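(* Let $(\mathbb E;B,Q;M)$ be an LA-Courant algebroid and choose a Lagrangian splitting. Let $(\partial_B:Q^*\to B,\Delta,\nabla,R_Q)$ be the Dorfman $2$-representation of $(Q,\rho_Q)$ and $(\partial_Q:Q^*\to Q,\nabla^Q,\nabla^{Q^*},R_B)$ the $2$-representation of the Lie algebroid $B$ defined by this splitting. Then the core $Q^*$ inherits the structure of a degenerate Courant algebroid over $M$, with the anchor $\rho_Q\circ\partial_Q$, the map $\mathcal D=\rho_Q^*\mathbf d:C^\infty(M)\to\Gamma(Q^* )$, the pairing $\langle\tau_1,\tau_2\rangle_{Q^*}=\langle\tau_1,\partial_Q\tau_2\rangle$ and the bracket $$[\![\tau_1,\tau_2]\!]_{Q^*}=\Delta_{\partial_Q\tau_1}\tau_2-\nabla^{Q^*}_{\partial_B\tau_2}\tau_1,\qquad\tau_1,\tau_2\in\Gamma(Q^* ).$$ This structure does not depend on the choice of the Lagrangian splitting, and the map $\partial_B:Q^*\to B$ preserves the brackets and the anchors.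
   Context: **Degenerate Courant algebroid** over $M$: a vector bundle $\mathsf E\to M$ with anchor $\rho:\mathsf E\to TM$, a (possibly degenerate) symmetric fibrewise pairing, a map $\mathcal D:C^\infty(M)\to\Gamma(\mathsf E)$ with $\langle\mathcal Df,e\rangle=\rho(e)(f)$, and an $\mathbb R$-bilinear bracket on $\Gamma(\mathsf E)$ such that (CA1) $[\![e_1,[\![e_2,e_3]\!]]\!]=[\![[\![e_1,e_2]\!],e_3]\!]+[\![e_2,[\![e_1,e_3]\!]]\!]$; (CA2) $\rho(e_1)\langle e_2,e_3\rangle=\langle[\![e_1,e_2]\!],e_3\rangle+\langle e_2,[\![e_1,e_3]\!]\rangle$; (CA3) $[\![e_1,e_2]\!]+[\![e_2,e_1]\!]=\mathcal D\langle e_1,e_2\rangle$; (CA4) $\rho[\![e_1,e_2]\!]=[\rho(e_1),\rho(e_2)]$; (CA5) $[\![e_1,fe_2]\!]=f[\![e_1,e_2]\!]+(\rho(e_1)f)e_2$. A Courant algebroid is one with nondegenerate pairing. $\overline{\mathsf E}$: opposite pairing. Dirac structure with support in a Courant algebroid $\mathsf E\to N$: subbundle $D\to S$ over a submanifold $S\subseteq N$, $D(s)$ maximal isotropic for $s\in S$, $e_1|_S,e_2|_S\in\Gamma_S(D)\Rightarrow[\![e_1,e_2]\!]|_S\in\Gamma_S(D)$ for $e_i\in\Gamma(\mathsf E)$. **Double vector bundles.** $(\mathbb E;Q,B;M)$: commutative square of vector bundles $\pi_Q:\mathbb E\to Q$, $\pi_B:\mathbb E\to B$, $Q\to M$, $q_B:B\to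 M$ such that the structure maps of $\mathbb E\to B$ are vector bundle morphisms over those of $Q\to M$; core $C=\ker\pi_Q\cap\ker\pi_B$. Core sections of $\mathbb E\to B$: $c^\dagger(b_m)=0_{b_m}+_Q\overline{c(m)}$, $c\in\Gamma(C)$; linear sections: sections that are vector bundle morphisms $(B\to M)\to(\mathbb E\to Q)$ over some $q\in\Gamma(Q)$; for $\phi\in\Gamma(\mathrm{Hom}(B,C))$, $\widetilde\phi(b_m)=0_{b_m}+_Q\overline{\phi(b_m)}$. Similarly for $\mathbb E\to Q$. A bracket is linear if linear/linear gives linear, linear/core gives core, core/core gives $0$. Linear splitting $\Sigma:Q\times_MB\to\mathbb E$: injective double vector bundle morphism over the identities on the sides; $\sigma_Q(q)(b_m)=\Sigma(q(m),b_m)$, $\sigma_B(b)(q_m)=\Sigma(q_m,b(m))$. Metric double vector bundle: symmetric nondegenerate pairing on $\mathbb E\to B$ inducing an isomorphism of double vector bundles $\mathbb E\to\mathbb E^*_B$ (dual over $B$); the core is then identified with $Q^*$. Lagrangian splitting: image maximal isotropic in $\mathbb E\to B$. $b^\uparrow$: vertical lift. For a derivation $D$ of $\Gamma(B)$ over $X$, $\widehat D\in\mathfrak X(B)$: $\widehat D(q_B^*f)=q_B^*(Xf)$, $\widehat D(\ell_\beta)=\ell_{D^*\beta}$ ($\ell_\beta$ the linear function of $\beta\in\Gamma(B^* )$). **VB-Courant algebroid**: metric double vector bundle with Courant algebroid structure on $\mathbb E\to B$, anchor $\Theta:\mathbb E\to TB$ a double vector bundle morphism over $\rho_Q:Q\to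 TM$, linear bracket. A Lagrangian splitting defines $(\partial_B,\Delta,\nabla,R_Q)$ (a Dorfman $2$-representation) by $\Theta(\tau^\dagger)=(\partial_B\tau)^\uparrow$, $\Theta(\sigma_Q(q))=\widehat{\nabla_q}$, $[\![\sigma_Q(q),\tau^\dagger]\!]=(\Delta_q\tau)^\dagger$, and $[\![\sigma_Q(q_1),\sigma_Q(q_2)]\!]=\sigma_Q([\![q_1,q_2]\!]_\Delta)-\widetilde{R_Q(q_1,q_2)}$, where $\langle[\![q_1,q_2]\!]_\Delta,\tau\rangle=\rho_Q(q_1)\langle q_2,\tau\rangle-\langle q_2,\Delta_{q_1}\tau\rangle$. **VB-algebroid** $(\mathbb E\to Q;B\to M)$: Lie algebroid $\mathbb E\to Q$ with anchor $\mathbb E\to TQ$ a double vector bundle morphism over some $\rho_B:B\to TM$ and linear bracket; $B$ is then a Lie algebroid. A splitting defines a $2$-representation by: the anchor of $\tau^\dagger$ is $(\partial_Q\tau)^\uparrow$, the anchor of $\sigma_B(b)$ is $\widehat{\nabla^Q_b}$, $[\sigma_B(b),\tau^\dagger]=(\nabla^{Q^*}_b\tau)^\dagger$, $[\sigma_B(b_1),\sigma_B(b_2)]=\sigma_B[b_1,b_2]-\widetilde{R_B(b_1,b_2)}$. **LA-Courant algebroid.** For a Lie algebroid $(A\to N,\rho_A,[\cdot,\cdot])$ let $\Pi_A\subseteq TA\times TA$ be the set of pairs $\bigl(T_nb(\rho_A(a(n)))+([b,a]+c)^\uparrow(b(n)),\ T_na(\rho_A(b(n)))+c^\uparrow(a(n))\bigr)$,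 $a,b,c\in\Gamma(A)$, $n\in N$. For a Courant algebroid $\mathsf E\to N$, the tangent Courant algebroid $T\mathsf E\to TN$ is determined, with $e^\times(v_n)=T_n0^{\mathsf E}(v_n)+\frac{d}{dt}|_{t=0}te(n)$, by $\langle Te_1,Te_2\rangle=\ell_{\mathbf d\langle e_1,e_2\rangle}$, $\langle Te_1,e_2^\times\rangle=p_N^*\langle e_1,e_2\rangle$, $\langle e_1^\times,e_2^\times\rangle=0$, $[\![Te_1,Te_2]\!]=T[\![e_1,e_2]\!]$, $[\![Te_1,e_2^\times]\!]=[\![e_1,e_2]\!]^\times=[\![e_1^\times,Te_2]\!]$, $[\![e_1^\times,e_2^\times]\!]=0$, with anchors the complete (for $Te$) and vertical (for $e^\times$) lifts of $\rho(e)$. An LA-Courant algebroid is a double vector bundle $(\mathbb E;Q,B;M)$ with a VB-Courant algebroid structure (over $B$) and a VB-algebroid structure $(\mathbb E\to Q;B\to M)$ such that $\Pi_{\mathbb E}$ (for $\mathbb E\to Q$) is a Dirac structure with support in $\overline{T\mathbb E}\times T\mathbb E\to TB\times TB$. *)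

(* Defs.v *)
From HB Require Import structures.
From mathcomp Require Import all_boot all_order all_algebra.
From mathcomp Require Import all_classical all_reals all_analysis.

Set Implicit Arguments.
Unset Strict Implicit.
Unset Printing Implicit Defensive.

Import Order.TTheory GRing.Theory Num.Theory.
Import numFieldNormedType.Exports.

Local Open Scope classical_set_scope.
Local Open Scope ring_scope.

(* Conventions.  Structures are split into raw operations (records of data) and
   predicates asserting their axioms.  Operations on a vector bundle are total
   functions on the total space and are only meaningful on elements of a common
   fibre; operators on sections are total functions on all maps M -> E and are
   only meaningful on smooth sections.  The predicates say nothing elsewhere. *)

Definition choose_or (T : Type) (d : T) (P : T -> Prop) : T :=
  if pselect (exists x, P x) is left h then sval (cid h) else d.

Fixpoint Ck (R : realType) (V : normedModType R) (k : nat) (f : V -> R) : Prop :=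
  continuous f /\
  if k is k'.+1 then
    forall v : V, (forall x, derivable f x v) /\ Ck k' (fun x => 'D_v f x)
  else True.

Definition Cinf (R : realType) (V : normedModType R) (f : V -> R) : Prop :=
  forall k, Ck k f.

(* A manifold is presented by its algebra of globally defined smooth functions.
   The bare record carries no axioms: see [is_manifold]. *)
Record smoothSpace (R : realType) := SmoothSpace {
  carrier :> Type;
  sfun : (carrier -> R) -> Prop
}.

Section SmoothSpaces.
Variable R : realType.

Definition vspace (V : normedModType R) : smoothSpace R :=
  @SmoothSpace R V (@Cinf R V).

(* Functions that are locally, for the initial topology of [G], smooth functions
   of finitely many elements of [G]. *)
Definition gen (X : Type) (G : (X -> R) -> Prop) (f : X -> R) : Prop :=
  forall x, exists k (g : 'I_k -> X -> R) (phi : 'rV[R]_k -> R) (eps : R),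
    [/\ forall i, G (g i), Cinf phi, 0 < eps &
        forall y, (forall i, `|g i y - g i x| < eps) ->
          f y = phi (\row_i g i y)].

Definition prodS (X Y : smoothSpace R) : smoothSpace R :=
  @SmoothSpace R (X * Y)%type (gen (fun h =>
    (exists2 f, sfun f & h = (fun p => f p.1)) \/
    (exists2 g, sfun g & h = (fun p => g p.2)))).

Definition subS (X : smoothSpace R) (P : X -> Prop) : smoothSpace R :=
  @SmoothSpace R {x : X | P x} (gen (fun h =>
    exists2 f, sfun f & h = (fun p => f (sval p)))).

(* Open sets of the initial topology of the smooth functions. *)
Definition sopen (X : smoothSpace R) (U : X -> Prop) : Prop :=
  forall x, U x ->
    exists f, [/\ sfun f, f x <> 0 & forall y, f y <> 0 -> U y].

Definition smooth_at (X : smoothSpace R) (f : X -> R) (x : X) : Prop :=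
  exists g (U : X -> Prop),
    [/\ sfun g, sopen U, U x & forall y, U y -> f y = g y].

Definition smooth_map (X Y : smoothSpace R) (phi : X -> Y) : Prop :=
  forall h, sfun h -> sfun (fun x => h (phi x)).

Definition smooth_on (X Y : smoothSpace R) (U : X -> Prop) (phi : X -> Y) : Prop :=
  forall h, sfun h -> forall x, U x -> smooth_at (fun y => h (phi y)) x.

Definition diffeo_on (X Y : smoothSpace R) (U : X -> Prop) (V : Y -> Prop)
    (phi : X -> Y) (psi : Y -> X) : Prop :=
  [/\ forall x, U x -> V (phi x) /\ psi (phi x) = x,
      forall y, V y -> U (psi y) /\ phi (psi y) = y,
      smooth_on U phi & smooth_on V psi].

Definition is_manifold (X : smoothSpace R) : Prop :=
  [/\ (* [sfun] is closed under smooth operations and is local *)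
      (forall f : X -> R, gen (@sfun R X) f -> sfun f),
      (* Hausdorff *)
      (forall x y : X, (forall f, sfun f -> f x = f y) -> x = y),
      (* second countable *)
      (exists u : nat -> X -> R, (forall n, sfun (u n)) /\
        forall U x, sopen U -> U x ->
          exists n, u n x <> 0 /\ forall y, u n y <> 0 -> U y) &
      (* charts *)
      exists n, forall x : X,
        exists U (V : vspace 'rV[R]_n -> Prop) phi psi,
          [/\ sopen U, U x, sopen V & diffeo_on U V phi psi]].

(* The induced structure on [S] being that of a manifold means that [S] is an
   embedded submanifold. *)
Definition is_submanifold (X : smoothSpace R) (S : X -> Prop) : Prop :=
  is_manifold (subS S).

(* Tangent vectors are derivations of the algebra of smooth functions; the value
   on non-smooth functions is normalised to 0, so that Leibniz equality is the
   equality of tangent vectors. *)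
Definition is_tangent (X : smoothSpace R) (x : X) (v : (X -> R) -> R) : Prop :=
  [/\ forall f, ~ sfun f -> v f = 0,
      forall f g, sfun f -> sfun g -> v (fun y => f y + g y) = v f + v g,
      forall a f, sfun f -> v (fun y => a * f y) = a * v f &
      forall f g, sfun f -> sfun g ->
        v (fun y => f y * g y) = v f * g x + f x * v g].

Record tvec (X : smoothSpace R) := TVec {
  tpt : X;
  tval : (X -> R) -> R;
  tvalP : is_tangent tpt tval
}.

Lemma is_tangent0 (X : smoothSpace R) (x : X) : is_tangent x (fun=> 0).
Proof. by split=> *; rewrite ?addr0 ?mulr0 ?mul0r ?addr0. Qed.

(* The tangent vector at [x] acting on smooth functions as [v]; it is 0 if [v]
   does not restrict to a derivation at [x]. *)
Definition mktvec (X : smoothSpace R) (x : X) (v : (X -> R) -> R) : tvec X :=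
  let w := fun f => if `[< sfun f >] then v f else 0 in
  if pselect (is_tangent x w) is left h then TVec h else TVec (is_tangent0 x).

Definition TS (X : smoothSpace R) : smoothSpace R :=
  @SmoothSpace R (tvec X) (gen (fun h =>
    (exists2 f, sfun f & h = (fun v : tvec X => f (tpt v))) \/
    (exists2 f, sfun f & h = (fun v : tvec X => tval v f)))).

Definition Tmap (X Y : smoothSpace R) (phi : X -> Y) (v : TS X) : TS Y :=
  mktvec (phi (tpt v)) (fun f => tval v (fun x => f (phi x))).

Definition velocity (X : smoothSpace R) (c : R -> X) : TS X :=
  mktvec (c 0) (fun f => derive1 (fun t : R => f (c t)) 0).

Definition smooth_curve (X : smoothSpace R) (c : R -> X) : Prop :=
  @smooth_map (vspace R) X c.

Record vb_ops (E M : smoothSpace R) := VBOps {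
  vproj : E -> M;
  vzero : M -> E;
  vadd : E -> E -> E;
  vscale : R -> E -> E
}.

Section VB.
Variables (E M : smoothSpace R) (V : vb_ops E M).

Definition vsub (x y : E) : E := vadd V x (vscale V (-1) y).

Definition lincomb (k : nat) (m : M) (a : 'rV[R]_k) (s : 'I_k -> M -> E) : E :=
  \big[vadd V/vzero V m]_(i < k) vscale V (a 0 i) (s i m).

Definition is_fibrewise_vspace : Prop :=
  [/\ forall m, vproj V (vzero V m) = m,
      forall x y, vproj V x = vproj V y -> vproj V (vadd V x y) = vproj V x &
      forall t x, vproj V (vscale V t x) = vproj V x] /\
  [/\ forall x y, vproj V x = vproj V y -> vadd V x y = vadd V y x,
      forall x y z, vproj V x = vproj V y -> vproj V y = vproj V z ->
        vadd V x (vadd V y z) = vadd V (vadd V x y) z,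
      forall x, vadd V x (vzero V (vproj V x)) = x &
      forall x, vsub x x = vzero V (vproj V x)] /\
  [/\ forall x, vscale V 1 x = x,
      forall s t x, vscale V s (vscale V t x) = vscale V (s * t) x,
      forall s t x, vscale V (s + t) x = vadd V (vscale V s x) (vscale V t x) &
      forall t x y, vproj V x = vproj V y ->
        vscale V t (vadd V x y) = vadd V (vscale V t x) (vscale V t y)].

Definition is_locally_trivial : Prop :=
  exists k, forall m, exists (U : M -> Prop) (lam : E -> 'rV[R]_k)
      (psi : M * 'rV[R]_k -> E),
    [/\ sopen U, U m,
        @diffeo_on E (prodS M (vspace 'rV[R]_k))
          (fun x => U (vproj V x)) (fun p => U p.1)
          (fun x => (vproj V x, lam x)) psi,
        forall x y, U (vproj V x) -> vproj V x = vproj V y ->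
          lam (vadd V x y) = lam x + lam y &
        forall t x, U (vproj V x) -> lam (vscale V t x) = t *: lam x].

Definition is_vbundle : Prop :=
  [/\ is_manifold E, is_manifold M, smooth_map (vproj V),
      is_fibrewise_vspace & is_locally_trivial].

Definition section (s : M -> E) : Prop :=
  smooth_map s /\ forall m, vproj V (s m) = m.

Definition sadd (s1 s2 : M -> E) : M -> E := fun m => vadd V (s1 m) (s2 m).
Definition sscale (f : M -> R) (s : M -> E) : M -> E :=
  fun m => vscale V (f m) (s m).

(* c^uparrow at x, for x and c in a common fibre *)
Definition vlift (x c : E) : TS E :=
  velocity (fun t => vadd V x (vscale V t c)).

Definition fibrewise_linear (l : E -> R) : Prop :=
  (forall x y, vproj V x = vproj V y -> l (vadd V x y) = l x + l y) /\
  (forall t x, l (vscale V t x) = t * l x).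

(* [L] is a maximal isotropic subspace of the fibre over [m]. *)
Definition isotropic_subspace (pair : E -> E -> R) (m : M) (L : E -> Prop) : Prop :=
  [/\ forall x, L x -> vproj V x = m,
      L (vzero V m),
      forall x y, L x -> L y -> L (vadd V x y),
      forall t x, L x -> L (vscale V t x) &
      forall x y, L x -> L y -> pair x y = 0].

Definition maximal_isotropic (pair : E -> E -> R) (m : M) (L : E -> Prop) : Prop :=
  isotropic_subspace pair m L /\
  forall L', isotropic_subspace pair m L' -> (forall x, L x -> L' x) ->
    forall x, L' x -> L x.

(* [D] is a subbundle, over [S], of the restriction of [E] to [S]. *)
Definition is_subbundle (D : E -> Prop) (S : M -> Prop) : Prop :=
  (forall x, D x -> S (vproj V x)) /\
  exists k, forall m, S m -> exists (U : M -> Prop) (s : 'I_k -> M -> E),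
    [/\ sopen U, U m, forall i, section (s i) &
        forall n, U n -> S n ->
          (forall a, D (lincomb n a s)) /\
          (forall x, D x -> vproj V x = n ->
             exists! a : 'rV[R]_k, x = lincomb n a s)].

End VB.

Definition vb_morphism (E M E' M' : smoothSpace R) (V : vb_ops E M)
    (V' : vb_ops E' M') (Phi : E -> E') (phi : M -> M') : Prop :=
  [/\ smooth_map Phi, smooth_map phi,
      forall x, vproj V' (Phi x) = phi (vproj V x),
      forall x y, vproj V x = vproj V y ->
        Phi (vadd V x y) = vadd V' (Phi x) (Phi y) &
      forall t x, Phi (vscale V t x) = vscale V' t (Phi x)].

Definition tangent_vb (M : smoothSpace R) : vb_ops (TS M) M := {|
  vproj := fun v : TS M => tpt v;
  vzero := fun m => mktvec m (fun=> 0);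
  vadd := fun v w : TS M => mktvec (tpt v) (fun f => tval v f + tval w f);
  vscale := fun t (v : TS M) => mktvec (tpt v) (fun f => t * tval v f)
|}.

(* The tangent prolongation TE -> TM: the tangent functor is applied to all
   structure maps.  The tangent of the addition E x_M E -> E is computed on
   velocities of smooth curves in E x_M E. *)
Definition Tvb (E M : smoothSpace R) (V : vb_ops E M) : vb_ops (TS E) (TS M) := {|
  vproj := Tmap (vproj V);
  vzero := Tmap (vzero V);
  vadd := fun v w : TS E =>
    choose_or (Tmap (vzero V) (Tmap (vproj V) v)) (fun u =>
      exists c d : R -> E,
        [/\ smooth_curve c, smooth_curve d,
            forall t, vproj V (c t) = vproj V (d t),
            velocity c = v /\ velocity d = w &
            u = velocity (fun t => vadd V (c t) (d t))]);
  vscale := fun t => Tmap (vscale V t)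
|}.

Definition prod_vb (E1 M1 E2 M2 : smoothSpace R) (V1 : vb_ops E1 M1)
    (V2 : vb_ops E2 M2) : vb_ops (prodS E1 E2) (prodS M1 M2) := {|
  vproj := fun x : prodS E1 E2 => (vproj V1 x.1, vproj V2 x.2) : prodS M1 M2;
  vzero := fun m : prodS M1 M2 => (vzero V1 m.1, vzero V2 m.2) : prodS E1 E2;
  vadd := fun x y : prodS E1 E2 =>
    (vadd V1 x.1 y.1, vadd V2 x.2 y.2) : prodS E1 E2;
  vscale := fun t (x : prodS E1 E2) =>
    (vscale V1 t x.1, vscale V2 t x.2) : prodS E1 E2
|}.

Record lie_ops (A N : smoothSpace R) := LieOps {
  lanchor : A -> TS N;
  lbr : (N -> A) -> (N -> A) -> (N -> A)
}.

Definition is_bilinear_bracket (A N : smoothSpace R) (V : vb_ops A N)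
    (br : (N -> A) -> (N -> A) -> (N -> A)) : Prop :=
  [/\ forall a b, section V a -> section V b -> section V (br a b),
      forall a b c, section V a -> section V b -> section V c ->
        br (sadd V a b) c = sadd V (br a c) (br b c) /\
        br c (sadd V a b) = sadd V (br c a) (br c b) &
      forall (t : R) a b, section V a -> section V b ->
        br (sscale V (fun=> t) a) b = sscale V (fun=> t) (br a b) /\
        br a (sscale V (fun=> t) b) = sscale V (fun=> t) (br a b)].

Definition anchor_preserves (A N : smoothSpace R) (V : vb_ops A N)
    (rho : A -> TS N) (br : (N -> A) -> (N -> A) -> (N -> A)) : Prop :=
  forall a b, section V a -> section V b -> forall (f : N -> R) n, sfun f ->
    tval (rho (br a b n)) f =
      tval (rho (a n)) (fun m => tval (rho (b m)) f) -
      tval (rho (b n)) (fun m => tval (rho (a m)) f).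

Definition leibniz (A N : smoothSpace R) (V : vb_ops A N)
    (rho : A -> TS N) (br : (N -> A) -> (N -> A) -> (N -> A)) : Prop :=
  forall a b, section V a -> section V b -> forall f : N -> R, sfun f ->
    br a (sscale V f b) =
      sadd V (sscale V f (br a b)) (sscale V (fun n => tval (rho (a n)) f) b).

Definition jacobi (A N : smoothSpace R) (V : vb_ops A N)
    (br : (N -> A) -> (N -> A) -> (N -> A)) : Prop :=
  forall a b c, section V a -> section V b -> section V c ->
    br a (br b c) = sadd V (br (br a b) c) (br b (br a c)).

Definition is_lie_algebroid (A N : smoothSpace R) (V : vb_ops A N)
    (l : lie_ops A N) : Prop :=
  [/\ is_vbundle V, vb_morphism V (tangent_vb N) (lanchor l) id &
      is_bilinear_bracket V (lbr l)] /\
  [/\ forall a b, section V a -> section V b ->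
        lbr l a b = sscale V (fun=> -1) (lbr l b a),
      jacobi V (lbr l), leibniz V (lanchor l) (lbr l) &
      anchor_preserves V (lanchor l) (lbr l)].

Record courant_ops (E N : smoothSpace R) := CourantOps {
  canchor : E -> TS N;
  cpair : E -> E -> R;
  cD : (N -> R) -> (N -> E);
  cbr : (N -> E) -> (N -> E) -> (N -> E)
}.

Definition spair (E N : smoothSpace R) (pair : E -> E -> R) (s1 s2 : N -> E) :
  N -> R := fun n => pair (s1 n) (s2 n).

Definition is_fibre_pairing (E N : smoothSpace R) (V : vb_ops E N)
    (pair : E -> E -> R) : Prop :=
  [/\ forall x y, vproj V x = vproj V y -> pair x y = pair y x,
      forall x y z, vproj V x = vproj V y -> vproj V y = vproj V z ->
        pair (vadd V x y) z = pair x z + pair y z,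
      forall t x y, vproj V x = vproj V y -> pair (vscale V t x) y = t * pair x y &
      forall s1 s2, section V s1 -> section V s2 -> sfun (spair pair s1 s2)].

Definition nondegenerate (E N : smoothSpace R) (V : vb_ops E N)
    (pair : E -> E -> R) : Prop :=
  forall x, (forall y, vproj V y = vproj V x -> pair x y = 0) ->
    x = vzero V (vproj V x).

Definition is_degenerate_courant (E N : smoothSpace R) (V : vb_ops E N)
    (c : courant_ops E N) : Prop :=
  [/\ is_vbundle V, vb_morphism V (tangent_vb N) (canchor c) id,
      is_fibre_pairing V (cpair c), is_bilinear_bracket V (cbr c) &
      forall f : N -> R, sfun f -> section V (cD c f) /\
        forall x, cpair c (cD c f (vproj V x)) x = tval (canchor c x) f] /\
  [/\ jacobi V (cbr c),
      forall e1 e2 e3, section V e1 -> section V e2 -> section V e3 ->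
        forall n, tval (canchor c (e1 n)) (spair (cpair c) e2 e3) =
          cpair c (cbr c e1 e2 n) (e3 n) + cpair c (e2 n) (cbr c e1 e3 n),
      forall e1 e2, section V e1 -> section V e2 ->
        sadd V (cbr c e1 e2) (cbr c e2 e1) = cD c (spair (cpair c) e1 e2),
      anchor_preserves V (canchor c) (cbr c) &
      leibniz V (canchor c) (cbr c)].

Definition is_courant (E N : smoothSpace R) (V : vb_ops E N)
    (c : courant_ops E N) : Prop :=
  is_degenerate_courant V c /\ nondegenerate V (cpair c).

Definition opp_courant (E N : smoothSpace R) (V : vb_ops E N)
    (c : courant_ops E N) : courant_ops E N := {|
  canchor := canchor c;
  cpair := fun x y => - cpair c x y;
  cD := fun f => sscale V (fun=> -1) (cD c f);
  cbr := cbr c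
|}.

Definition is_product_courant (E1 N1 E2 N2 : smoothSpace R)
    (V1 : vb_ops E1 N1) (V2 : vb_ops E2 N2) (c1 : courant_ops E1 N1)
    (c2 : courant_ops E2 N2) (c : courant_ops (prodS E1 E2) (prodS N1 N2)) : Prop :=
  let pull (e1 : N1 -> E1) (e2 : N2 -> E2) : prodS N1 N2 -> prodS E1 E2 :=
    fun n => (e1 n.1, e2 n.2) in
  [/\ is_courant (prod_vb V1 V2) c,
      forall x y : prodS E1 E2,
        vproj (prod_vb V1 V2) x = vproj (prod_vb V1 V2) y ->
        cpair c x y = cpair c1 x.1 y.1 + cpair c2 x.2 y.2,
      forall (x : prodS E1 E2) (f : prodS N1 N2 -> R), sfun f ->
        tval (canchor c x) f =
          tval (canchor c1 x.1) (fun n => f (n, vproj V2 x.2)) +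
          tval (canchor c2 x.2) (fun n => f (vproj V1 x.1, n)) &
      forall e1 e2 e1' e2', section V1 e1 -> section V2 e2 ->
        section V1 e1' -> section V2 e2' ->
        cbr c (pull e1 e2) (pull e1' e2') = pull (cbr c1 e1 e1') (cbr c2 e2 e2')].

Definition is_dirac (E N : smoothSpace R) (V : vb_ops E N) (c : courant_ops E N)
    (D : E -> Prop) : Prop :=
  exists S : N -> Prop,
    [/\ is_submanifold S, is_subbundle V D S,
        forall n, S n ->
          maximal_isotropic V (cpair c) n (fun x => D x /\ vproj V x = n) &
        forall e1 e2, section V e1 -> section V e2 ->
          (forall n, S n -> D (e1 n)) -> (forall n, S n -> D (e2 n)) ->
          forall n, S n -> D (cbr c e1 e2 n)].

Definition is_complete_lift (N : smoothSpace R) (X : N -> TS N)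
    (Y : TS N -> TS (TS N)) : Prop :=
  forall (v : TS N), tpt (Y v) = v /\ forall f : N -> R, sfun f ->
    tval (Y v) (fun w : TS N => f (tpt w)) = tval (X (tpt v)) f /\
    tval (Y v) (fun w : TS N => tval w f) = tval v (fun n => tval (X n) f).

(* The core section e^times of TE -> TN *)
Definition cross (E N : smoothSpace R) (V : vb_ops E N) (e : N -> E) :
    TS N -> TS E :=
  fun v => vadd (tangent_vb E) (Tmap (vzero V) v)
             (velocity (fun t => vscale V t (e (tpt v)))).

Definition is_tangent_courant (E N : smoothSpace R) (V : vb_ops E N)
    (c : courant_ops E N) (cT : courant_ops (TS E) (TS N)) : Prop :=
  is_courant (Tvb V) cT /\
  forall e1 e2, section V e1 -> section V e2 ->
  [/\ forall v, cpair cT (Tmap e1 v) (Tmap e2 v) = tval v (spair (cpair c) e1 e2),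
      forall v, cpair cT (Tmap e1 v) (cross V e2 v) =
        spair (cpair c) e1 e2 (tpt v) &
      forall v, cpair cT (cross V e1 v) (cross V e2 v) = 0] /\
  [/\ cbr cT (Tmap e1) (Tmap e2) = Tmap (cbr c e1 e2),
      cbr cT (Tmap e1) (cross V e2) = cross V (cbr c e1 e2),
      cbr cT (cross V e1) (Tmap e2) = cross V (cbr c e1 e2) &
      cbr cT (cross V e1) (cross V e2) = vzero (Tvb V)] /\
  is_complete_lift (fun n => canchor c (e1 n)) (fun v => canchor cT (Tmap e1 v)) /\
  forall v, canchor cT (cross V e1 v) =
    vlift (tangent_vb N) v (canchor c (e1 (tpt v))).

(* Operations of a double vector bundle (E; Q, B; M) with core C; [dcore] is the
   inclusion of the core, denoted by an overline in formulas. *)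
Record dvb_ops (E Q B C M : smoothSpace R) := DVBOps {
  dEQ : vb_ops E Q;
  dEB : vb_ops E B;
  dQM : vb_ops Q M;
  dBM : vb_ops B M;
  dCM : vb_ops C M;
  dcore : C -> E
}.

Definition flip (E Q B C M : smoothSpace R) (D : dvb_ops E Q B C M) :
    dvb_ops E B Q C M :=
  {| dEQ := dEB D; dEB := dEQ D; dQM := dBM D; dBM := dQM D;
     dCM := dCM D; dcore := dcore D |}.

(* The dvb (TB; TM, B; M), with core B *)
Definition Tdvb (B M : smoothSpace R) (V : vb_ops B M) :
    dvb_ops (TS B) (TS M) B B M :=
  {| dEQ := Tvb V; dEB := tangent_vb B; dQM := tangent_vb M; dBM := V; dCM := V;
     dcore := fun b => vlift V (vzero V (vproj V b)) b |}.

Section DVB.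
Variables (E Q B C M : smoothSpace R) (D : dvb_ops E Q B C M).
Let EQ := dEQ D.
Let EB := dEB D.
Let QM := dQM D.
Let BM := dBM D.

(* The projection, addition, scalar multiplication and zero section of E -> B
   are vector bundle morphisms over those of Q -> M. *)
Definition is_dvb : Prop :=
  [/\ is_vbundle EQ, is_vbundle EB, is_vbundle QM, is_vbundle BM &
      is_vbundle (dCM D)] /\
  [/\ vb_morphism EQ BM (vproj EB) (vproj QM),
      vb_morphism BM EQ (vzero EB) (vzero QM),
      forall t, vb_morphism EQ EQ (vscale EB t) (vscale QM t),
      (forall x y, vproj EB x = vproj EB y ->
        vproj EQ (vadd EB x y) = vadd QM (vproj EQ x) (vproj EQ y)) /\
      (forall t x y, vproj EB x = vproj EB y ->
        vscale EQ t (vadd EB x y) = vadd EB (vscale EQ t x) (vscale EQ t y)) &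
      forall x1 x2 y1 y2, vproj EB x1 = vproj EB x2 -> vproj EB y1 = vproj EB y2 ->
        vproj EQ x1 = vproj EQ y1 -> vproj EQ x2 = vproj EQ y2 ->
        vadd EQ (vadd EB x1 x2) (vadd EB y1 y2) =
        vadd EB (vadd EQ x1 y1) (vadd EQ x2 y2)] /\
  [/\ vb_morphism (dCM D) EB (dcore D) (vzero BM),
      vb_morphism (dCM D) EQ (dcore D) (vzero QM),
      injective (dcore D) &
      forall x m, vproj EQ x = vzero QM m -> vproj EB x = vzero BM m ->
        exists c, x = dcore D c].

(* \widetilde{phi} for phi : B -> C over the identity of M *)
Definition core_hom (phi : B -> C) : B -> E :=
  fun b => vadd EQ (vzero EB b) (dcore D (phi b)).

(* The core section c^dagger of E -> B *)
Definition core_section (c : M -> C) : B -> E :=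
  core_hom (fun b => c (vproj BM b)).

(* [chi] is a linear section of E -> B over the section [q] of Q -> M. *)
Definition linear_section (chi : B -> E) (q : M -> Q) : Prop :=
  [/\ section EB chi, section QM q & vb_morphism BM EQ chi q].

Definition is_linear_bracket (br : (B -> E) -> (B -> E) -> (B -> E)) : Prop :=
  [/\ forall chi1 chi2 q1 q2, linear_section chi1 q1 -> linear_section chi2 q2 ->
        exists q, linear_section (br chi1 chi2) q,
      forall chi q c, linear_section chi q -> section (dCM D) c ->
        exists2 c', section (dCM D) c' &
          br chi (core_section c) = core_section c' &
      forall c1 c2, section (dCM D) c1 -> section (dCM D) c2 ->
        br (core_section c1) (core_section c2) = vzero EB].

Definition is_splitting (Sg : Q -> B -> E) : Prop :=
  [/\ @smooth_map
        (@subS (prodS Q B) (fun p => vproj QM p.1 = vproj BM p.2)) E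
        (fun p => Sg (sval p).1 (sval p).2),
      forall q b, vproj QM q = vproj BM b ->
        vproj EQ (Sg q b) = q /\ vproj EB (Sg q b) = b,
      forall q q' b, vproj QM q = vproj BM b -> vproj QM q' = vproj BM b ->
        Sg (vadd QM q q') b = vadd EB (Sg q b) (Sg q' b),
      forall q b b', vproj QM q = vproj BM b -> vproj QM q = vproj BM b' ->
        Sg q (vadd BM b b') = vadd EQ (Sg q b) (Sg q b') &
      forall t q b, vproj QM q = vproj BM b ->
        Sg (vscale QM t q) b = vscale EB t (Sg q b) /\
        Sg q (vscale BM t b) = vscale EQ t (Sg q b)].

Definition is_lagrangian_splitting (pair : E -> E -> R) (Sg : Q -> B -> E) : Prop :=
  is_splitting Sg /\
  forall b, maximal_isotropic EB pair b
    (fun x => exists2 q, vproj QM q = vproj BM b & x = Sg q b).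

Definition sigmaQ (Sg : Q -> B -> E) (q : M -> Q) : B -> E :=
  fun b => Sg (q (vproj BM b)) b.

Definition sigmaB (Sg : Q -> B -> E) (b : M -> B) : Q -> E :=
  fun q => Sg q (b (vproj QM q)).

(* [pair] is a metric on E -> B.  The map E -> E^*_B is a morphism of double
   vector bundles from (E; Q, B; M) to (E^*_B; C^*, B; M): [ev] is the map
   Q -> C^* between the sides (the projection E^*_B -> C^* sends Phi over b to
   c |-> Phi (0_b +_Q c)), and the last two clauses are linearity for the
   structure of E^*_B -> C^*, where
   (Phi1 + Phi2) (xi1 +_Q xi2) = Phi1 xi1 + Phi2 xi2 and
   (t . Phi) (t ._Q xi) = t Phi xi.
   Through [ev], the core C is identified with Q^*. *)
Definition is_metric (pair : E -> E -> R) (ev : Q -> C -> R) : Prop :=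
  [/\ is_fibre_pairing EB pair, nondegenerate EB pair,
      forall x c, vproj BM (vproj EB x) = vproj (dCM D) c ->
        pair x (core_hom (fun=> c) (vproj EB x)) = ev (vproj EQ x) c,
      forall x1 x2 y1 y2, vproj EB x1 = vproj EB y1 -> vproj EB x2 = vproj EB y2 ->
        vproj EQ x1 = vproj EQ x2 -> vproj EQ y1 = vproj EQ y2 ->
        pair (vadd EQ x1 x2) (vadd EQ y1 y2) = pair x1 y1 + pair x2 y2 &
      forall t x y, vproj EB x = vproj EB y ->
        pair (vscale EQ t x) (vscale EQ t y) = t * pair x y].

End DVB.

Definition dvb_morphism (E Q B C M E' Q' B' C' M' : smoothSpace R)
    (D : dvb_ops E Q B C M) (D' : dvb_ops E' Q' B' C' M')
    (Phi : E -> E') (phiQ : Q -> Q') (phiB : B -> B') (phi : M -> M') : Prop :=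
  [/\ vb_morphism (dEQ D) (dEQ D') Phi phiQ, vb_morphism (dEB D) (dEB D') Phi phiB,
      vb_morphism (dQM D) (dQM D') phiQ phi & vb_morphism (dBM D) (dBM D') phiB phi].

Record vb_courant_ops (E Q B C M : smoothSpace R) := VBCourantOps {
  vc_courant : courant_ops E B;
  vc_ev : Q -> C -> R;
  vc_rhoQ : Q -> TS M
}.

Definition is_vb_courant (E Q B C M : smoothSpace R) (D : dvb_ops E Q B C M)
    (K : vb_courant_ops E Q B C M) : Prop :=
  let c := vc_courant K in
  [/\ is_dvb D, is_metric D (cpair c) (vc_ev K), is_courant (dEB D) c,
      dvb_morphism D (Tdvb (dBM D)) (canchor c) (vc_rhoQ K) id id &
      is_linear_bracket D (cbr c)].

(* [va_base] is the Lie algebroid structure induced on B. *)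
Record vb_algebroid_ops (E Q B M : smoothSpace R) := VBAlgebroidOps {
  va_lie : lie_ops E Q;
  va_base : lie_ops B M
}.

Definition is_vb_algebroid (E Q B C M : smoothSpace R) (D : dvb_ops E Q B C M)
    (L : vb_algebroid_ops E Q B M) : Prop :=
  let l := va_lie L in
  [/\ is_dvb D, is_lie_algebroid (dEQ D) l,
      dvb_morphism (flip D) (Tdvb (dQM D)) (lanchor l) (lanchor (va_base L)) id id,
      is_linear_bracket (flip D) (lbr l) &
      forall chi1 chi2 b1 b2, linear_section (flip D) chi1 b1 ->
        linear_section (flip D) chi2 b2 ->
        linear_section (flip D) (lbr l chi1 chi2) (lbr (va_base L) b1 b2)].

Definition Pi_rel (A N : smoothSpace R) (V : vb_ops A N) (l : lie_ops A N)
    (p : prodS (TS A) (TS A)) : Prop :=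
  exists a b c n, [/\ section V a, section V b, section V c,
    p.1 = vadd (tangent_vb A) (Tmap b (lanchor l (a n)))
            (vlift V (b n) (vadd V (lbr l b a n) (c n))) &
    p.2 = vadd (tangent_vb A) (Tmap a (lanchor l (b n))) (vlift V (a n) (c n))].

Definition is_la_courant (E Q B C M : smoothSpace R) (D : dvb_ops E Q B C M)
    (K : vb_courant_ops E Q B C M) (L : vb_algebroid_ops E Q B M) : Prop :=
  [/\ is_vb_courant D K, is_vb_algebroid D L &
      exists cT cP,
        [/\ is_tangent_courant (dEB D) (vc_courant K) cT,
            is_product_courant (Tvb (dEB D)) (Tvb (dEB D))
              (opp_courant (Tvb (dEB D)) cT) cT cP &
            is_dirac (prod_vb (Tvb (dEB D)) (Tvb (dEB D))) cP
              (Pi_rel (dEQ D) (va_lie L))]].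

(* [Del] is a derivation of the sections of B over the vector field [X], and
   [Y] is the vector field \widehat{Del} on B.  Here beta in Gamma(B^* ) is
   given by the function l = ell_beta, and D^*beta is evaluated on a section b:
   <D^*beta, b> = X <beta, b> - <beta, D b>. *)
Definition is_hat (B M : smoothSpace R) (V : vb_ops B M) (X : M -> TS M)
    (Del : (M -> B) -> (M -> B)) (Y : B -> TS B) : Prop :=
  [/\ forall b, section V b -> section V (Del b),
      forall b b', section V b -> section V b' ->
        Del (sadd V b b') = sadd V (Del b) (Del b'),
      forall (f : M -> R) b, sfun f -> section V b ->
        Del (sscale V f b) =
          sadd V (sscale V f (Del b)) (sscale V (fun m => tval (X m) f) b) &
      section (tangent_vb B) Y] /\
  (forall (f : M -> R) x, sfun f ->
    tval (Y x) (fun y => f (vproj V y)) = tval (X (vproj V x)) f) /\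
  forall l : B -> R, sfun l -> fibrewise_linear V l ->
    forall b m, section V b ->
      tval (Y (b m)) l = tval (X m) (fun n => l (b n)) - l (Del b m).

Record dorfman_rep (Q B C M : smoothSpace R) := DorfmanRep {
  dr_dB : C -> B;
  dr_Delta : (M -> Q) -> (M -> C) -> (M -> C);
  dr_nabla : (M -> Q) -> (M -> B) -> (M -> B);
  dr_R : (M -> Q) -> (M -> Q) -> (B -> C)
}.

Definition is_dorfman_rep (E Q B C M : smoothSpace R) (D : dvb_ops E Q B C M)
    (K : vb_courant_ops E Q B C M) (Sg : Q -> B -> E)
    (P : dorfman_rep Q B C M) : Prop :=
  let c := vc_courant K in let ev := vc_ev K in let rho := vc_rhoQ K in
  [/\ vb_morphism (dCM D) (dBM D) (dr_dB P) id /\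
      (forall tau, section (dCM D) tau -> forall b,
        canchor c (core_section D tau b) =
          vlift (dBM D) b (dr_dB P (tau (vproj (dBM D) b)))),
      forall q, section (dQM D) q ->
        is_hat (dBM D) (fun m => rho (q m)) (dr_nabla P q)
          (fun b => canchor c (sigmaQ D Sg q b)),
      forall q tau, section (dQM D) q -> section (dCM D) tau ->
        section (dCM D) (dr_Delta P q tau) /\
        cbr c (sigmaQ D Sg q) (core_section D tau) =
          core_section D (dr_Delta P q tau),
      forall q1 q2, section (dQM D) q1 -> section (dQM D) q2 ->
        vb_morphism (dBM D) (dCM D) (dr_R P q1 q2) id &
      (* [q12] is the bracket [[q1, q2]]_Delta *)
      forall q1 q2 q12, section (dQM D) q1 -> section (dQM D) q2 ->
        section (dQM D) q12 ->
        (forall tau m, section (dCM D) tau ->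
          ev (q12 m) (tau m) =
            tval (rho (q1 m)) (fun n => ev (q2 n) (tau n)) -
            ev (q2 m) (dr_Delta P q1 tau m)) ->
        forall b, cbr c (sigmaQ D Sg q1) (sigmaQ D Sg q2) b =
          vsub (dEB D) (sigmaQ D Sg q12 b) (core_hom D (dr_R P q1 q2) b)].

Record two_rep (Q B C M : smoothSpace R) := TwoRep {
  tr_dQ : C -> Q;
  tr_nablaQ : (M -> B) -> (M -> Q) -> (M -> Q);
  tr_nablaC : (M -> B) -> (M -> C) -> (M -> C);
  tr_R : (M -> B) -> (M -> B) -> (Q -> C)
}.

Definition is_two_rep (E Q B C M : smoothSpace R) (D : dvb_ops E Q B C M)
    (L : vb_algebroid_ops E Q B M) (Sg : Q -> B -> E)
    (P : two_rep Q B C M) : Prop :=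
  let l := va_lie L in
  [/\ vb_morphism (dCM D) (dQM D) (tr_dQ P) id /\
      (forall tau, section (dCM D) tau -> forall q,
        lanchor l (core_section (flip D) tau q) =
          vlift (dQM D) q (tr_dQ P (tau (vproj (dQM D) q)))),
      forall b, section (dBM D) b ->
        is_hat (dQM D) (fun m => lanchor (va_base L) (b m)) (tr_nablaQ P b)
          (fun q => lanchor l (sigmaB D Sg b q)),
      forall b tau, section (dBM D) b -> section (dCM D) tau ->
        section (dCM D) (tr_nablaC P b tau) /\
        lbr l (sigmaB D Sg b) (core_section (flip D) tau) =
          core_section (flip D) (tr_nablaC P b tau),
      forall b1 b2, section (dBM D) b1 -> section (dBM D) b2 ->
        vb_morphism (dQM D) (dCM D) (tr_R P b1 b2) id &
      forall b1 b2, section (dBM D) b1 -> section (dBM D) b2 ->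
        forall q, lbr l (sigmaB D Sg b1) (sigmaB D Sg b2) q =
          vsub (dEQ D) (sigmaB D Sg (lbr (va_base L) b1 b2) q)
            (core_hom (flip D) (tr_R P b1 b2) q)].

(* rho_Q^* d f, as a section of the core *)
Definition rho_star_d (E Q B C M : smoothSpace R) (D : dvb_ops E Q B C M)
    (K : vb_courant_ops E Q B C M) (f : M -> R) : M -> C :=
  fun m => choose_or (vzero (dCM D) m) (fun tau =>
    vproj (dCM D) tau = m /\
    forall q, vproj (dQM D) q = m -> vc_ev K q tau = tval (vc_rhoQ K q) f).

Definition core_courant (E Q B C M : smoothSpace R) (D : dvb_ops E Q B C M)
    (K : vb_courant_ops E Q B C M) (P : dorfman_rep Q B C M)
    (P' : two_rep Q B C M) : courant_ops C M := {|
  canchor := fun tau => vc_rhoQ K (tr_dQ P' tau);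
  cpair := fun tau1 tau2 => vc_ev K (tr_dQ P' tau2) tau1;
  cD := rho_star_d D K;
  cbr := fun tau1 tau2 m =>
    vsub (dCM D) (dr_Delta P (fun n => tr_dQ P' (tau1 n)) tau2 m)
      (tr_nablaC P' (fun n => dr_dB P (tau2 n)) tau1 m)
|}.

Definition same_courant (E N : smoothSpace R) (V : vb_ops E N)
    (c c' : courant_ops E N) : Prop :=
  [/\ forall x, canchor c x = canchor c' x,
      forall x y, vproj V x = vproj V y -> cpair c x y = cpair c' x y,
      forall f, sfun f -> cD c f = cD c' f &
      forall e1 e2, section V e1 -> section V e2 -> cbr c e1 e2 = cbr c' e1 e2].

End SmoothSpaces.

(* Main.v *)
(* Let E be the LA-Courant algebroid.  For a section tau of the core Q^*, let
   ell_tau be the linear function on Q that it defines.  The differential of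
   ell_tau along the anchor of E -> Q is linear on the fibres of E -> B, hence
   represented by a section e_tau of E -> B.  Pairing explicit elements of Pi_E
   gives e_tau(b) = sigma_Q(d_Q tau)(b) + nabla^{Q^*}_b tau, so that
   [[e_tau1, tau2^dagger]] = [[tau1, tau2]]^dagger for the bracket on Q^*.

   By maximality, Pi_E contains the sections (e_tau^times, T tau^dagger),
   (T tau^dagger, e_tau^times) and (T e_tau, T e_tau) along its support.
   Involutivity, applied to the last and the first, gives
   [[e_tau1, e_tau2]] = e_[[tau1, tau2]], which reduces the axioms CA1, CA2, CA4
   and CA5 of Q^* to those of E; applied to the first two it gives CA3.  Since
   e_tau and tau^dagger do not involve the splitting, neither does the bracket.

   The support S consists of pairs of tangent vectors of B satisfying relations
   given by the Lie algebroid B; the anchor of (e_tau^times, T tau^dagger) is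
   tangent to S, which computes the linear vector field Theta(e_tau) on B as the
   one of the derivation [d_B tau, -], and gives the statements on d_B. *)

From HB Require Import structures.
From mathcomp Require Import all_boot all_order all_algebra.
From mathcomp Require Import all_classical all_reals all_analysis.
From mathcomp Require Import ring lra.
Require Import Defs.

Set Implicit Arguments.
Unset Strict Implicit.
Unset Printing Implicit Defensive.

Import Order.TTheory GRing.Theory Num.Theory.
Import numFieldNormedType.Exports.

Local Open Scope classical_set_scope.
Local Open Scope ring_scope.

(** * Calculus and smooth functions *)

(** Tangent vectors are derivations and the addition of TE is a choice over curves, so no
    coordinates on TE are at hand. Equalities in TE are tested on functions, and the pairing of TE,
    prescribed only on the sections Te and e^times, is first extended to arbitrary second arguments
    ([pair_Tmap], [pair_cross]).

    Membership in Pi_E is evaluated only over special points of the support, (0_b, T0(rho_B b)),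
    where Pi_E contains (0_x, T0(rho x)) for every x over b. Pairing with these recovers the value
    of a section at b from derivatives along rho x on the zero section.

    Membership of (T e_tau, T e_tau) asks for equal self-pairings. They are equal because <e_tau,
    e_tau> is the derivative along rho_B of the function <tau, d_Q tau>, and the differential of an
    exact form vanishes.

    Tangency to S comes from the Leibniz rule: for F vanishing on S, the bracket with F z leaves a
    multiple of z in Pi_E, and isotropy forces the factor to be 0 if z pairs nontrivially. If a
    fibre of E is zero, there is no such z; the core then vanishes nearby, and the claims on d_B are
    checked directly. *)

Section Calculus.
Variable R : realType.
Implicit Types V : normedModType R.

Lemma is_derive_lineP V (f : V -> R) (x v : V) (d : R) :
  is_derive x v f d <-> is_derive (0 : R) 1 (fun h : R => f (h *: v + x)) d.
Proof.
have E : 'D_v f x = 'D_1 (fun h : R => f (h *: v + x)) 0.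
  rewrite /derive; set g1 := fun h => _ *: _; set g2 := fun h => _ *: _.
  suff -> : g1 = g2 by [].
  apply/funext => h; rewrite /g1 /g2 /=.
  by rewrite addr0 scale0r add0r [_%:A]mulr1.
split=> -[df <-].
  by apply: DeriveDef; [exact: (iffLR (derivable1P f x v))|rewrite E].
by apply: DeriveDef; [exact: (iffRL (derivable1P f x v))|rewrite E].
Qed.

Lemma is_derive_along V (f : V -> R) (w y : V) (s : R) :
  (forall x, derivable f x w) ->
  is_derive s 1 (fun u : R => f (u *: w + y)) ('D_w f (s *: w + y)).
Proof.
move=> df; apply/is_derive_lineP.
have /derivableP/is_derive_lineP := df (s *: w + y).
congr (is_derive _ _ _ _); apply/funext => h.
by rewrite [h *: 1]mulr1 scalerDl addrA.
Qed.

Lemma increment_mvt V (f : V -> R) (w y : V) (h : R) :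
  (forall x, derivable f x w) ->
  exists2 s : R, `|s| <= `|h| & f (h *: w + y) - f y = h * 'D_w f (s *: w + y).
Proof.
move=> df; pose g u := f (u *: w + y).
have dg (s : R) : is_derive s 1 g ('D_w f (s *: w + y)) by exact: is_derive_along.
have cg : continuous g.
  by move=> s; apply/differentiable_continuous/derivable1_diffP; case: (dg s).
have [h0|h0] := leP 0 h.
  have [s + E] := MVT_segment h0 (fun x _ => dg x) (continuous_subspaceT cg).
  rewrite in_itv /= => /andP[s0 sh]; exists s; first by rewrite !ger0_norm.
  by move: E; rewrite /g scale0r add0r subr0 mulrC => ->.
have [s + E] := MVT_segment (ltW h0) (fun x _ => dg x) (continuous_subspaceT cg).
rewrite in_itv /= => /andP[hs s0]; exists s.
  by rewrite !ler0_norm ?lerN2// ltW.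
by move: E; rewrite /g scale0r add0r sub0r => /(congr1 -%R); rewrite opprB => ->; ring.
Qed.

(** [Cinf] speaks of directional derivatives only. The mean value theorem turns their continuity
    into a factorization of the increment in the style of Caratheodory, which replaces total
    differentiability. The last clause gives the value of the factor where the increment
    vanishes. *)
Lemma increment_factor V (T : Type) (F : set_system T) {FF : Filter F}
    (f : V -> R) (w x0 : V) (y : T -> V) (h : T -> R) :
  (forall x, derivable f x w) -> {for x0, continuous ('D_w f)} ->
  y t @[t --> F] --> x0 -> h t @[t --> F] --> 0 ->
  exists psi : T -> R,
    [/\ forall t, f (h t *: w + y t) - f (y t) = h t * psi t,
        psi t @[t --> F] --> 'D_w f x0 &
        forall t, h t = 0 -> psi t = 'D_w f (y t)].
Proof.
move=> df cf yx h0.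
have /choice[s Hs] t : exists s : R, `|s| <= `|h t| /\
    f (h t *: w + y t) - f (y t) = h t * 'D_w f (s *: w + y t).
  by have [s] := increment_mvt (y t) (h t) df; exists s.
exists (fun t => 'D_w f (s t *: w + y t)); split=> [t| |t ht].
- by case: (Hs t).
- have s0 : s t @[t --> F] --> (0 : R).
    apply/cvgr0Pnorm_lt => e e0.
    near=> t; have [sh _] := Hs t; apply: le_lt_trans sh _.
    by near: t; exact: cvgr0_norm_lt.
  apply: (continuous_cvg _ cf).
  rewrite -[X in _ --> X]add0r -[X in _ --> X + _](scale0r w).
  by apply: cvgD => //; apply: cvgZr_tmp.
- have [] := Hs t; rewrite ht normr0 normr_le0 => /eqP -> _.
  by rewrite scale0r add0r.
Unshelve. all: by end_near. Qed.

Lemma is_derive_multi V (f : V -> R) (k : nat) (w : 'I_k -> V) (y0 : V)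
    (h : 'I_k -> R -> R) (dh : 'I_k -> R) (t0 : R) :
  (forall i x, derivable f x (w i)) -> (forall i, continuous ('D_(w i) f)) ->
  (forall i, is_derive t0 1 (h i) (dh i)) -> (forall i, h i t0 = 0) ->
  is_derive t0 1 (fun t => f (\sum_i h i t *: w i + y0))
    (\sum_i dh i * 'D_(w i) f y0).
Proof.
move=> df cf dh_ h0.
(* The convergence is part of the induction: the increment in the last direction starts from the
   moving point formed by the other directions. *)
suff [] : is_derive t0 1 (fun t => f (\sum_i h i t *: w i + y0))
    (\sum_i dh i * 'D_(w i) f y0) /\
    (\sum_i h i t *: w i + y0) @[t --> t0] --> y0 by [].
elim: k => [|k IH] in w h dh df cf dh_ h0 *.
  split.
    rewrite big_ord0; under eq_fun do rewrite big_ord0 add0r.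
    exact: is_derive_cst.
  by under eq_fun do rewrite big_ord0 add0r; exact: cvg_cst.
pose W i := w (widen_ord (leqnSn k) i).
pose H i := h (widen_ord (leqnSn k) i).
pose DH i := dh (widen_ord (leqnSn k) i).
have [dIH cIH] := IH W H DH (fun i => df _) (fun i => cf _) (fun i => dh_ _)
  (fun i => h0 _).
pose y t := \sum_i H i t *: W i + y0; pose hm := h ord_max.
have E t : \sum_i h i t *: w i + y0 = hm t *: w ord_max + y t.
  by rewrite big_ord_recr /= addrAC addrC.
have [g [hg cg g0]] := iffLR (is_derive1_caratheodory _ _ _) (dh_ ord_max).
have hm0 : hm t @[t --> t0] --> 0.
  rewrite -(h0 ord_max); apply/differentiable_continuous/derivable1_diffP.
  by case: (dh_ ord_max).
have [psi [Epsi cpsi psi0]] :=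
  increment_factor (df ord_max) (@cf ord_max y0) cIH hm0.
have psit0 : psi t0 = 'D_(w ord_max) f y0.
  rewrite psi0 ?/hm ?h0// big1 ?add0r// => i _.
  by rewrite /H h0 scale0r.
split; last first.
  rewrite (_ : (fun t => _) = (fun t => hm t *: w ord_max + y t)); last first.
    by apply/funext.
  rewrite -[X in _ --> X]add0r -[X in _ --> X + _](scale0r (w ord_max)).
  by apply: cvgD => //; apply: cvgZr_tmp.
rewrite (_ : (fun t => _) = (fun t => hm t * psi t) + (fun t => f (y t))); last first.
  by apply/funext => t; rewrite E fctE -Epsi subrK.
rewrite big_ord_recr /= addrC; apply: is_deriveD.
apply/is_derive1_caratheodory; exists (fun t => g t * psi t); split.
- by move=> z; rewrite {2}/hm h0 mul0r subr0 mulrAC -hg /hm h0 subr0.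
- by apply: cvgM; [exact: cg|rewrite psit0; exact: cpsi].
- by rewrite g0 psit0.
Qed.

Lemma Ck_le V k (f : V -> R) : Ck k.+1 f -> Ck k f.
Proof.
elim: k f => [|k IH] f [cf Hf]; split=> // v.
by have [df /IH] := Hf v.
Qed.

Lemma Cinf_derivable V (f : V -> R) x v : Cinf f -> derivable f x v.
Proof. by case/(_ 1%N) => _ /(_ v)[]. Qed.

Lemma Cinf_D V (f : V -> R) v : Cinf f -> Cinf ('D_v f).
Proof. by move=> Hf k; case: (Hf k.+1) => _ /(_ v)[]. Qed.

Lemma Cinf_cont V (f : V -> R) : Cinf f -> continuous f.
Proof. by case/(_ 0%N). Qed.

Lemma is_derive_sumdir V (f : V -> R) (k : nat) (w : 'I_k -> V) (y0 : V)
    (h : 'I_k -> R -> R) (dh : 'I_k -> R) (t0 : R) :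
  Cinf f -> (forall i, is_derive t0 1 (h i) (dh i)) -> (forall i, h i t0 = 0) ->
  is_derive t0 1 (fun t => f (\sum_i h i t *: w i + y0))
    (\sum_i dh i * 'D_(w i) f y0).
Proof.
move=> Hf; apply: is_derive_multi => [i x|i]; first exact: Cinf_derivable.
exact/Cinf_cont/Cinf_D.
Qed.

Lemma is_derive_comp n (f : 'rV[R]_n -> R) (c : R -> 'rV[R]_n) (dc : 'I_n -> R)
    (t0 : R) :
  Cinf f -> (forall i, is_derive t0 1 (fun t => c t 0 i) (dc i)) ->
  is_derive t0 1 (fun t => f (c t))
    (\sum_i dc i * 'D_(delta_mx 0 i) f (c t0)).
Proof.
move=> Hf dc_.
rewrite (_ : (fun t => _) = (fun t => f (\sum_i (c t 0 i - c t0 0 i) *: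
    delta_mx 0 i + c t0))); last first.
  apply/funext => t; congr f; apply/rowP => j.
  rewrite mxE summxE (bigD1 j)//= big1 ?addr0 => [|i ij]; last first.
    by rewrite !mxE eq_sym (negbTE ij) andbF mulr0.
  by rewrite !mxE !eqxx mulr1 subrK.
apply: (@is_derive_sumdir _ f n (fun i => delta_mx 0 i) (c t0)
  (fun i t => c t 0 i - c t0 0 i)) => // i; last by rewrite subrr.
rewrite -[dc i]subr0; exact: is_deriveB (dc_ i) _.
Qed.

Lemma cvg_sum_ord (T : Type) (F : set_system T) {FF : Filter F} V k
    (f : 'I_k -> T -> V) (l : 'I_k -> V) :
  (forall i, f i t @[t --> F] --> l i) ->
  (\sum_i f i t) @[t --> F] --> \sum_i l i.
Proof.
elim: k f l => [|k IH] f l H.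
  by rewrite big_ord0; under eq_fun do rewrite big_ord0; exact: cvg_cst.
rewrite big_ord_recr /=; under eq_fun do rewrite big_ord_recr /=.
by apply: cvgD => //; apply: IH => i.
Qed.

Lemma cvg_row (T : Type) (F : set_system T) {FF : Filter F} k
    (f : 'I_k -> T -> R) (l : 'I_k -> R) :
  (forall i, f i t @[t --> F] --> l i) ->
  (\row_i f i t) @[t --> F] --> \row_i l i.
Proof.
move=> H.
have E (a : 'I_k -> R) : \row_i a i = \sum_i a i *: delta_mx 0 i :> 'rV[R]_k.
  by rewrite [LHS]row_sum_delta; apply: eq_bigr => i _; rewrite mxE.
rewrite E; under eq_fun do rewrite E.
by apply: cvg_sum_ord => i; apply: cvgZr_tmp.
Qed.

Lemma Ck_derive V k (f : V -> R) (D : V -> V -> R) :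
  continuous f -> (forall v x, is_derive x v f (D v x)) ->
  (forall v, Ck k (D v)) -> Ck k.+1 f.
Proof.
move=> cf df cD; split=> // v; split=> [x|]; first by case: (df v x).
rewrite (_ : (fun x => _) = D v) //.
by apply/funext => x; case: (df v x).
Qed.

Lemma Ck_cont V k (f : V -> R) : Ck k f -> continuous f.
Proof. by case: k => [|k] []. Qed.

Lemma Ck_is_derive V k (f : V -> R) x v :
  Ck k.+1 f -> is_derive x v f ('D_v f x).
Proof. by case=> _ /(_ v)[df _]; exact/derivableP. Qed.

Lemma Ck_D V k (f : V -> R) v : Ck k.+1 f -> Ck k ('D_v f).
Proof. by case=> _ /(_ v)[]. Qed.

Lemma Ck_cst V k (a : R) : Ck k (fun _ : V => a).
Proof.
elim: k a => [|k IH] a; first by split=> // x; exact: cvg_cst.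
apply: (@Ck_derive V k (fun=> a) (fun _ _ => 0)) => // x.
exact: cvg_cst.
Qed.

Lemma Ck_add V k (f g : V -> R) : Ck k f -> Ck k g -> Ck k (fun x => f x + g x).
Proof.
elim: k f g => [|k IH] f g Hf Hg.
  by split=> // x; apply: cvgD; [case: Hf => + _; apply|case: Hg => + _; apply].
apply: (@Ck_derive V k _ (fun v x => 'D_v f x + 'D_v g x)) => [x|v x|v].
- by apply: cvgD; [exact: (Ck_cont Hf)|exact: (Ck_cont Hg)].
- exact: (is_deriveD (Ck_is_derive x v Hf) (Ck_is_derive x v Hg)).
- by apply: IH; exact: Ck_D.
Qed.

Lemma Ck_mul V k (f g : V -> R) : Ck k f -> Ck k g -> Ck k (fun x => f x * g x).
Proof.
elim: k f g => [|k IH] f g Hf Hg.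
  by split=> // x; apply: cvgM; [case: Hf => + _; apply|case: Hg => + _; apply].
apply: (@Ck_derive V k _ (fun v x => f x * 'D_v g x + g x * 'D_v f x)) => [x|v x|v].
- by apply: cvgM; [exact: (Ck_cont Hf)|exact: (Ck_cont Hg)].
- exact: (is_deriveM (Ck_is_derive x v Hf) (Ck_is_derive x v Hg)).
- by apply: Ck_add; apply: IH; solve [exact: Ck_le|exact: Ck_D].
Qed.

Lemma Ck_sum V k n (f : 'I_n -> V -> R) :
  (forall i, Ck k (f i)) -> Ck k (fun x => \sum_i f i x).
Proof.
elim: n f => [|n IH] f Hf.
  by under eq_fun do rewrite big_ord0; exact: Ck_cst.
under eq_fun do rewrite big_ord_recr /=.
by apply: Ck_add => //; apply: IH => i.
Qed.

Lemma Ck_comp V k n (f : 'rV[R]_n -> R) (g : 'I_n -> V -> R) :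
  Cinf f -> (forall i, Ck k (g i)) -> Ck k (fun x => f (\row_i g i x)).
Proof.
elim: k f g => [|k IH] f g Hf Hg.
  split=> // x; apply: (@continuous_comp _ _ _ (fun x => \row_i g i x) f).
    by apply: cvg_row => i; case: (Hg i) => + _; apply.
  exact: Cinf_cont.
apply: (@Ck_derive V k _ (fun v x => \sum_i 'D_v (g i) x *
    'D_(delta_mx 0 i) f (\row_i g i x))) => [x|v x|v].
- apply: (@continuous_comp _ _ _ (fun x => \row_i g i x) f).
    by apply: cvg_row => i; exact: (Ck_cont (Hg i)).
  exact: Cinf_cont.
- apply/is_derive_lineP.
  have := @is_derive_comp n f (fun h => \row_i g i (h *: v + x))
    (fun i => 'D_v (g i) x) 0 Hf.
  rewrite scale0r add0r; apply=> i.
  under eq_fun do rewrite mxE.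
  exact: (iffLR (is_derive_lineP _ _ _ _) (Ck_is_derive x v (Hg i))).
- apply: Ck_sum => i; apply: Ck_mul; first exact: Ck_D.
  by apply: (IH _ g (Cinf_D _ Hf)) => j; exact: Ck_le.
Qed.

Lemma Ck_local V k (f : V -> R) :
  (forall x : V, exists2 g, Ck k g & \forall y \near x, f y = g y) -> Ck k f.
Proof.
have C (f1 : V -> R) (x : V) : (exists2 g, continuous g & \forall y \near x, f1 y = g y) ->
    {for x, continuous f1}.
  move=> [g cg fg]; rewrite /prop_for /continuous_at (nbhs_singleton fg).
  by apply: cvg_trans (cg x); apply: near_eq_cvg; apply: filterS fg.
elim: k f => [|k IH] f H.
  by split=> // x; apply: C; have [g [cg _] fg] := H x; exists g.
split=> [x|v]; first by apply: C; have [g /Ck_cont cg fg] := H x; exists g.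
split=> [x|].
  have [g Hg fg] := H x; apply: (@near_eq_derivable _ _ _ g).
    by apply: filterS fg.
  by have [] := Ck_is_derive x v Hg.
apply: IH => x; have [g Hg fg] := H x; exists ('D_v g); first exact: Ck_D.
by apply: filterS (nbhs_interior fg) => y fgy; rewrite (near_eq_derive v fgy).
Qed.

End Calculus.

(** * Smooth functions with prescribed vanishing *)

Section Flat.
Variable R : realType.

(** The derivatives of exp(-1/x), extended by 0 to x <= 0, are combinations of these functions for
    various n, so smoothness is proved for the whole family at once. *)
Definition flat (n : nat) (x : R) : R :=
  if 0 < x then x^-1 ^+ n * expR (- x^-1) else 0.

Lemma flat_ge0 n x : 0 <= flat n x.
Proof.
rewrite /flat; case: ifPn => // x0.
by rewrite mulr_ge0 ?expR_ge0// exprn_ge0// invr_ge0 ltW.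
Qed.

Lemma flat0_gt0 x : 0 < x -> 0 < flat 0 x.
Proof. by rewrite /flat => ->; rewrite expr0 mul1r expR_gt0. Qed.

Lemma flat_le0 n x : x <= 0 -> flat n x = 0.
Proof. by rewrite /flat leNgt => /negbTE ->. Qed.

Lemma flatS n x : flat n x = flat n.+1 x * x.
Proof.
rewrite /flat; case: ifPn => [x0|]; last by rewrite mul0r.
by rewrite exprSr mulrAC -[X in _ = X * _]mulrA mulVf ?mulr1// gt_eqF.
Qed.

(** Since exp(y) dominates y^(n+1)/(n+1)!, the function is O(x) at 0. For n + 1 in place of n, the
    bound shows that the difference quotient of [flat n] at 0, which is [flat n.+1], tends to 0. *)
Lemma flat_bound n x : `|flat n x| <= (n.+1)`!%:R * `|x|.
Proof.
have [x0|x0] := leP x 0; first by rewrite flat_le0// normr0 mulr_ge0.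
rewrite ger0_norm ?flat_ge0// gtr0_norm// flatS ler_pM2r// /flat x0.
rewrite expRN ler_pdivrMr ?expR_gt0//.
have y0 : 0 <= x^-1 by rewrite invr_ge0 ltW.
have := expR_ge1Dxn n y0; move=> /(le_trans _) H.
have : x^-1 ^+ n.+1 / (n.+1)`!%:R <= expR x^-1 by apply: H; rewrite lerDr.
by rewrite ler_pdivrMr 1?mulrC// ltr0n fact_gt0.
Qed.

Lemma is_derive_flat n (x : R) :
  is_derive x 1 (flat n) (- (n%:R * flat n.+1 x) + flat n.+2 x).
Proof.
have [x0|x0|->] := ltgtP x 0.
- rewrite !flat_le0 ?ltW// mulr0 oppr0 addr0.
  apply: (@near_eq_is_derive _ _ _ (cst 0)).
  by near=> y; rewrite /= flat_le0// ltW//; near: y; exact: lt_nbhsl.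
- have dV : is_derive x 1 (fun y : R => y^-1) (- x^-1 ^+ 2).
    have := @is_deriveV R id x 1 1; rewrite [_ *: 1]mulr1 exprVn.
    by apply; rewrite ?gt_eqF//; exact: is_derive_id.
  have dVn := @is_deriveX _ _ _ n _ _ _ dV.
  have dN := is_deriveN dV.
  have dE := is_derive1_comp (is_derive_expR _) dN.
  have dP := is_deriveM dVn dE.
  have dF : is_derive x 1 (fun y : R => y^-1 ^+ n * expR (- y^-1))
      (- (n%:R * flat n.+1 x) + flat n.+2 x).
    have -> : (fun y : R => y^-1 ^+ n * expR (- y^-1)) =
        (fun y : R => y^-1) ^+ n * (expR \o - (fun y : R => y^-1)).
      by rewrite exprfctE.
    apply: (is_derive_eq dP); rewrite exprfctE /flat x0 /GRing.scale /=.
    have -> : (- (fun y : R => y^-1)) x = - x^-1 by [].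
    have H (e z : R) m : z ^+ m * (e * - - z ^+ 2) +
        e * (m%:R * z ^+ m.-1 * - z ^+ 2) =
        - (m%:R * (z ^+ m.+1 * e)) + z ^+ m.+2 * e.
      by case: m => [|m] /=; rewrite !exprS; ring.
    exact: H.
  apply: (near_eq_is_derive _ dF).
  by near=> y; rewrite /flat ifT//; near: y; exact: lt_nbhsr.
- apply/is_derive1_caratheodory; exists (flat n.+1); split.
  + by move=> z; rewrite (flat_le0 n (lexx 0)) !subr0 -flatS.
  + rewrite /prop_for /continuous_at flat_le0//.
    apply/cvgr0Pnorm_lt => e e0; near=> z.
    apply: le_lt_trans (flat_bound _ _) _.
    rewrite mulrC -ltr_pdivlMr ?ltr0n ?fact_gt0//.
    by near: z; apply: cvgr0_norm_lt => //; rewrite divr_gt0// ltr0n fact_gt0.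
  + by rewrite !flat_le0// mulr0 oppr0 addr0.
Unshelve. all: by end_near. Qed.

Lemma Cinf_cst (V : normedModType R) (a : R) : Cinf (fun _ : V => a).
Proof. by move=> k; exact: Ck_cst. Qed.

Lemma Cinf_add (V : normedModType R) (f g : V -> R) :
  Cinf f -> Cinf g -> Cinf (fun x => f x + g x).
Proof. by move=> Hf Hg k; exact: Ck_add. Qed.

Lemma Cinf_mul (V : normedModType R) (f g : V -> R) :
  Cinf f -> Cinf g -> Cinf (fun x => f x * g x).
Proof. by move=> Hf Hg k; exact: Ck_mul. Qed.

Lemma Cinf_sum (V : normedModType R) n (f : 'I_n -> V -> R) :
  (forall i, Cinf (f i)) -> Cinf (fun x => \sum_i f i x).
Proof. by move=> Hf k; apply: Ck_sum => i; exact: Hf. Qed.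

Lemma Cinf_comp (V : normedModType R) n (f : 'rV[R]_n -> R) (g : 'I_n -> V -> R) :
  Cinf f -> (forall i, Cinf (g i)) -> Cinf (fun x => f (\row_i g i x)).
Proof. by move=> Hf Hg k; apply: Ck_comp => // i; exact: Hg. Qed.

Lemma Cinf_local (V : normedModType R) (f : V -> R) :
  (forall x : V, exists2 g, Cinf g & \forall y \near x, f y = g y) -> Cinf f.
Proof.
by move=> H k; apply: Ck_local => x; have [g Hg fg] := H x; exists g.
Qed.

Lemma Ck_comp1 (V : normedModType R) k (f : R -> R) (g : V -> R) :
  Cinf f -> Ck k g -> Ck k (fun x => f (g x)).
Proof.
elim: k f => [|k IH] f Hf Hg.
  split=> // x; apply: (@continuous_comp _ _ _ g f); last exact: Cinf_cont.
  by case: Hg => + _; apply.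
apply: (@Ck_derive _ V k _ (fun v x => 'D_1 f (g x) * 'D_v g x)) => [x|v x|v].
- apply: (@continuous_comp _ _ _ g f); last exact: Cinf_cont.
  exact: (Ck_cont Hg).
- apply/is_derive_lineP.
  have dg := iffLR (is_derive_lineP _ _ _ _) (Ck_is_derive x v Hg).
  have df : is_derive (g (0 *: v + x)) 1 f ('D_1 f (g x)).
    rewrite scale0r add0r; exact/derivableP/Cinf_derivable.
  exact: (@is_derive1_comp _ f (fun h => g (h *: v + x)) 0 _ _ df dg).
- apply: Ck_mul; last exact: Ck_D.
  by apply: (IH _ (Cinf_D _ Hf)); exact: Ck_le.
Qed.

Lemma Cinf_comp1 (V : normedModType R) (f : R -> R) (g : V -> R) :
  Cinf f -> Cinf g -> Cinf (fun x => f (g x)).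
Proof. by move=> Hf Hg k; exact: Ck_comp1. Qed.

Lemma is_derive_affine (t a b : R) : is_derive t 1 (fun h : R => h * a + b) a.
Proof.
apply/is_derive1_caratheodory; exists (fun=> a); split=> // [z|]; first by ring.
exact: cst_continuous.
Qed.

Lemma Ck_derive1 k (f f' : R -> R) :
  (forall x : R, is_derive x 1 f (f' x)) -> Ck k f' -> Ck k.+1 f.
Proof.
move=> df Hf'; apply: (@Ck_derive _ R k f (fun v x => f' x * v)) => [x|v x|v].
- by apply/differentiable_continuous/derivable1_diffP; case: (df x).
- apply/is_derive_lineP.
  have dg : is_derive (0 * v + x) 1 f (f' x) by rewrite mul0r add0r.
  exact: (@is_derive1_comp _ f (fun h => h * v + x) 0 _ _ dg (is_derive_affine 0 v x)).
- by apply: Ck_mul => //; exact: Ck_cst.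
Qed.

Lemma Cinf_flat n : Cinf (flat n).
Proof.
move=> k; elim: k n => [|k IH] n; last first.
  apply: Ck_derive1 (is_derive_flat n) _.
  apply: Ck_add => //; under eq_fun do rewrite -mulNr.
  by apply: Ck_mul => //; exact: Ck_cst.
split=> // x; apply/differentiable_continuous/derivable1_diffP.
by case: (is_derive_flat n x).
Qed.

Lemma Cinf_id : Cinf (fun x : R => x).
Proof.
move=> [|k]; first by split=> // x; exact: cvg_id.
by apply: (@Ck_derive1 _ _ (fun=> 1)); exact: Ck_cst.
Qed.

Lemma Cinf_coord n (i : 'I_n) : Cinf (fun x : 'rV[R]_n => x 0 i).
Proof.
have C : continuous (fun x : 'rV[R]_n => x 0 i) by exact: coord_continuous.
move=> [|k]; first by split.
apply: (@Ck_derive R 'rV[R]_n k (fun x => x 0 i) (fun v _ => v 0 i)) => // [v x|v];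
  last exact: Ck_cst.
apply/is_derive_lineP; under eq_fun do rewrite !mxE.
exact: is_derive_affine.
Qed.

Lemma Cinf_inv (V : normedModType R) (f : V -> R) :
  (forall x, f x != 0) -> Cinf f -> Cinf (fun x => (f x)^-1).
Proof.
move=> f0 Hf; elim=> [|k IH].
  by split=> // x; apply: cvgV => //; exact: Cinf_cont.
apply: (@Ck_derive _ V k _ (fun v x => - ((f x)^-1 * (f x)^-1 * 'D_v f x)))
  => [x|v x|v].
- by apply: cvgV => //; exact: Cinf_cont.
- have df : derivable f x v by exact: Cinf_derivable.
  apply: DeriveDef; first exact: derivableV.
  by rewrite deriveV// /GRing.scale /= mulNr -exprVn expr2.
- under eq_fun do rewrite -mulNr.
  apply: Ck_mul; last exact: (Cinf_D _ Hf).
  under eq_fun do rewrite -mulrN.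
  apply: Ck_mul => //; under eq_fun do rewrite -mulN1r.
  by apply: Ck_mul => //; exact: Ck_cst.
Qed.

Lemma Cinf_opp (V : normedModType R) (f : V -> R) :
  Cinf f -> Cinf (fun x => - f x).
Proof.
move=> Hf; under eq_fun do rewrite -mulN1r.
by apply: Cinf_mul => //; exact: Cinf_cst.
Qed.

(** The function is p / (p + q), where p vanishes for |y| >= e and q for |y| <= e / 2, so never
    both. Squares keep the arguments of [flat] smooth. *)
Lemma Cinf_plateau (e : R) : 0 < e -> exists b : R -> R,
  [/\ Cinf b, forall y, `|y| <= e / 2 -> b y = 1 & forall y, e <= `|y| -> b y = 0].
Proof.
move=> e0.
pose p (y : R) := flat 0 (e ^+ 2 + - (y * y)).
pose q (y : R) := flat 0 (y * y + - (e / 2) ^+ 2).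
have Hsq : Cinf (fun y : R => y * y) by apply: Cinf_mul; exact: Cinf_id.
have Hp : Cinf p.
  apply: Cinf_comp1; first exact: Cinf_flat.
  by apply: Cinf_add; [exact: Cinf_cst|exact: Cinf_opp].
have Hq : Cinf q.
  apply: Cinf_comp1; first exact: Cinf_flat.
  by apply: Cinf_add => //; exact: Cinf_cst.
have sqE (y : R) : y * y = `|y| ^+ 2 by rewrite real_normK ?num_real.
have p0 y : e <= `|y| -> p y = 0.
  by move=> ey; rewrite /p flat_le0// sqE subr_le0 ler_pXn2r// ?nnegrE ltW.
have q0 y : `|y| <= e / 2 -> q y = 0.
  move=> ey; rewrite /q flat_le0// sqE subr_le0 ler_pXn2r// ?nnegrE//.
  by rewrite ltW// divr_gt0.
have pos y : p y + q y != 0.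
  rewrite gt_eqF//; have [ye|ye] := ltP `|y| e.
    rewrite ltr_wpDr ?flat_ge0// flat0_gt0// sqE subr_gt0 ltr_pXn2r//.
    by rewrite nnegrE ltW.
  rewrite ltr_wpDl ?flat_ge0// flat0_gt0// sqE subr_gt0 ltr_pXn2r//.
  - by apply: lt_le_trans ye; rewrite ltr_pdivrMr// ltr_pMr// ltr1n.
  - by rewrite nnegrE ltW// divr_gt0.
exists (fun y => p y * (p y + q y)^-1); split.
- by apply: Cinf_mul => //; apply: Cinf_inv => //; exact: Cinf_add.
- by move=> y /q0 qy; have := pos y; rewrite qy addr0; apply: divff.
- by move=> y /p0 ->; rewrite mul0r.
Qed.

(** Smooth functions on a manifold are closed under globally smooth operations, so x^-1 is replaced
    by x / q(x), where q is positive everywhere and equals x^2 for |x| >= a. *)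
Lemma Cinf_inv_local (a : R) : 0 < a -> exists f : R -> R,
  Cinf f /\ forall x, a <= `|x| -> f x = x^-1.
Proof.
move=> a0; pose q (x : R) := x * x + flat 0 (a ^+ 2 + - (x * x)).
have sqE (y : R) : y * y = `|y| ^+ 2 by rewrite real_normK ?num_real.
have Hsq : Cinf (fun y : R => y * y) by apply: Cinf_mul; exact: Cinf_id.
have Hq : Cinf q.
  apply: Cinf_add => //; apply: Cinf_comp1; first exact: Cinf_flat.
  by apply: Cinf_add; [exact: Cinf_cst|exact: Cinf_opp].
have pos x : q x != 0.
  rewrite gt_eqF// /q; have [->|x0] := eqVneq x 0.
    by rewrite mul0r add0r oppr0 addr0 flat0_gt0// exprn_gt0.
  by rewrite ltr_wpDr ?flat_ge0// sqE exprn_gt0// normr_gt0.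
exists (fun x => x * (q x)^-1); split.
  by apply: Cinf_mul; [exact: Cinf_id|exact: Cinf_inv].
move=> x ax; rewrite /q flat_le0 ?addr0; last first.
  by rewrite sqE subr_le0 ler_pXn2r// ?nnegrE ltW.
have x0 : x != 0 by rewrite -normr_gt0 (lt_le_trans a0).
by rewrite invfM mulrA divff// mul1r.
Qed.

End Flat.

(** * The algebra of smooth functions and its topology *)

Section SmoothFunctions.
Variable R : realType.

Lemma gen_incl (X : Type) (G : (X -> R) -> Prop) g : G g -> gen G g.
Proof.
move=> Gg x; exists 1%N, (fun=> g), (fun v => v 0 0), 1; split=> //.
- exact: Cinf_coord.
- by move=> y _; rewrite mxE.
Qed.

Lemma gen_pull (X Y : Type) (G : (X -> R) -> Prop) (G' : (Y -> R) -> Prop)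
    (phi : Y -> X) f :
  (forall g, G g -> G' (fun y => g (phi y))) -> gen G f ->
  gen G' (fun y => f (phi y)).
Proof.
move=> GG' Hf y; have [k [g [p [e [Gg Hp e0 H]]]]] := Hf (phi y).
by exists k, (fun i y => g i (phi y)), p, e; split=> // [i|z]; [exact: GG'|exact: H].
Qed.

Definition smooth_closed (X : smoothSpace R) :=
  forall f : X -> R, gen (@sfun R X) f -> sfun f.

Lemma manifold_closed (X : smoothSpace R) : is_manifold X -> smooth_closed X.
Proof. by case. Qed.

Lemma vspace_closed (V : normedModType R) : smooth_closed (vspace V).
Proof.
move=> f Hf; apply: Cinf_local => x.
have [k [g [p [e [Gg Hp e0 H]]]]] := Hf x.
exists (fun y => p (\row_i g i y)); first exact: Cinf_comp.
have : \forall y \near x, forall i, `|g i y - g i x| < e.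
  apply: filter_forall => i; have cg := Cinf_cont (Gg i : Cinf (g i : V -> R)).
  have /cvgrPdist_lt/(_ e e0) := cg x.
  by apply: filterS => y; rewrite distrC.
by apply: filterS => y /H.
Qed.

Lemma sopen_ball (X : smoothSpace R) (HX : smooth_closed X) (g : X -> R) c e :
  sfun g -> sopen (fun y => `|g y - c| < e).
Proof.
move=> Hg x gx; have e0 : 0 < e by apply: le_lt_trans gx.
(* The argument of [flat] is positive exactly on the ball. *)
exists (fun y => flat 0 (e ^+ 2 + - (g y - c) ^+ 2)); split.
- apply: HX => z; exists 1%N, (fun=> g), (fun v => flat 0 (e ^+ 2 + - (v 0 0 + - c) ^+ 2)), 1.
  split=> // [|y _]; last by rewrite mxE.
  apply: Cinf_comp1; first exact: Cinf_flat.
  apply: Cinf_add; [exact: Cinf_cst|apply: Cinf_opp].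
  by apply: Cinf_mul; apply: Cinf_add; solve [exact: Cinf_coord|exact: Cinf_cst].
- apply/eqP; rewrite gt_eqF// flat0_gt0// subr_gt0 -[ltLHS]real_normK ?num_real//.
  by rewrite ltr_pXn2r// nnegrE ltW.
- move=> y /eqP; apply: contraNT; rewrite -leNgt => ey.
  rewrite flat_le0// subr_le0 -[leRHS]real_normK ?num_real//.
  by rewrite ler_pXn2r// nnegrE ltW.
Qed.

Lemma sopen_pull (X Y : smoothSpace R) (phi : X -> Y) U :
  smooth_map phi -> sopen U -> sopen (fun x => U (phi x)).
Proof.
move=> Hphi HU x /HU[f [Hf fx Uf]].
by exists (fun x => f (phi x)); split=> // [|y /Uf]; first exact: Hphi.
Qed.

Section Closed.
Variable X : smoothSpace R.
Hypothesis HX : smooth_closed X.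
Implicit Types f g : X -> R.

Lemma sfun_fin k (g : 'I_k -> X -> R) (p : 'rV[R]_k -> R) :
  (forall i, sfun (g i)) -> Cinf p -> sfun (fun x => p (\row_i g i x)).
Proof. by move=> Hg Hp; apply: HX => x; exists k, g, p, 1; split. Qed.

Lemma sfun_cst (a : R) : sfun (fun _ : X => a).
Proof.
apply: (@sfun_fin 0 (fun _ _ => 0) (fun=> a)) => [[]//|]; exact: Cinf_cst.
Qed.

Lemma sfun_comp1 (p : R -> R) g : Cinf p -> sfun g -> sfun (fun x => p (g x)).
Proof.
move=> Hp Hg.
have -> : (fun x => p (g x)) = (fun x => p ((\row_(i < 1) g x) 0 0)).
  by apply/funext => x; rewrite mxE.
apply: (@sfun_fin 1 (fun=> g) (fun v => p (v 0 0))) => //.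
by apply: Cinf_comp1 => //; exact: Cinf_coord.
Qed.

Lemma sfun_op2 (p : R -> R -> R) f g :
  Cinf (fun v : 'rV[R]_2 => p (v 0 0) (v 0 1)) -> sfun f -> sfun g ->
  sfun (fun x => p (f x) (g x)).
Proof.
move=> Hp Hf Hg; pose h (i : 'I_2) := if i == 0 then f else g.
have -> : (fun x => p (f x) (g x)) =
    (fun x => p ((\row_i h i x) 0 0) ((\row_i h i x) 0 1)).
  by apply/funext => x; rewrite !mxE.
apply: (@sfun_fin 2 h (fun v => p (v 0 0) (v 0 1))) => // i.
by rewrite /h; case: ifP.
Qed.

Lemma sfun_add f g : sfun f -> sfun g -> sfun (fun x => f x + g x).
Proof.
by apply: (sfun_op2 (p := fun a b => a + b)); apply: Cinf_add; exact: Cinf_coord.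
Qed.

Lemma sfun_mul f g : sfun f -> sfun g -> sfun (fun x => f x * g x).
Proof.
by apply: (sfun_op2 (p := fun a b => a * b)); apply: Cinf_mul; exact: Cinf_coord.
Qed.

Lemma sfun_opp f : sfun f -> sfun (fun x => - f x).
Proof.
by apply: (sfun_comp1 (p := fun a => - a)); apply: Cinf_opp; exact: Cinf_id.
Qed.

Lemma sfun_sub f g : sfun f -> sfun g -> sfun (fun x => f x - g x).
Proof. by move=> Hf Hg; apply: sfun_add => //; exact: sfun_opp. Qed.

Lemma sfun_sum k (f : 'I_k -> X -> R) :
  (forall i, sfun (f i)) -> sfun (fun x => \sum_i f i x).
Proof.
move=> Hf.
have -> : (fun x => \sum_i f i x) = (fun x => \sum_i (\row_i f i x) 0 i).
  by apply/funext => x; apply: eq_bigr => i _; rewrite mxE.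
apply: (@sfun_fin k f (fun v => \sum_i v 0 i) Hf).
by apply: Cinf_sum => i; exact: Cinf_coord.
Qed.

Lemma sfun_prod k (f : 'I_k -> X -> R) :
  (forall i, sfun (f i)) -> sfun (fun x => \prod_i f i x).
Proof.
elim: k f => [|k IH] f Hf.
  by under eq_fun do rewrite big_ord0; exact: sfun_cst.
under eq_fun do rewrite big_ord_recr /=.
by apply: sfun_mul => //; apply: IH => i.
Qed.

Lemma sopenT : sopen (fun _ : X => True).
Proof.
by move=> x _; exists (fun=> 1); split=> //; [exact: sfun_cst|exact/eqP/oner_neq0].
Qed.

Lemma sopen_forall k (U : 'I_k -> X -> Prop) :
  (forall i, sopen (U i)) -> sopen (fun x => forall i, U i x).
Proof.
move=> HU x Ux.
have /choice[f Hf] i := HU i x (Ux i).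
exists (fun x => \prod_i f i x); split.
- by apply: sfun_prod => i; case: (Hf i).
- by apply/eqP/prodf_neq0 => i _; apply/eqP; case: (Hf i).
- move=> y /eqP/prodf_neq0 fy i; have [_ _] := Hf i; apply.
  exact/eqP/fy.
Qed.

Lemma sopenI (U V : X -> Prop) : sopen U -> sopen V -> sopen (fun x => U x /\ V x).
Proof.
move=> HU HV x [/HU[f [Hf fx Uf]] /HV[g [Hg gx Vg]]].
exists (fun x => f x * g x); split; first exact: sfun_mul.
- by apply/eqP; rewrite mulf_neq0//; exact/eqP.
- move=> y fg; split; [apply: Uf|apply: Vg] => E; apply: fg.
    by rewrite E mul0r.
  by rewrite E mulr0.
Qed.

Lemma sfun_smooth_at f x : sfun f -> smooth_at f x.
Proof. by move=> Hf; exists f, (fun=> True); split=> //; exact: sopenT. Qed.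

Lemma smooth_at_eq f g x (U : X -> Prop) : sopen U -> U x ->
  (forall y, U y -> f y = g y) -> smooth_at g x -> smooth_at f x.
Proof.
move=> HU Ux fg [h [V [Hh HV Vx gh]]].
exists h, (fun y => U y /\ V y); split=> //; first exact: sopenI.
by move=> y [Uy Vy]; rewrite fg ?gh.
Qed.

Lemma smooth_at_fin k (g : 'I_k -> X -> R) (p : 'rV[R]_k -> R) x :
  (forall i, smooth_at (g i) x) -> Cinf p -> smooth_at (fun x => p (\row_i g i x)) x.
Proof.
move=> Hg Hp.
have /choice[h Hh] i : exists h, sfun h /\ exists U : X -> Prop,
    [/\ sopen U, U x & forall y, U y -> g i y = h y].
  by have [h [U [Hh HU Ux gh]]] := Hg i; exists h; split=> //; exists U.
have /choice[U HU] i : exists U : X -> Prop,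
    [/\ sopen U, U x & forall y, U y -> g i y = h i y] by case: (Hh i).
exists (fun x => p (\row_i h i x)), (fun y => forall i, U i y); split.
- by apply: sfun_fin => // i; case: (Hh i).
- by apply: sopen_forall => i; case: (HU i).
- by move=> i; case: (HU i).
- move=> y Uy; congr p; apply/rowP => i; rewrite !mxE.
  by have [_ _] := HU i; apply.
Qed.

Lemma smooth_at_op2 (p : R -> R -> R) f g x :
  Cinf (fun v : 'rV[R]_2 => p (v 0 0) (v 0 1)) -> smooth_at f x -> smooth_at g x ->
  smooth_at (fun x => p (f x) (g x)) x.
Proof.
move=> Hp Hf Hg; pose h (i : 'I_2) := if i == 0 then f else g.
have -> : (fun x => p (f x) (g x)) =
    (fun x => p ((\row_i h i x) 0 0) ((\row_i h i x) 0 1)).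
  by apply/funext => y; rewrite !mxE.
apply: (@smooth_at_fin 2 h (fun v => p (v 0 0) (v 0 1))) => // i.
by rewrite /h; case: ifP.
Qed.

Lemma smooth_at_mul f g x :
  smooth_at f x -> smooth_at g x -> smooth_at (fun x => f x * g x) x.
Proof.
by apply: (smooth_at_op2 (p := fun a b => a * b)); apply: Cinf_mul; exact: Cinf_coord.
Qed.

Lemma sfun_local f : (forall x, smooth_at f x) -> sfun f.
Proof.
move=> Hf; apply: HX => x; have [g [U [Hg HU Ux fg]]] := Hf x.
have [h [Hh hx Uh]] := HU x Ux.
(* The second generator [h] serves as a gate: as long as it stays within |h x| of its value at x it
   is nonzero, so the point lies in U, where f = g. *)
exists 2%N, (fun i => if i == 0 then g else h), (fun v => v 0 0), `|h x|; split.
- by move=> i; case: ifP.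
- exact: Cinf_coord.
- by rewrite normr_gt0; exact/eqP.
- move=> y /(_ 1) /= hy; rewrite mxE /= fg//; apply: Uh => h0.
  by move: hy; rewrite h0 sub0r normrN ltxx.
Qed.

Lemma smooth_at_inv f x : sfun f -> f x <> 0 -> smooth_at (fun y => (f y)^-1) x.
Proof.
move=> Hf /eqP fx; have a0 : 0 < `|f x| / 2 by rewrite divr_gt0// normr_gt0.
have [p [Hp pE]] := Cinf_inv_local a0.
exists (fun y => p (f y)), (fun y => `|f y - f x| < `|f x| / 2); split.
- exact: sfun_comp1.
- exact: sopen_ball.
- by rewrite subrr normr0.
- move=> y fy; rewrite pE//.
  have : `|f x| <= `|f y| + `|f y - f x|.
    by rewrite [X in `|X| <= _](_ : f x = f y - (f y - f x)) ?ler_normB//; ring.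
  lra.
Qed.

(** The last clause says that the support of chi lies in U, in the form used for extending local
    objects by zero. *)
Lemma bump (U : X -> Prop) x : sopen U -> U x -> exists chi : X -> R, [/\ sfun chi,
  exists W : X -> Prop, [/\ sopen W, W x & forall y, W y -> U y /\ chi y = 1] &
  forall y, U y \/ exists W : X -> Prop,
    [/\ sopen W, W y & forall z, W z -> chi z = 0]].
Proof.
move=> HU Ux; have [f [Hf /eqP fx Uf]] := HU x Ux.
pose e := `|f x| / 2; have e0 : 0 < e by rewrite divr_gt0// normr_gt0.
have [b [Hb b1 b0]] := Cinf_plateau e0.
have near_U y : `|f y - f x| < `|f x| -> U y.
  by move=> fy; apply: Uf => f0; move: fy; rewrite f0 sub0r normrN ltxx.
have e_fx : e < `|f x| by rewrite ltr_pdivrMr// ltr_pMr ?normr_gt0// ltr1n.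
exists (fun y => b (f y - f x)); split.
- by apply: sfun_comp1 => //; apply: sfun_sub => //; exact: sfun_cst.
- exists (fun y => `|f y - f x| < e / 2); split; first exact: sopen_ball.
    by rewrite subrr normr0 divr_gt0.
  move=> y fy; split; last by rewrite b1// ltW.
  apply: near_U; apply: lt_trans fy _; apply: lt_trans e_fx.
  by rewrite ltr_pdivrMr// ltr_pMr// ltr1n.
- move=> y; have [ye|ye] := leP `|f y - f x| e.
    by left; apply: near_U; exact: le_lt_trans e_fx.
  right; exists (fun z => `|f z - f y| < `|f y - f x| - e); split.
  + exact: sopen_ball.
  + by rewrite subrr normr0 subr_gt0.
  + move=> z fz; rewrite b0//.
    have : `|f y - f x| <= `|f y - f z| + `|f z - f x|.
      by rewrite [X in `|X| <= _](_ : _ = (f y - f z) + (f z - f x)) ?ler_normD//; ring.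
    rewrite [`|f y - f z|]distrC; lra.
Qed.

End Closed.

Lemma curve_near (X : smoothSpace R) (c : R -> X) (t0 : R) (U : X -> Prop) :
  smooth_curve c -> sopen U -> U (c t0) -> \forall t \near t0, U (c t).
Proof.
move=> Hc HU Uc; have [f [Hf fx Uf]] := HU _ Uc.
have Hcf : {for t0, continuous (fun t => f (c t))} by exact: Cinf_cont (Hc f Hf) _.
have fx0 : 0 < `|f (c t0)| by rewrite normr_gt0; exact/eqP.
have /cvgrPdist_lt/(_ _ fx0) := Hcf; apply: filterS => t ft; apply: Uf => f0.
by move: ft; rewrite f0 subr0 ltxx.
Qed.

End SmoothFunctions.

Section Products.
Variables (R : realType) (X Y Z : smoothSpace R).

Lemma smooth_pair (HZ : smooth_closed Z) (s1 : Z -> X) (s2 : Z -> Y) :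
  smooth_map s1 -> smooth_map s2 ->
  @smooth_map R Z (prodS X Y) (fun z => (s1 z, s2 z)).
Proof.
move=> H1 H2 h Hh; apply: (HZ); apply: gen_pull Hh => g [[f Hf ->]|[f Hf ->]].
  exact: H1.
exact: H2.
Qed.

Lemma smooth_fst : @smooth_map R (prodS X Y) X (fun p => p.1).
Proof. by move=> h Hh; apply: gen_incl; left; exists h. Qed.

Lemma smooth_snd : @smooth_map R (prodS X Y) Y (fun p => p.2).
Proof. by move=> h Hh; apply: gen_incl; right; exists h. Qed.

End Products.

Lemma sfun_slice (R : realType) (X Y : smoothSpace R) (HX : smooth_closed X)
  (F : prodS X Y -> R) y : sfun F -> sfun (fun x => F (x, y)).
Proof.
move=> HF; apply: (smooth_pair HX _ _ HF) => [f Hf|f _]; first exact: Hf.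
exact: (sfun_cst HX).
Qed.

(** * Vector bundles *)

Section LocalForm.
Variables (R : realType) (M : smoothSpace R) (k : nat).
Hypothesis HM : smooth_closed M.
Local Notation MR := (prodS M (vspace 'rV[R]_k)).

(** Neighbourhoods are split into a base and a fibre factor. The latter carries the norm topology,
    so that along a curve membership in it follows from convergence of the fibre coordinates. *)
Definition box_near (m0 : M) (y0 : 'rV[R]_k) (P : M -> 'rV[R]_k -> Prop) :=
  exists (W : M -> Prop) (A : set 'rV[R]_k),
    [/\ sopen W, W m0, nbhs y0 A & forall m y, W m -> A y -> P m y].

Lemma box_nearI m0 y0 P P' :
  box_near m0 y0 P -> box_near m0 y0 P' ->
  box_near m0 y0 (fun m y => P m y /\ P' m y).
Proof.
move=> [W [A [HW Wm HA H]]] [W' [A' [HW' Wm' HA' H']]].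
exists (fun m => W m /\ W' m), (A `&` A'); split=> //.
- exact: sopenI.
- exact: filterI.
- by move=> m y [? ?] [? ?]; split; [exact: H|exact: H'].
Qed.

Lemma box_nearS m0 y0 (P P' : M -> 'rV[R]_k -> Prop) :
  (forall m y, P m y -> P' m y) -> box_near m0 y0 P -> box_near m0 y0 P'.
Proof.
move=> PP' [W [A [HW Wm HA H]]]; exists W, A; split=> // m y Wm' Ay.
exact/PP'/H.
Qed.

Lemma box_near_forall n m0 y0 (P : 'I_n -> M -> 'rV[R]_k -> Prop) :
  (forall i, box_near m0 y0 (P i)) -> box_near m0 y0 (fun m y => forall i, P i m y).
Proof.
move=> H; have /choice[W HW] i := H i.
have /choice[A HA] i := HW i.
exists (fun m => forall i, W i m), (fun y => forall i, A i y); split.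
- by apply: sopen_forall => // i; case: (HA i).
- by move=> i; case: (HA i).
- have HA' i : nbhs y0 (A i) by case: (HA i).
  exact: (filter_forall (nbhs_filter y0) HA').
- by move=> m y Wm Ay i; have [_ _ _] := HA i; apply.
Qed.

Definition prod_gen (h : MR -> R) :=
  (exists2 f, sfun f & h = (fun p => f p.1)) \/
  (exists2 g, @sfun R (vspace 'rV[R]_k) g & h = (fun p => g p.2)).

Lemma prod_gen_near (h : MR -> R) m0 y0 (e : R) : 0 < e -> prod_gen h ->
  box_near m0 y0 (fun m y => `|h (m, y) - h (m0, y0)| < e).
Proof.
move=> e0 [[f Hf ->]|[g Hg ->]] /=.
  exists (fun m => `|f m - f m0| < e), setT; split=> //.
  - exact: sopen_ball.
  - by rewrite subrr normr0.
  - exact: filterT.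
have cg := Cinf_cont (Hg : Cinf (g : 'rV[R]_k -> R)).
exists (fun=> True), (fun y => `|g y - g y0| < e); split=> //.
- exact: sopenT.
- have /cvgrPdist_lt/(_ e e0) := cg y0.
  by apply: filterS => y; rewrite distrC.
Qed.

Lemma prodS_near (h : MR -> R) m0 y0 (e : R) : 0 < e -> sfun h ->
  box_near m0 y0 (fun m y => `|h (m, y) - h (m0, y0)| < e).
Proof.
move=> e0 Hh; have [n [g [p [d [Gg Hp d0 H]]]]] := Hh (m0, y0).
pose v0 := \row_i g i (m0, y0).
have cp := Cinf_cont Hp.
have /cvgrPdist_lt/(_ e e0)/nbhs_ballP[r r0 Hr] := cp v0.
have H1 : box_near m0 y0 (fun m y => forall i, `|g i (m, y) - g i (m0, y0)| < d).
  by apply: box_near_forall => i; exact: (prod_gen_near m0 y0 d0 (Gg i)).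
have H2 : box_near m0 y0 (fun m y => forall i, `|g i (m, y) - g i (m0, y0)| < r).
  by apply: box_near_forall => i; exact: (prod_gen_near m0 y0 r0 (Gg i)).
apply: box_nearS (box_nearI H1 H2) => m y [Hd Hr'].
rewrite (H (m, y))// (H (m0, y0)) => [|i]; last by rewrite subrr normr0.
rewrite distrC; apply: Hr; split=> // i j; rewrite !mxE /ball /= distrC; exact: Hr'.
Qed.

(** The generators of the product come from one factor each. Substituting those of the fibre into p
    leaves the fibre variable itself as an argument, so derivatives along the fibre become partial
    derivatives of a function on R^n. *)
Lemma smooth_at_prod_form (F : MR -> R) m0 y0 : smooth_at F (m0, y0) ->
  exists r (g : 'I_r -> M -> R) (p : 'rV[R]_(r + k) -> R),
    [/\ forall j, sfun (g j), Cinf p &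
        box_near m0 y0 (fun m y => F (m, y) = p (row_mx (\row_j g j m) y))].
Proof.
move=> [G [Z [HG HZ Zp FG]]].
have [r [g [p [d [Gg Hp d0 H]]]]] := HG (m0, y0).
have [h [Hh /eqP hp hZ]] := HZ _ Zp.
have /choice[a Ha] i : exists a : bool * (M -> R) * ('rV[R]_k -> R),
    [/\ sfun a.1.2, Cinf a.2 & g i = fun q => if a.1.1 then a.1.2 q.1 else a.2 q.2].
  case: (Gg i) => -[f Hf ->].
    by exists (true, f, fun=> 0); split=> //; exact: Cinf_cst.
  by exists (false, fun=> 0, f); split=> //; exact: sfun_cst.
exists r, (fun i => (a i).1.2), (fun z => p (\row_i
  if (a i).1.1 then z 0 (lshift k i) else (a i).2 (\row_j z 0 (rshift r j)))).
split.
- by move=> j; case: (Ha j).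
- apply: Cinf_comp => // i; have [_ Hai _] := Ha i.
  case: (a i) Hai => [[[] f] l] /= Hl; first exact: Cinf_coord.
  by apply: Cinf_comp => // j; exact: Cinf_coord.
- have hp0 : 0 < `|h (m0, y0)| by rewrite normr_gt0.
  have H1 : box_near m0 y0 (fun m y => forall i, `|g i (m, y) - g i (m0, y0)| < d).
    by apply: box_near_forall => i; exact: (prod_gen_near m0 y0 d0 (Gg i)).
  have H2 := prodS_near m0 y0 hp0 Hh.
  apply: box_nearS (box_nearI H1 H2) => m y [Hd Hr].
  have Zy : Z (m, y).
    by apply: hZ => h0; move: Hr; rewrite h0 sub0r normrN ltxx.
  rewrite FG// H//; congr p; apply/rowP => i; rewrite [LHS]mxE [RHS]mxE.
  have [_ _ ->] := Ha i; case: (a i).1.1 => /=.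
    by rewrite row_mxEl mxE.
  by congr ((a i).2 _); apply/rowP => j; rewrite mxE row_mxEr.
Qed.

End LocalForm.

(** * Frames, linear functions and tensoriality *)

Section VectorBundles.
Variables (R : realType) (E M : smoothSpace R) (V : vb_ops E M).
Hypothesis HV : is_vbundle V.
Local Notation pr := (vproj V).

Lemma vb_closedE : smooth_closed E.
Proof. by case: HV => /manifold_closed. Qed.

Lemma vb_closedM : smooth_closed M.
Proof. by case: HV => _ /manifold_closed. Qed.

Lemma vproj_smooth : smooth_map pr.
Proof. by case: HV. Qed.

Lemma vproj0 m : pr (vzero V m) = m.
Proof. by case: HV => _ _ _ [[]]. Qed.

Lemma vprojD x y : pr x = pr y -> pr (vadd V x y) = pr x.
Proof. by case: HV => _ _ _ [[_ + _] _] _; apply. Qed.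

Lemma vprojZ t x : pr (vscale V t x) = pr x.
Proof. by case: HV => _ _ _ [[_ _ +] _] _; apply. Qed.

Lemma vprojB x y : pr x = pr y -> pr (vsub V x y) = pr x.
Proof. by move=> xy; rewrite vprojD ?vprojZ. Qed.

Lemma vaddC x y : pr x = pr y -> vadd V x y = vadd V y x.
Proof. by case: HV => _ _ _ [_ [[+ _ _ _] _]] _; apply. Qed.

Lemma vaddx0 x m : pr x = m -> vadd V x (vzero V m) = x.
Proof. by move=> <-; case: HV => _ _ _ [_ [[_ _ + _] _]] _; apply. Qed.

Lemma vaddA x y z : pr x = pr y -> pr y = pr z ->
  vadd V x (vadd V y z) = vadd V (vadd V x y) z.
Proof. by case: HV => _ _ _ [_ [[_ + _ _] _]] _; apply. Qed.

Lemma vadd0x x m : pr x = m -> vadd V (vzero V m) x = x.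
Proof. by move=> xm; rewrite vaddC ?vproj0// vaddx0. Qed.

Lemma vscale1 x : vscale V 1 x = x.
Proof. by case: HV => _ _ _ [_ [_ [+ _ _ _]]] _; apply. Qed.

Lemma vscale0 x : vscale V 0 x = vzero V (pr x).
Proof.
have [_ _ _ [_ [[_ aA ax0 asub] [_ _ sD _]]] _] := HV.
set z := vscale V 0 x; have zp : pr z = pr x by rewrite vprojZ.
have zz : vadd V z z = z by rewrite /z -sD addr0.
rewrite -zp -(asub z) -{1}(ax0 z) -asub {1}/vsub aA ?vprojZ//.
by rewrite zz.
Qed.

Lemma vscale_zero t m : vscale V t (vzero V m) = vzero V m.
Proof.
have [_ _ _ [_ [_ [_ sM _ _]]] _] := HV.
by rewrite -{1}[m in vzero V m](vproj0 m) -vscale0 sM mulr0 vscale0 vproj0.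
Qed.

Lemma fl_D l x y : fibrewise_linear V l -> pr x = pr y -> l (vadd V x y) = l x + l y.
Proof. by case=> + _; apply. Qed.

Lemma fl_Z l t x : fibrewise_linear V l -> l (vscale V t x) = t * l x.
Proof. by case=> _; apply. Qed.

Lemma fl_0 l m : fibrewise_linear V l -> l (vzero V m) = 0.
Proof. by move=> Hl; rewrite -[m]vproj0 -vscale0 fl_Z// mul0r. Qed.

Lemma fl_B l x y : fibrewise_linear V l -> pr x = pr y -> l (vsub V x y) = l x - l y.
Proof. by move=> Hl xy; rewrite fl_D ?vprojZ// fl_Z// mulN1r. Qed.

Lemma vproj_lincomb k m (a : 'rV[R]_k) (s : 'I_k -> M -> E) :
  (forall i, pr (s i m) = m) -> pr (lincomb V m a s) = m.
Proof.
move=> Hs; rewrite /lincomb; apply: (big_ind (fun x => pr x = m)).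
- exact: vproj0.
- by move=> x y xm ym; rewrite vprojD ?xm ?ym.
- by move=> i _; rewrite vprojZ.
Qed.

Lemma fl_lincomb l k m (a : 'rV[R]_k) (s : 'I_k -> M -> E) :
  fibrewise_linear V l -> (forall i, pr (s i m) = m) ->
  l (lincomb V m a s) = \sum_i a 0 i * l (s i m).
Proof.
move=> Hl Hs; rewrite /lincomb.
suff [] : pr (\big[vadd V/vzero V m]_i vscale V (a 0 i) (s i m)) = m /\
  l (\big[vadd V/vzero V m]_i vscale V (a 0 i) (s i m)) =
    \sum_i a 0 i * l (s i m) by [].
apply: (big_rec2 (fun x r => pr x = m /\ l x = r)).
  by rewrite vproj0 fl_0.
move=> i x r _ [xm <-]; rewrite vprojD ?vprojZ ?Hs ?xm//.
by rewrite fl_D ?vprojZ ?Hs ?xm// fl_Z.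
Qed.

Definition local_form k (psi : M -> 'rV[R]_k -> E) (f : E -> R) m0 y0 :=
  exists r (g : 'I_r -> M -> R) (p : 'rV[R]_(r + k) -> R),
    [/\ forall j, sfun (g j), Cinf p &
        box_near m0 y0 (fun m y => f (psi m y) = p (row_mx (\row_j g j m) y))].

Lemma local_form_smooth (X : smoothSpace R) (HX : smooth_closed X) k
    (psi : M -> 'rV[R]_k -> E) (f : E -> R) (u : X -> M) (y : X -> 'rV[R]_k) x0 :
  smooth_map u -> (forall i, smooth_at (fun x => y x 0 i) x0) ->
  local_form psi f (u x0) (y x0) -> smooth_at (fun x => f (psi (u x) (y x))) x0.
Proof.
move=> Hu Hy [r [g [p [Hg Hp [W [A [HW Wx HA H]]]]]]].
have /nbhs_ballP[d d0 Hd] := HA.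
have /choice[h Hh] i : exists h, sfun h /\ exists U : X -> Prop,
    [/\ sopen U, U x0 & forall x, U x -> y x 0 i = h x].
  by have [h [U [Hh HU Ux yh]]] := Hy i; exists h; split=> //; exists U.
have /choice[U HU] i : exists U : X -> Prop,
    [/\ sopen U, U x0 & forall x, U x -> y x 0 i = h i x] by case: (Hh i).
pose G (i : 'I_(r + k)) : X -> R :=
  match fintype.split i with inl j => fun x => g j (u x) | inr j => h j end.
exists (fun x => p (\row_i G i x)),
  (fun x => W (u x) /\ ((forall i, U i x) /\ forall i, `|h i x - h i x0| < d)); split.
- apply: sfun_fin => // i; rewrite /G; case: (fintype.split i) => j.
    exact/Hu/Hg.
  by case: (Hh j).
- apply: sopenI => //; first exact: sopen_pull.
  apply: sopenI => //; first by apply: sopen_forall => // i; case: (HU i).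
  by apply: sopen_forall => // i; apply: sopen_ball => //; case: (Hh i).
- split=> //; split=> i; first by case: (HU i).
  by rewrite subrr normr0.
- move=> x [Wux [Ux hx]].
  have yx i : y x 0 i = h i x by have [_ _] := HU i; apply.
  have y0x i : y x0 0 i = h i x0 by have [_ ux] := HU i; apply.
  rewrite H//; last first.
    apply: Hd; split=> // i j; rewrite ord1 yx y0x /ball /= distrC; exact: hx.
  congr p; apply/rowP => i; rewrite [RHS]mxE /G [LHS]mxE.
  by case: (fintype.split i) => j; rewrite ?mxE.
Qed.

Lemma local_triv m0 : exists k (U : M -> Prop) (lam : E -> 'rV[R]_k)
    (psi : M -> 'rV[R]_k -> E),
  [/\ sopen U, U m0,
      forall x, U (pr x) -> psi (pr x) (lam x) = x,
      forall m y, U m -> pr (psi m y) = m /\ lam (psi m y) = y &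
      forall x i, U (pr x) -> smooth_at (fun x => lam x 0 i) x] /\
  [/\ forall f m y, sfun f -> U m -> local_form psi f m y,
      forall x y, U (pr x) -> pr x = pr y -> lam (vadd V x y) = lam x + lam y &
      forall t x, U (pr x) -> lam (vscale V t x) = t *: lam x].
Proof.
have [_ _ _ _ [k Hk]] := HV.
have [U [lam [psi [HU Um [D1 D2 S1 S2] lamD lamZ]]]] := Hk m0.
exists k, U, lam, (fun m y => psi (m, y)); split; split=> //.
- by move=> x /D1[].
- move=> m y Um'; have [_ E1] := D2 (m, y) Um'.
  by split; [have := congr1 fst E1|have := congr1 snd E1].
- move=> x i Ux; apply: (S1 (fun p => p.2 0 i)) => //.
  by apply: gen_incl; right; exists (fun y : 'rV[R]_k => y 0 i);
    first exact: Cinf_coord.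
- move=> f m y Hf Um'.
  exact: (@smooth_at_prod_form _ _ k vb_closedM (fun p => f (psi p)) m y
    (S2 f Hf (m, y) Um')).
Qed.

Lemma smooth_into_triv (X : smoothSpace R) (HX : smooth_closed X) k
    (psi : M -> 'rV[R]_k -> E) (s : X -> E) (u : X -> M) (y : X -> 'rV[R]_k) x0
    (W : X -> Prop) (f : E -> R) :
  sopen W -> W x0 -> (forall x, W x -> s x = psi (u x) (y x)) ->
  smooth_map u -> (forall i, smooth_at (fun x => y x 0 i) x0) ->
  local_form psi f (u x0) (y x0) -> smooth_at (fun x => f (s x)) x0.
Proof.
move=> HW Wx sE Hu Hy Hf.
apply: (smooth_at_eq HX HW Wx (g := fun x => f (psi (u x) (y x)))).
  by move=> x Wx'; rewrite sE.
exact: (local_form_smooth HX Hu Hy Hf).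
Qed.

Lemma vzero_section : section V (vzero V).
Proof.
split; last exact: vproj0.
move=> f Hf; apply: (sfun_local vb_closedM) => m0.
have [k [U [lam [psi [[HU Um D1 D2 _] [LF lamD lamZ]]]]]] := local_triv m0.
apply: (smooth_into_triv vb_closedM (u := id) (y := fun=> 0) HU Um) => //.
- move=> m Um'; rewrite -[LHS]D1 ?vproj0//; congr (psi m _).
  by rewrite -[m in LHS]vproj0 -vscale0 lamZ ?vproj0// scale0r.
- move=> i; apply: (sfun_smooth_at vb_closedM); under eq_fun do rewrite mxE.
  exact: sfun_cst vb_closedM _.
- exact: LF.
Qed.

(** These functions stand for the sections of the dual bundle. *)
Definition lin_fun (l : E -> R) := sfun l /\ fibrewise_linear V l.

(** A frame and its dual coframe over U that consist of globally defined sections and functions,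
    since smooth functions are global objects. The final clause expresses every smooth function on E
    in the coordinates of the frame. *)
Definition is_frame k (l : 'I_k -> E -> R) (e : 'I_k -> M -> E) (U : M -> Prop) :=
  [/\ sopen U, forall i, lin_fun (l i), forall i, section V (e i),
      forall x, U (pr x) -> lincomb V (pr x) (\row_i l i x) e = x &
      forall m i j, U m -> l i (e j m) = (i == j)%:R] /\
  forall f m y, sfun f -> U m -> local_form (fun m y => lincomb V m y e) f m y.

Lemma exists_frame m0 : exists k (l : 'I_k -> E -> R) (e : 'I_k -> M -> E) U,
  is_frame l e U /\ U m0.
Proof.
have [k [U [lam [psi [[HU Um D1 D2 Slam] [LF lamD lamZ]]]]]] := local_triv m0.
have [chi [Hchi [W [HW Wm W1]] chi0]] := bump vb_closedM HU Um.
have lamI x y : U (pr x) -> pr x = pr y -> lam x = lam y -> x = y.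
  by move=> Ux xy Exy; rewrite -(D1 x)// -(D1 y) -?xy// Exy.
have psiZ m t y : U m -> psi m (t *: y) = vscale V t (psi m y).
  move=> Um'; have [p1 p2] := D2 m (t *: y) Um'; have [p3 p4] := D2 m y Um'.
  by apply: lamI; rewrite ?p1 ?vprojZ ?p3// p2 lamZ ?p3// p4.
have lam0 m : U m -> lam (vzero V m) = 0.
  by move=> Um'; rewrite -[m in vzero V m]vproj0 -vscale0 lamZ ?vproj0// scale0r.
(* Basis sections, cut off and extended by zero. With [l] below they are dual to each other only
   where chi = 1, hence the smaller open set W. *)
pose e (i : 'I_k) m := if `[< U m >] then vscale V (chi m) (psi m (delta_mx 0 i))
  else vzero V m.
pose l i x := chi (pr x) * lam x 0 i.
have He i : section V (e i).
  split; last first.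
    move=> m; rewrite /e; case: asboolP => [Um'|_]; last exact: vproj0.
    by rewrite vprojZ; case: (D2 m (delta_mx 0 i) Um').
  move=> f Hf; apply: (sfun_local vb_closedM) => m.
  have [Um'|[N1 [HO Om chiO]]] := chi0 m; last first.
    apply: (smooth_at_eq vb_closedM HO Om (g := fun m => f (vzero V m))).
      move=> m' Om'; rewrite /e; case: asboolP => // Um'.
      by rewrite chiO// vscale0; case: (D2 m' (delta_mx 0 i) Um') => ->.
    apply: (sfun_smooth_at vb_closedM); exact: (vzero_section.1 f Hf).
  apply: (smooth_into_triv vb_closedM (psi := psi) (u := id)
    (y := fun m => chi m *: delta_mx 0 i) HU Um') => //.
  + by move=> m1 Um1; rewrite /e; case: asboolP => // _; rewrite psiZ.
  + move=> j; apply: (sfun_smooth_at vb_closedM); under eq_fun do rewrite mxE.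
    by apply: (sfun_mul vb_closedM) => //; exact: sfun_cst vb_closedM _.
  + exact: LF.
have Hl i : lin_fun (l i).
  split.
    apply: (sfun_local vb_closedE) => x.
    have [Ux|[N1 [HO Ox chiO]]] := chi0 (pr x).
      apply: (smooth_at_mul vb_closedE); last exact: Slam.
      apply: (sfun_smooth_at vb_closedE); exact: vproj_smooth.
    apply: (smooth_at_eq vb_closedE (sopen_pull vproj_smooth HO) Ox (g := fun=> 0)).
      by move=> y Oy; rewrite /l chiO// mul0r.
    apply: (sfun_smooth_at vb_closedE); exact: sfun_cst vb_closedE _.
  have C m : U m \/ chi m = 0.
    have [?|[N1 [_ Ox chiO]]] := chi0 m; first by left.
    by right; exact: chiO.
  split=> [x y xy|t x]; rewrite /l ?vprojD ?vprojZ//.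
    rewrite -xy; have [Ux|->] := C (pr x); last by rewrite !mul0r addr0.
    by rewrite lamD// mxE mulrDr.
  have [Ux|->] := C (pr x); last by rewrite !mul0r mulr0.
  by rewrite lamZ// mxE mulrCA.
have eE m i : W m -> e i m = psi m (delta_mx 0 i).
  move=> Wm'; have [Um' chi1] := W1 m Wm'.
  by rewrite /e; case: asboolP => // _; rewrite chi1 vscale1.
have eC m y : W m -> lincomb V m y e = psi m y.
  move=> Wm'; have [Um' chi1] := W1 m Wm'.
  have pe i : pr (e i m) = m by case: (He i).
  have [p1 p2] := D2 m y Um'.
  apply: lamI; rewrite ?vproj_lincomb ?p1//.
  apply/rowP => i; have := fl_lincomb y (Hl i).2 pe.
  rewrite {1}/l vproj_lincomb// chi1 mul1r => ->; rewrite p2 (bigD1 i)//= big1 ?addr0.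
    have [q1 q2] := D2 m (delta_mx 0 i) Um'.
    by rewrite eE// /l q1 chi1 mul1r q2 mxE !eqxx mulr1.
  move=> j ji; have [q1 q2] := D2 m (delta_mx 0 j) Um'.
  by rewrite eE// /l q1 chi1 mul1r q2 mxE [i == j]eq_sym (negbTE ji) andbF mulr0.
exists k, l, e, W; split=> //; split; first split=> //.
- move=> x Wx; have [Ux chi1] := W1 _ Wx.
  rewrite eC// -[RHS]D1//; congr (psi _ _); apply/rowP => i.
  by rewrite mxE /l chi1 mul1r.
- move=> m i j Wm'; have [Um' chi1] := W1 _ Wm'.
  have [q1 q2] := D2 m (delta_mx 0 j) Um'.
  by rewrite eE// /l q1 chi1 mul1r q2 mxE eqxx.
- move=> f m y Hf Wm'; have [Um' _] := W1 _ Wm'.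
  have [r [g [p [Hg Hp [W' [A [HW' Wm1 HA H]]]]]]] := LF f m y Hf Um'.
  exists r, g, p; split=> //; exists (fun m => W m /\ W' m), A; split=> //.
    exact: (sopenI vb_closedM).
  by move=> m' y' [Wm2 Wm3] Ay; rewrite eC// H.
Qed.

(** Used throughout for identities in a fibre: linear functions turn them into identities of real
    numbers, where ordinary algebra applies. *)
Lemma lin_sep x y : pr x = pr y -> (forall l, lin_fun l -> l x = l y) -> x = y.
Proof.
move=> xy H; have [k [l [e [U [[[_ Hl _ Hx _] _] Ux]]]]] := exists_frame (pr x).
rewrite -(Hx x)// -(Hx y) -?xy//; congr lincomb.
by apply/rowP => i; rewrite !mxE H.
Qed.

Lemma smooth_criterion (X : smoothSpace R) (HX : smooth_closed X) (s : X -> E) :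
  smooth_map (fun x => pr (s x)) ->
  (forall l, lin_fun l -> sfun (fun x => l (s x))) -> smooth_map s.
Proof.
move=> Hp Hl f Hf; apply: (sfun_local HX) => x0.
have [k [l [e [U [[[HU Hl' He Hx _] LF] Ux]]]]] := exists_frame (pr (s x0)).
apply: (smooth_into_triv HX (psi := fun m y => lincomb V m y e)
  (u := fun x => pr (s x)) (y := fun x => \row_i l i (s x)) (sopen_pull Hp HU) Ux _ Hp).
- by move=> x Uy; rewrite Hx.
- move=> i; apply: (sfun_smooth_at HX).
  by under eq_fun do rewrite mxE; exact: Hl.
- exact: LF.
Qed.

Lemma section_criterion (s : M -> E) : (forall m, pr (s m) = m) ->
  (forall l, lin_fun l -> sfun (fun m => l (s m))) -> section V s.
Proof.
move=> ps Hl; split=> //; apply: (smooth_criterion vb_closedM) => //.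
by rewrite (_ : (fun x => pr (s x)) = id)//; exact/funext.
Qed.

Lemma sadd_section s1 s2 : section V s1 -> section V s2 -> section V (sadd V s1 s2).
Proof.
move=> [H1 p1] [H2 p2]; apply: section_criterion => [m|l [Hl fl]].
  by rewrite /sadd vprojD ?p1 ?p2.
rewrite /sadd; under eq_fun => m do rewrite (fl_D fl) ?p1 ?p2//.
by apply: (sfun_add vb_closedM); [exact: H1|exact: H2].
Qed.

Lemma sscale_section f s : sfun f -> section V s -> section V (sscale V f s).
Proof.
move=> Hf [H p]; apply: section_criterion => [m|l [Hl fl]].
  by rewrite /sscale vprojZ p.
rewrite /sscale; under eq_fun => m do rewrite (fl_Z _ _ fl).
by apply: (sfun_mul vb_closedM) => //; exact: H.
Qed.

Lemma section_through x : exists2 s, section V s & s (pr x) = x.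
Proof.
have [k [l [e [U [[[_ Hl He Hx _] _] Ux]]]]] := exists_frame (pr x).
have pe i m : pr (e i m) = m by case: (He i).
exists (fun m => lincomb V m (\row_i l i x) e); last exact: Hx.
apply: section_criterion => [m|l' [Hl' fl]]; first exact: vproj_lincomb.
under eq_fun => m do rewrite (fl_lincomb _ fl)//.
apply: (sfun_sum vb_closedM) => i; apply: (sfun_mul vb_closedM).
  by under eq_fun do rewrite mxE; exact: sfun_cst vb_closedM _.
by case: (He i) => + _; apply.
Qed.

Lemma lincombS k m (a : 'rV[R]_k.+1) (s : 'I_k.+1 -> M -> E) : lincomb V m a s =
  vadd V (vscale V (a 0 ord0) (s ord0 m))
    (lincomb V m (\row_i a 0 (lift ord0 i)) (fun i => s (lift ord0 i))).
Proof.
by rewrite /lincomb big_ord_recl; congr vadd; apply: eq_bigr => i _; rewrite mxE.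
Qed.

Lemma lincomb_sectionS k (g : 'I_k.+1 -> M -> R) (s : 'I_k.+1 -> M -> E) :
  (fun m => lincomb V m (\row_i g i m) s) =
  sadd V (sscale V (g ord0) (s ord0)) (fun m =>
    lincomb V m (\row_i g (lift ord0 i) m) (fun i => s (lift ord0 i))).
Proof.
apply/funext => m; rewrite lincombS /sadd /sscale mxE; congr vadd.
by congr lincomb; apply/rowP => i; rewrite !mxE.
Qed.

Lemma lincomb_section k (g : 'I_k -> M -> R) (s : 'I_k -> M -> E) :
  (forall i, sfun (g i)) -> (forall i, section V (s i)) ->
  section V (fun m => lincomb V m (\row_i g i m) s).
Proof.
elim: k g s => [|k IH] g s Hg Hs.
  rewrite (_ : (fun m => _) = vzero V); first exact: vzero_section.
  by apply/funext => m; rewrite /lincomb big_ord0.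
rewrite lincomb_sectionS; apply: sadd_section; first exact: sscale_section.
exact: IH.
Qed.

Section Tensorial.
Variables (F : (M -> E) -> R) (m0 : M).
Hypothesis FD : forall s1 s2, section V s1 -> section V s2 ->
  F (sadd V s1 s2) = F s1 + F s2.
Hypothesis FZ : forall f s, sfun f -> section V s -> F (sscale V f s) = f m0 * F s.

Lemma tensor_zero : F (vzero V) = 0.
Proof.
have := FZ (sfun_cst vb_closedM 0) vzero_section.
rewrite mul0r => <-; congr F; apply/funext => m.
by rewrite /sscale vscale0 vproj0.
Qed.

Lemma tensor_lincomb k (g : 'I_k -> M -> R) (s : 'I_k -> M -> E) :
  (forall i, sfun (g i)) -> (forall i, section V (s i)) ->
  F (fun m => lincomb V m (\row_i g i m) s) = \sum_i g i m0 * F (s i).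
Proof.
elim: k g s => [|k IH] g s Hg Hs.
  rewrite big_ord0 (_ : (fun m => _) = vzero V); first exact: tensor_zero.
  by apply/funext => m; rewrite /lincomb big_ord0.
rewrite lincomb_sectionS FD; last exact: lincomb_section.
  by rewrite FZ// IH// big_ord_recl.
exact: sscale_section.
Qed.

Lemma pointwise s1 s2 : section V s1 -> section V s2 -> s1 m0 = s2 m0 -> F s1 = F s2.
Proof.
have [k [l [e [U [[[HU Hl He Hx _] _] Um]]]]] := exists_frame m0.
have [chi [Hchi [W [HW Wm W1]] chi0]] := bump vb_closedM HU Um.
have pe i m : pr (e i m) = m by case: (He i).
have loc s : section V s -> F s = \sum_i l i (s m0) * F (e i).
  move=> [Hs ps].
  have Hg i : sfun (fun m => chi m * l i (s m)).
    by apply: (sfun_mul vb_closedM) => //; apply: Hs; case: (Hl i).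
  have := tensor_lincomb Hg He.
  have [Um' chi1] := W1 _ Wm.
  under eq_bigr do rewrite chi1 mul1r; move=> <-.
  (* As chi is 1 at m0, F s = F (chi s). The section chi s is globally a combination of the frame,
     with coefficients chi l_i(s) that vanish off U. *)
  rewrite -[LHS]mul1r -chi1 -FZ//; congr F; apply/funext => m.
  rewrite /sscale; have [Um1|[N1 [_ Om chiO]]] := chi0 m.
    apply: lin_sep => [|l' [_ fl]]; first by rewrite vprojZ vproj_lincomb.
    rewrite (fl_Z _ _ fl) (fl_lincomb _ fl)// -{1}[s m]Hx ?ps//.
    by rewrite (fl_lincomb _ fl)// mulr_sumr; apply: eq_bigr => i _; rewrite !mxE mulrA.
  apply: lin_sep => [|l' [_ fl]]; first by rewrite vprojZ vproj_lincomb.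
  rewrite (fl_Z _ _ fl) (fl_lincomb _ fl)// chiO// mul0r big1// => i _.
  by rewrite mxE !mul0r.
by move=> H1 H2 E12; rewrite !loc// E12.
Qed.

End Tensorial.

End VectorBundles.

Lemma vscaleA (R : realType) (E M : smoothSpace R) (V : vb_ops E M)
  (HV : is_vbundle V) s t x : vscale V s (vscale V t x) = vscale V (s * t) x.
Proof. by case: HV => _ _ _ [_ [_ [_ H _ _]]] _; exact: H. Qed.

(** A frame with at least one element would satisfy l(e(m)) = 1 although e(m) = 0, so the local rank
    is 0. *)
Lemma zero_fibre_near (R : realType) (E M : smoothSpace R) (V : vb_ops E M)
  (HV : is_vbundle V) m : (forall x, vproj V x = m -> x = vzero V m) ->
  exists U, [/\ sopen U, U m & forall x, U (vproj V x) -> x = vzero V (vproj V x)].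
Proof.
move=> H0; have [k [l [e [U [[[HU Hl He Hx Hdelta] _] Um]]]]] := exists_frame HV m.
exists U; split=> // x Ux.
case: k l e Hl He Hx Hdelta => [|k] l e Hl He Hx Hdelta.
  by rewrite -[LHS](Hx _ Ux) /lincomb big_ord0.
have [_ pe] := He ord0; have := Hdelta _ ord0 ord0 Um.
rewrite eqxx (H0 (e ord0 m)) ?pe// (fl_0 HV _ (Hl ord0).2) => /eqP.
by rewrite eq_sym oner_eq0.
Qed.

Lemma comb_linear (R : realType) (E M : smoothSpace R) (V : vb_ops E M)
  (HV : is_vbundle V) (G : (M -> E) -> (M -> E)) :
  (forall t, section V t -> section V (G t)) ->
  (forall r t t', section V t -> section V t' ->
    G (sadd V (sscale V (fun=> r) t) t') = sadd V (sscale V (fun=> r) (G t)) (G t')) ->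
  (forall t t', section V t -> section V t' -> G (sadd V t t') = sadd V (G t) (G t')) /\
  (forall r t, section V t -> G (sscale V (fun=> r) t) = sscale V (fun=> r) (G t)).
Proof.
move=> HG HC.
have E1 t t' : sadd V t t' = sadd V (sscale V (fun=> 1) t) t'.
  by apply/funext => m; rewrite /sadd /sscale (vscale1 HV).
have E0 t : section V t -> sadd V t (vzero V) = t.
  by move=> [_ pt]; apply/funext => m; rewrite /sadd (vaddx0 HV).
have H0 := vzero_section HV.
have z r : sscale V (fun=> r) (vzero V) = vzero V.
  by apply/funext => m; rewrite /sscale (vscale_zero HV).
have G0 : G (vzero V) = vzero V.
  (* With r = -1 and both sections zero, the hypothesis reads G 0 = - G 0 + G 0. *)
  have := HC (-1) _ _ H0 H0; rewrite z E0// => ->; have [_ pG] := HG _ H0.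
  apply/funext => m; apply: (lin_sep HV) => [|la [_ fl]].
    by rewrite /sadd /sscale (vprojD HV) ?(vprojZ HV) ?pG// (vproj0 HV).
  rewrite /sadd /sscale (fl_D fl) ?(vprojZ HV)// (fl_Z _ _ fl) (fl_0 HV _ fl).
  by rewrite mulN1r addNr.
split=> [t t' Ht Ht'|r t Ht]; first by rewrite [in LHS]E1 HC// -E1.
have Hr := sscale_section HV (sfun_cst (vb_closedM HV) r).
by rewrite -[in LHS](E0 _ (Hr _ Ht)) HC// G0 E0//; exact: Hr _ (HG _ Ht).
Qed.

(** * Tangent vectors and the tangent prolongation *)

Section TangentVectors.
Variable R : realType.
Implicit Types X Y : smoothSpace R.

Lemma is_derive_mul (f g : R -> R) (t a b : R) :
  is_derive t 1 f a -> is_derive t 1 g b ->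
  is_derive t 1 (fun s => f s * g s) (a * g t + f t * b).
Proof.
move=> df dg; have H := is_deriveM df dg.
by apply: (is_derive_eq H); rewrite /GRing.scale /=; ring.
Qed.

Lemma tvec_eq X (u v : tvec X) : tpt u = tpt v ->
  (forall f, sfun f -> tval u f = tval v f) -> u = v.
Proof.
case: u v => [x u Hu] [y v Hv] /= xy uv; subst y.
have Euv : u = v.
  apply/funext => f; have [Hf|Hf] := pselect (sfun f); first exact: uv.
  by case: Hu => -> // _ _ _; case: Hv => ->.
by subst v; congr TVec; exact: Prop_irrelevance.
Qed.

Lemma tpt_mktvec X (x : X) v : tpt (mktvec x v) = x.
Proof. by rewrite /mktvec; case: pselect. Qed.

Lemma tval_mktvec X (HX : smooth_closed X) (x : X) v f :
  (forall f g, sfun f -> sfun g -> v (fun y => f y + g y) = v f + v g) ->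
  (forall a f, sfun f -> v (fun y => a * f y) = a * v f) ->
  (forall f g, sfun f -> sfun g -> v (fun y => f y * g y) = v f * g x + f x * v g) ->
  sfun f -> tval (mktvec x v) f = v f.
Proof.
move=> HD HZ HM Hf; rewrite /mktvec; case: pselect => [H|[]] /=.
  by rewrite asboolT.
split=> [h Hh|h k Hh Hk|a h Hh|h k Hh Hk]; first by rewrite asboolF.
- by rewrite !asboolT//; [exact: HD|exact: (sfun_add HX)].
- rewrite !asboolT//; first exact: HZ.
  by apply: (sfun_mul HX) => //; exact: sfun_cst HX _.
- by rewrite !asboolT//; [exact: HM|exact: (sfun_mul HX)].
Qed.

Section TangentAlgebra.
Variable X : smoothSpace R.
Hypothesis HX : smooth_closed X.
Implicit Types (v : TS X) (f g : X -> R).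

Lemma tvalD v f g : sfun f -> sfun g ->
  tval v (fun y => f y + g y) = tval v f + tval v g.
Proof. by case: (tvalP v) => _ + _ _; apply. Qed.

Lemma tvalZ v a f : sfun f -> tval v (fun y => a * f y) = a * tval v f.
Proof. by case: (tvalP v) => _ _ + _; apply. Qed.

Lemma tvalM v f g : sfun f -> sfun g ->
  tval v (fun y => f y * g y) = tval v f * g (tpt v) + f (tpt v) * tval v g.
Proof. by case: (tvalP v) => _ _ _; apply. Qed.

Lemma tval_cst v a : tval v (fun=> a) = 0.
Proof.
have H1 : tval v (fun=> 1) = 0.
  have := tvalM v (sfun_cst HX 1) (sfun_cst HX 1).
  rewrite !mulr1 mul1r => /eqP; rewrite -{1}[tval v _]addr0 (inj_eq (addrI _)).
  by rewrite eq_sym => /eqP.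
have := tvalZ v a (sfun_cst HX 1); rewrite H1 mulr0 => <-.
by congr (tval v _); apply/funext => y; rewrite mulr1.
Qed.

Lemma tvalB v f g : sfun f -> sfun g ->
  tval v (fun y => f y - g y) = tval v f - tval v g.
Proof.
move=> Hf Hg; rewrite tvalD//; last exact: sfun_opp.
congr (_ + _); rewrite -mulN1r -tvalZ//.
by congr (tval v _); apply/funext => y; rewrite mulN1r.
Qed.

Lemma tpt_tzero m : tpt (vzero (tangent_vb X) m) = m.
Proof. exact: tpt_mktvec. Qed.

Lemma tval_tzero m f : tval (vzero (tangent_vb X) m) f = 0.
Proof.
have [Hf|Hf] := pselect (sfun f); last by case: (tvalP (vzero (tangent_vb X) m)) => ->.
by rewrite /= tval_mktvec// => *; rewrite ?addr0 ?mulr0 ?mul0r ?addr0.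
Qed.

Lemma tpt_tadd v w : tpt (vadd (tangent_vb X) v w) = tpt v.
Proof. exact: tpt_mktvec. Qed.

Lemma tval_tadd v w f : tpt v = tpt w -> sfun f ->
  tval (vadd (tangent_vb X) v w) f = tval v f + tval w f.
Proof.
move=> vw Hf; rewrite /= tval_mktvec// => [g h Hg Hh|a g Hg|g h Hg Hh].
- by rewrite !tvalD//; ring.
- by rewrite !tvalZ//; ring.
- by rewrite !tvalM// -vw; ring.
Qed.

Lemma tpt_tscale t v : tpt (vscale (tangent_vb X) t v) = tpt v.
Proof. exact: tpt_mktvec. Qed.

Lemma tval_tscale t v f : sfun f -> tval (vscale (tangent_vb X) t v) f = t * tval v f.
Proof.
move=> Hf; rewrite /= tval_mktvec// => [g h Hg Hh|a g Hg|g h Hg Hh].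
- by rewrite !tvalD//; ring.
- by rewrite !tvalZ//; ring.
- by rewrite !tvalM//; ring.
Qed.

Lemma curve_derivable (c : R -> X) (t : R) f : smooth_curve c -> sfun f ->
  is_derive t 1 (fun t => f (c t)) (derive1 (fun t => f (c t)) t).
Proof.
move=> Hc Hf; rewrite derive1E; apply: derivableP.
exact: (@Cinf_derivable R R (fun t => f (c t)) t 1 (Hc f Hf)).
Qed.

Lemma tpt_velocity (c : R -> X) : tpt (velocity c) = c 0.
Proof. exact: tpt_mktvec. Qed.

Lemma velocityP (c : R -> X) f d : smooth_curve c -> sfun f ->
  is_derive (0 : R) 1 (fun t => f (c t)) d -> tval (velocity c) f = d.
Proof.
move=> Hc Hf Hd.
have D1 (g : R -> R) (e : R) : is_derive (0 : R) 1 g e -> derive1 g 0 = e.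
  by rewrite derive1E => -[].
rewrite tval_mktvec//; first exact: D1.
- move=> g h Hg Hh; apply: D1.
  exact: (is_deriveD (curve_derivable 0 Hc Hg) (curve_derivable 0 Hc Hh)).
- move=> a g Hg; apply: D1.
  exact: (is_deriveZ a (curve_derivable 0 Hc Hg)).
- move=> g h Hg Hh; apply: D1.
  exact: (is_derive_mul (curve_derivable 0 Hc Hg) (curve_derivable 0 Hc Hh)).
Qed.

Lemma is_derive_velocity (c : R -> X) f : smooth_curve c -> sfun f ->
  is_derive (0 : R) 1 (fun t => f (c t)) (tval (velocity c) f).
Proof.
move=> Hc Hf; rewrite (velocityP Hc Hf (curve_derivable 0 Hc Hf)).
exact: curve_derivable.
Qed.

Lemma velocity_near (c d : R -> X) : smooth_curve c -> smooth_curve d ->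
  (\forall t \near (0 : R), c t = d t) -> velocity c = velocity d.
Proof.
move=> Hc Hd cd; apply: tvec_eq => [|f Hf].
  by rewrite !tpt_velocity (nbhs_singleton cd).
apply: (velocityP Hc Hf); apply: near_eq_is_derive (is_derive_velocity Hd Hf).
by apply: filterS cd => t ->.
Qed.

Lemma sfun_tpt f : sfun f -> @sfun R (TS X) (fun v : TS X => f (tpt v)).
Proof. by move=> Hf; apply: gen_incl; left; exists f. Qed.

Lemma sfun_tval f : sfun f -> @sfun R (TS X) (fun v : TS X => tval v f).
Proof. by move=> Hf; apply: gen_incl; right; exists f. Qed.

End TangentAlgebra.

Lemma smooth_into_TS X Y (HY : smooth_closed Y) (s : Y -> TS X) :
  (forall f, sfun f -> sfun (fun y => f (tpt (s y)))) ->
  (forall f, sfun f -> sfun (fun y => tval (s y) f)) -> smooth_map s.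
Proof.
move=> H1 H2 h Hh; apply: HY.
by apply: gen_pull Hh => g [[f Hf ->]|[f Hf ->]]; [exact: H1|exact: H2].
Qed.

Lemma tpt_Tmap X Y (phi : X -> Y) v : tpt (Tmap phi v) = phi (tpt v).
Proof. exact: tpt_mktvec. Qed.

Lemma tval_Tmap X Y (HY : smooth_closed Y) (phi : X -> Y) v f :
  smooth_map phi -> sfun f -> tval (Tmap phi v) f = tval v (fun x => f (phi x)).
Proof.
move=> Hp Hf; rewrite tval_mktvec// => [g h Hg Hh|a g Hg|g h Hg Hh].
- by rewrite tvalD//; exact: Hp.
- by rewrite tvalZ//; exact: Hp.
- by rewrite tvalM//; exact: Hp.
Qed.

Lemma Tmap_smooth X Y (HY : smooth_closed Y) (phi : X -> Y) :
  smooth_map phi -> smooth_map (Tmap phi).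
Proof.
move=> Hp h Hh; apply: gen_pull Hh => g [[f Hf ->]|[f Hf ->]].
  left; exists (fun x => f (phi x)); first exact: Hp.
  by apply/funext => v; rewrite tpt_Tmap.
right; exists (fun x => f (phi x)); first exact: Hp.
by apply/funext => v; rewrite tval_Tmap.
Qed.

Lemma Tmap_comp X Y (Z : smoothSpace R) (HY : smooth_closed Y) (HZ : smooth_closed Z)
    (phi : X -> Y) (psi : Y -> Z) v : smooth_map phi -> smooth_map psi ->
  Tmap psi (Tmap phi v) = Tmap (fun x => psi (phi x)) v.
Proof.
move=> Hp Hq; have Hc : smooth_map (fun x => psi (phi x)).
  by move=> f Hf; exact: (Hp _ (Hq _ Hf)).
apply: tvec_eq => [|f Hf]; first by rewrite !tpt_Tmap.
by rewrite !tval_Tmap//; exact: Hq.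
Qed.

Lemma Tmap_id X (HX : smooth_closed X) (phi : X -> X) v :
  (forall x, phi x = x) -> Tmap phi v = v.
Proof.
move=> E; have {E}-> : phi = id by exact/funext.
by apply: tvec_eq => [|f Hf]; rewrite ?tpt_Tmap// tval_Tmap.
Qed.

Lemma Tmap_velocity X Y (HX : smooth_closed X) (HY : smooth_closed Y)
    (phi : X -> Y) (c : R -> X) : smooth_map phi -> smooth_curve c ->
  Tmap phi (velocity c) = velocity (fun t => phi (c t)).
Proof.
move=> Hp Hc; have Hpc : smooth_curve (fun t => phi (c t)).
  by move=> f Hf; exact: (Hc _ (Hp f Hf)).
apply: tvec_eq => [|f Hf]; first by rewrite tpt_Tmap !tpt_velocity.
rewrite tval_Tmap//; symmetry; apply: (velocityP HY Hpc Hf).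
by apply: (is_derive_velocity HX Hc); exact: Hp.
Qed.

(* [velocity], sealed: unification otherwise unfolds it down to limits. *)
Fact vel_key : {v : forall X, (R -> X) -> TS X | v = fun X => @velocity R X}.
Proof. by exists (fun X => @velocity R X). Qed.

Definition vel X (c : R -> X) : TS X := sval vel_key X c.

Lemma velE X (c : R -> X) : velocity c = vel c.
Proof. by rewrite /vel; case: vel_key => v /= ->. Qed.

Lemma tpt_vel X (c : R -> X) : tpt (vel c) = c 0.
Proof. by rewrite -velE tpt_velocity. Qed.

Lemma vel_val X (HX : smooth_closed X) (c : R -> X) f d : smooth_curve c -> sfun f ->
  is_derive (0 : R) 1 (fun t => f (c t)) d -> tval (vel c) f = d.
Proof. by rewrite -velE; exact: velocityP. Qed.

Lemma is_derive_vel X (HX : smooth_closed X) (c : R -> X) f :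
  smooth_curve c -> sfun f ->
  is_derive (0 : R) 1 (fun t => f (c t)) (tval (vel c) f).
Proof. by rewrite -velE; exact: is_derive_velocity. Qed.

Lemma vel_near X (HX : smooth_closed X) (c d : R -> X) :
  smooth_curve c -> smooth_curve d ->
  (\forall t \near (0 : R), c t = d t) -> vel c = vel d.
Proof. by rewrite -!velE; exact: velocity_near. Qed.

Lemma Tmap_vel X Y (HX : smooth_closed X) (HY : smooth_closed Y)
    (phi : X -> Y) (c : R -> X) : smooth_map phi -> smooth_curve c ->
  Tmap phi (vel c) = vel (fun t => phi (c t)).
Proof. by rewrite -!velE; exact: Tmap_velocity. Qed.

End TangentVectors.

Section BundleTangent.
Variables (R : realType) (E M : smoothSpace R) (V : vb_ops E M).
Hypothesis HV : is_vbundle V.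
Local Notation pr := (vproj V).
Let HE := vb_closedE HV.
Let HM := vb_closedM HV.

Lemma smooth_vadd (X : smoothSpace R) (HX : smooth_closed X) (s1 s2 : X -> E) :
  smooth_map s1 -> smooth_map s2 -> (forall x, pr (s1 x) = pr (s2 x)) ->
  smooth_map (fun x => vadd V (s1 x) (s2 x)).
Proof.
move=> H1 H2 E12; apply: (smooth_criterion HV HX) => [f Hf|l [Hl fl]].
  under eq_fun => x do rewrite (vprojD HV)//.
  exact: (H1 _ (vproj_smooth HV Hf)).
under eq_fun => x do rewrite (fl_D fl)//.
by apply: (sfun_add HX); [exact: H1|exact: H2].
Qed.

Lemma smooth_vscale (X : smoothSpace R) (HX : smooth_closed X) (a : X -> R)
  (s : X -> E) : sfun a -> smooth_map s -> smooth_map (fun x => vscale V (a x) (s x)).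
Proof.
move=> Ha Hs; apply: (smooth_criterion HV HX) => [f Hf|l [Hl fl]].
  under eq_fun => x do rewrite (vprojZ HV)//.
  exact: (Hs _ (vproj_smooth HV Hf)).
under eq_fun => x do rewrite (fl_Z _ _ fl)//.
by apply: (sfun_mul HX) => //; exact: Hs.
Qed.

Let HR := @vspace_closed R R.

Lemma smooth_line (x y : E) : pr x = pr y ->
  smooth_curve (fun t => vadd V x (vscale V t y)).
Proof.
move=> xy; apply: (smooth_vadd HR).
- by move=> f Hf; exact: (sfun_cst HR).
- apply: (smooth_vscale HR (a := id)); first exact: Cinf_id.
  by move=> f Hf; exact: (sfun_cst HR).
- by move=> t; rewrite (vprojZ HV).
Qed.

(** The chain rule in a local form of f. The coefficients depend on x0 but not on the curve, so a
    velocity at x0 is known from its values on base functions and on linear functions. *)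
Lemma curve_form f x0 : sfun f -> exists r (g : 'I_r -> M -> R) k
    (l : 'I_k -> E -> R) (A : 'I_r -> R) (B : 'I_k -> R),
  [/\ forall j, sfun (g j), forall i, lin_fun V (l i) &
      forall c : R -> E, smooth_curve c -> c 0 = x0 ->
        tval (vel c) f =
          \sum_j A j * tval (vel c) (fun x => g j (pr x)) +
          \sum_i B i * tval (vel c) (l i)].
Proof.
move=> Hf.
have [k [l [e [U [[[HU Hl He Hx _] LF] Ux]]]]] := exists_frame HV (pr x0).
have [r [g [p [Hg Hp [W [S [HW Wx HS H]]]]]]] := LF f _ (\row_i l i x0) Hf Ux.
pose z x := row_mx (\row_j g j (pr x)) (\row_i l i x) : 'rV[R]_(r + k).
exists r, g, k, l, (fun j => 'D_(delta_mx 0 (lshift k j)) p (z x0)),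
  (fun i => 'D_(delta_mx 0 (rshift r i)) p (z x0)); split=> // c Hc c0.
have Hpc : smooth_curve (fun t => pr (c t)).
  by move=> h Hh; exact: (Hc _ (vproj_smooth HV Hh)).
pose dz (i : 'I_(r + k)) := match fintype.split i with
  | inl j => tval (vel c) (fun x => g j (pr x))
  | inr j => tval (vel c) (l j) end.
have Hz i : is_derive (0 : R) 1 (fun t => z (c t) 0 i) (dz i).
  rewrite /z /dz; under eq_fun do rewrite mxE.
  case: (fintype.split i) => j; under eq_fun do rewrite mxE.
    apply: (is_derive_vel HE Hc); exact: (vproj_smooth HV (Hg j)).
  by apply: (is_derive_vel HE Hc); case: (Hl j).
have Hd := is_derive_comp (c := fun t => z (c t)) Hp Hz.
have -> : tval (vel c) f = \sum_i dz i * 'D_(delta_mx 0 i) p (z (c 0)).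
  apply: (vel_val HE Hc Hf); apply: near_eq_is_derive Hd.
  have N1 : \forall t \near (0 : R), U (pr (c t)).
    by apply: (curve_near Hpc HU); rewrite c0.
  have N2 : \forall t \near (0 : R), W (pr (c t)).
    by apply: (curve_near Hpc HW); rewrite c0.
  have N3 : \forall t \near (0 : R), S (\row_i l i (c t)).
    have : (\row_i l i (c t)) @[t --> (0 : R)] --> (\row_i l i x0).
      rewrite -c0; apply: cvg_row => i.
      exact: (Cinf_cont (Hc _ (Hl i).1 : Cinf (fun t : R => l i (c t)))).
    exact.
  near=> t; rewrite -[in RHS](Hx (c t)); last by near: t.
  by rewrite H //; near: t.
rewrite c0 big_split_ord /=; congr (_ + _); apply: eq_bigr => j _.
  by rewrite /dz (unsplitK (inl j : 'I_r + 'I_k)%type) mulrC.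
by rewrite /dz (unsplitK (inr j : 'I_r + 'I_k)%type) mulrC.
Unshelve. all: by end_near. Qed.

Lemma vel_ext (c d : R -> E) : smooth_curve c -> smooth_curve d ->
  c 0 = d 0 ->
  (forall g, sfun g -> tval (vel c) (fun x => g (pr x)) =
    tval (vel d) (fun x => g (pr x))) ->
  (forall l, lin_fun V l -> tval (vel c) l = tval (vel d) l) ->
  vel c = vel d.
Proof.
move=> Hc Hd cd Hg Hl; apply: tvec_eq => [|f Hf]; first by rewrite !tpt_vel.
have [r [g [k [l [A [B [Hg' Hl' H]]]]]]] := curve_form (c 0) Hf.
rewrite (H _ Hc erefl) (H _ Hd (esym cd)); apply: f_equal2.
  by apply: eq_bigr => i _; rewrite (Hg _ (Hg' i)).
by apply: eq_bigr => i _; rewrite (Hl _ (Hl' i)).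
Qed.

Lemma vel_base (c d : R -> E) g : smooth_curve c -> smooth_curve d -> sfun g ->
  (forall t, pr (c t) = pr (d t)) ->
  tval (vel c) (fun x => g (pr x)) = tval (vel d) (fun x => g (pr x)).
Proof.
move=> Hc Hd Hg cd; have Hgp := vproj_smooth HV Hg.
apply: (vel_val HE Hc Hgp); under eq_fun do rewrite cd.
exact: (is_derive_vel HE Hd Hgp).
Qed.

Lemma vel_add_lin (c d : R -> E) l : smooth_curve c -> smooth_curve d ->
  (forall t, pr (c t) = pr (d t)) -> lin_fun V l ->
  tval (vel (fun t => vadd V (c t) (d t))) l =
  tval (vel c) l + tval (vel d) l.
Proof.
move=> Hc Hd cd [Hl fl]; apply: (vel_val HE) => //.
  exact: (smooth_vadd HR).
under eq_fun do rewrite (fl_D fl)//.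
exact: (is_deriveD (is_derive_vel HE Hc Hl) (is_derive_vel HE Hd Hl)).
Qed.

(* The sum that [choose_or] selects in [Tvb] does not depend on the two curves. *)
Lemma Tvb_add (c d : R -> E) : smooth_curve c -> smooth_curve d ->
  (forall t, pr (c t) = pr (d t)) ->
  vadd (Tvb V) (vel c) (vel d) = vel (fun t => vadd V (c t) (d t)).
Proof.
move=> Hc Hd cd; rewrite /= /choose_or; case: pselect => [ex|[]]; last first.
  by exists (vel (fun t => vadd V (c t) (d t))), c, d; rewrite !velE.
case: (cid ex) => u /= [c' [d' [Hc' Hd' cd']]]; rewrite !velE => -[[vc vd] ->].
have Hs := smooth_vadd HR Hc Hd cd; have Hs' := smooth_vadd HR Hc' Hd' cd'.
have v0 (a b : R -> E) : vel a = vel b -> a 0 = b 0.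
  by move=> /(congr1 (fun v : TS E => tpt v)); rewrite /= !tpt_vel.
apply: (vel_ext Hs' Hs).
- by rewrite (v0 _ _ vc) (v0 _ _ vd).
- move=> g Hg.
  rewrite (vel_base Hs' Hc' Hg) => [|t]; last exact: (vprojD HV).
  rewrite (vel_base Hs Hc Hg) => [|t]; last exact: (vprojD HV).
  by rewrite vc.
- move=> l Hl.
  by rewrite (vel_add_lin Hc' Hd' cd' Hl) (vel_add_lin Hc Hd cd Hl) vc vd.
Qed.

Lemma vlift_val x y f : pr x = pr y -> sfun f ->
  is_derive (0 : R) 1 (fun t => f (vadd V x (vscale V t y))) (tval (vlift V x y) f).
Proof.
by move=> xy Hf; rewrite /vlift velE; apply: (is_derive_vel HE) => //; exact: smooth_line.
Qed.

Lemma vlift_base x y g : pr x = pr y -> sfun g ->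
  tval (vlift V x y) (fun z => g (pr z)) = 0.
Proof.
move=> xy Hg; rewrite /vlift velE; apply: (vel_val HE (smooth_line xy) (vproj_smooth HV Hg)).
under eq_fun do rewrite (vprojD HV) ?(vprojZ HV)//.
exact: is_derive_cst.
Qed.

Lemma vlift_lin x y l : pr x = pr y -> sfun l -> fibrewise_linear V l ->
  tval (vlift V x y) l = l y.
Proof.
move=> xy Hl fl; rewrite /vlift velE; apply: (vel_val HE (smooth_line xy) Hl).
under eq_fun do rewrite (fl_D fl) ?(vprojZ HV)// (fl_Z _ _ fl) addrC.
exact: is_derive_affine.
Qed.

Lemma tpt_vlift x y : pr x = pr y -> tpt (vlift V x y) = x.
Proof.
by move=> xy; rewrite /vlift velE tpt_vel (vscale0 HV) (vaddx0 HV).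
Qed.

Lemma Tmap_section (s : M -> E) : section V s -> section (Tvb V) (Tmap s).
Proof.
move=> [Hs ps]; split; first exact: Tmap_smooth.
move=> v; rewrite [LHS](Tmap_comp HE HM _ Hs (vproj_smooth HV)).
exact: Tmap_id.
Qed.

Lemma line0_smooth (x : E) : smooth_curve (fun t => vscale V t x).
Proof.
apply: (smooth_vscale HR (a := id)); first exact: Cinf_id.
by move=> f Hf; exact: (sfun_cst HR).
Qed.

Lemma tpt_cross s v : section V s -> tpt (cross V s v) = vzero V (tpt v).
Proof. by move=> Hs; rewrite tpt_tadd tpt_Tmap. Qed.

Lemma tval_cross s v f : section V s -> sfun f ->
  tval (cross V s v) f = tval v (fun m => f (vzero V m)) +
    tval (vel (fun t => vscale V t (s (tpt v)))) f.
Proof.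
move=> [Hs ps] Hf; rewrite /cross velE tval_tadd// ?tval_Tmap//; first exact: (vzero_section HV).1.
by rewrite tpt_Tmap tpt_vel (vscale0 HV) ps.
Qed.

(** Differentiating t s(c(t)) at t = 0 gives the velocity of the zero section along c plus the
    vertical vector s(c(0)), and these are the two summands that define the core section. *)
Lemma cross_velocity s (c : R -> M) : section V s -> smooth_curve c ->
  cross V s (vel c) = vel (fun t => vscale V t (s (c t))).
Proof.
move=> Hs Hc; have [Hs' ps] := Hs.
have Hsc : smooth_curve (fun t => s (c t)) by move=> f Hf; exact: (Hc _ (Hs' f Hf)).
have Ht : smooth_curve (fun t => vscale V t (s (c t))).
  by apply: (smooth_vscale HR (a := id)) => //; exact: Cinf_id.
have H0 : smooth_curve (fun t => vzero V (c t)).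
  by move=> f Hf; exact: (Hc _ ((vzero_section HV).1 f Hf)).
have H1 := line0_smooth (s (c 0)).
have p0 := vproj0 HV; have pZ := vprojZ HV.
apply: tvec_eq => [|f Hf].
  by rewrite tpt_cross// !tpt_vel (vscale0 HV) ps.
rewrite tval_cross// tpt_vel.
have -> : tval (vel c) (fun m => f (vzero V m)) =
    tval (vel (fun t => vzero V (c t))) f.
  by rewrite -(Tmap_vel HM HE (vzero_section HV).1 Hc) tval_Tmap//;
    case: (vzero_section HV).
have [r [g [k [l [A [B [Hg Hl H]]]]]]] := curve_form (vzero V (c 0)) Hf.
have E1 : vscale V 0 (s (c 0)) = vzero V (c 0) by rewrite (vscale0 HV) ps.
rewrite (H _ H0 erefl) (H _ H1 E1) (H _ Ht E1).
rewrite addrACA -!big_split /=; apply: f_equal2; apply: eq_bigr => i _.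
  rewrite -mulrDr; apply: f_equal2 => //.
  have -> : tval (vel (fun t => vscale V t (s (c 0)))) (fun x => g i (pr x)) = 0.
    apply: (vel_val HE H1 (vproj_smooth HV (Hg i))).
    by under eq_fun do rewrite pZ; exact: is_derive_cst.
  rewrite addr0; apply: (vel_base H0 Ht (Hg i)) => t.
  by rewrite p0 pZ ps.
rewrite -mulrDr; apply: f_equal2 => //; have [Hli fl] := Hl i.
have -> : tval (vel (fun t => vzero V (c t))) (l i) = 0.
  apply: (vel_val HE H0 Hli).
  by under eq_fun do rewrite (fl_0 HV _ fl); exact: is_derive_cst.
rewrite add0r.
have -> : tval (vel (fun t => vscale V t (s (c 0)))) (l i) = l i (s (c 0)).
  apply: (vel_val HE H1 Hli); under eq_fun do rewrite (fl_Z _ _ fl) -[_ * _]addr0.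
  exact: is_derive_affine.
symmetry; apply: (vel_val HE Ht Hli); under eq_fun do rewrite (fl_Z _ _ fl).
have dl := curve_derivable 0 Hsc Hli.
have := is_derive_mul (is_derive_id (0 : R) 1) dl.
by rewrite mul1r mul0r addr0.
Qed.

End BundleTangent.

Section Pairing.
Variables (R : realType) (E M : smoothSpace R) (V : vb_ops E M).
Variable pair : E -> E -> R.
Hypothesis HV : is_vbundle V.
Hypothesis HP : is_fibre_pairing V pair.
Local Notation pr := (vproj V).

Lemma pairC x y : pr x = pr y -> pair x y = pair y x.
Proof. by case: HP => + _ _ _; apply. Qed.

Lemma pairDl x y z : pr x = pr y -> pr y = pr z ->
  pair (vadd V x y) z = pair x z + pair y z.
Proof. by case: HP => _ + _ _; apply. Qed.

Lemma pairZl t x y : pr x = pr y -> pair (vscale V t x) y = t * pair x y.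
Proof. by case: HP => _ _ + _; apply. Qed.

Lemma pairDr x y z : pr x = pr z -> pr y = pr z ->
  pair z (vadd V x y) = pair z x + pair z y.
Proof.
move=> xz yz; rewrite pairC ?(vprojD HV) ?xz ?yz//.
by rewrite pairDl ?xz// ![pair _ z]pairC ?xz ?yz.
Qed.

Lemma pairZr t x y : pr x = pr y -> pair y (vscale V t x) = t * pair y x.
Proof. by move=> xy; rewrite pairC ?(vprojZ HV)// pairZl// pairC. Qed.

Lemma pair_comb a b x y z : pr x = pr z -> pr y = pr z ->
  pair z (vadd V (vscale V a x) (vscale V b y)) = a * pair z x + b * pair z y.
Proof. by move=> xz yz; rewrite pairDr ?(vprojZ HV)// !pairZr. Qed.

Lemma pair0r x m : pr x = m -> pair x (vzero V m) = 0.
Proof.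
by move=> xm; rewrite -(vproj0 HV m) -(vscale0 HV) pairZr ?mul0r// (vproj0 HV).
Qed.

Lemma pair0l x m : pr x = m -> pair (vzero V m) x = 0.
Proof. by move=> xm; rewrite pairC ?pair0r// (vproj0 HV). Qed.

Lemma pairBr x y z : pr x = pr z -> pr y = pr z ->
  pair z (vsub V x y) = pair z x - pair z y.
Proof.
by move=> xz yz; rewrite pairDr ?(vprojZ HV)// pairZr// mulN1r.
Qed.

Lemma pair_sfun s1 s2 : section V s1 -> section V s2 -> sfun (spair pair s1 s2).
Proof. by case: HP => _ _ _; apply. Qed.

Definition dual_fun (e : M -> E) (x : E) : R := pair (e (pr x)) x.

Lemma dual_fun_linear e : (forall m, pr (e m) = m) ->
  fibrewise_linear V (dual_fun e).
Proof.
move=> pe; split=> [x y xy|t x]; rewrite /dual_fun.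
  by rewrite (vprojD HV)// pairDr ?pe// -xy.
by rewrite (vprojZ HV) pairZr ?pe.
Qed.

Lemma dual_fun_lin e : section V e -> lin_fun V (dual_fun e).
Proof.
move=> He; have [_ pe] := He; split; last exact: dual_fun_linear.
have HE := vb_closedE HV.
apply: (sfun_local HE) => x0.
have [k [l [s [U [[[HU Hl Hs Hx _] _] Ux]]]]] := exists_frame HV (pr x0).
apply: (smooth_at_eq HE (sopen_pull (vproj_smooth HV) HU) Ux
  (g := fun x => \sum_i l i x * spair pair e (s i) (pr x))).
  move=> x Ux'; rewrite -{1}(Hx x Ux').
  rewrite (fl_lincomb HV); [|exact: dual_fun_linear|by move=> i; case: (Hs i)].
  apply: eq_bigr => i _; rewrite mxE /dual_fun; congr (_ * pair (e _) _).
  by case: (Hs i).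
apply: (sfun_smooth_at HE); apply: (sfun_sum HE) => i; apply: (sfun_mul HE).
  by case: (Hl i).
exact: (vproj_smooth HV (pair_sfun He (Hs i))).
Qed.

Hypothesis Hnd : nondegenerate V pair.

Lemma pair_inj x y : pr x = pr y ->
  (forall z, pr z = pr x -> pair x z = pair y z) -> x = y.
Proof.
move=> xy H; have E0 : vsub V x y = vzero V (pr x).
  have pxy : pr (vsub V x y) = pr x by exact: vprojB.
  rewrite -pxy; apply: Hnd => z; rewrite pxy => zx.
  have yz : pr y = pr z by rewrite -xy.
  by rewrite pairC ?pxy// pairBr// [pair z x]pairC// [pair z y]pairC// H// subrr.
apply: (lin_sep HV) => // l [_ fl]; apply/eqP; rewrite -subr_eq0.
by rewrite -(fl_B HV fl)// E0 (fl_0 HV _ fl).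
Qed.

End Pairing.

(** * The pairing of the tangent Courant algebroid *)

Section TangentPairing.
Variables (R : realType) (E N : smoothSpace R) (V : vb_ops E N).
Variables (c : courant_ops E N) (cT : courant_ops (TS E) (TS N)).
Hypothesis HV : is_vbundle V.
Hypothesis HP : is_fibre_pairing V (cpair c).
Hypothesis HT : is_tangent_courant V c cT.
Local Notation pr := (vproj V).
Let HE := vb_closedE HV.
Let HN := vb_closedM HV.
Let HR := @vspace_closed R R.

Lemma tangent_vbundle : is_vbundle (Tvb V).
Proof. by case: HT => -[[[]]]. Qed.

Lemma tangent_pairing : is_fibre_pairing (Tvb V) (cpair cT).
Proof. by case: HT => -[[[]]]. Qed.

Let HVT := tangent_vbundle.
Let HPT := tangent_pairing.

Lemma vproj_Tvb_vel d : smooth_curve d ->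
  vproj (Tvb V) (vel d) = vel (fun t => pr (d t)).
Proof. by move=> Hd; rewrite /= (Tmap_vel HE HN (vproj_smooth HV) Hd). Qed.

Lemma vscale_Tvb_vel t d : smooth_curve d ->
  vscale (Tvb V) t (vel d) = vel (fun s => vscale V t (d s)).
Proof.
move=> Hd; rewrite /= (Tmap_vel HE HE _ Hd)//.
by apply: (smooth_vscale HV HE (a := fun=> t)) => //; exact: sfun_cst HE _.
Qed.

Lemma cross_smooth e : section V e -> smooth_map (cross V e).
Proof.
move=> He; have [He' pe] := He; have HTN := vb_closedM HVT.
apply: smooth_into_TS => [//|f Hf|f Hf].
  under eq_fun do rewrite tpt_cross//.
  exact: (sfun_tpt ((vzero_section HV).1 f Hf)).
under eq_fun do rewrite (tval_cross HV)//.
apply: (sfun_add HTN); first exact: (sfun_tval ((vzero_section HV).1 f Hf)).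
(* Only the vertical part remains. In a local form of f at the zero section it is the sum of l_i(e
   b) times the fibre derivatives of p, which is smooth in b. *)
suff H : sfun (fun b => tval (vel (fun t => vscale V t (e b))) f).
  exact: (sfun_tpt H).
apply: (sfun_local HN) => m0.
have [k [l [s [U [[[HU Hl Hs Hx _] LF] Um]]]]] := exists_frame HV m0.
have [r [g [p [Hg Hp [W [S [HW Wm HS H]]]]]]] := LF f m0 0 Hf Um.
pose z m y := row_mx (\row_j g j m) y : 'rV[R]_(r + k).
apply: (smooth_at_eq HN (sopenI HN HU HW) (conj Um Wm) (g := fun b =>
  \sum_i l i (e b) * 'D_(delta_mx 0 (rshift r i)) p (z b 0))).
  move=> b [Ub Wb]; apply: (vel_val HE) => //; first exact: line0_smooth.
  pose y t := \row_i (t * l i (e b)) : 'rV[R]_k.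
  have y0 : y 0 = 0 by apply/rowP => i; rewrite !mxE mul0r.
  pose dz (i : 'I_(r + k)) := match fintype.split i with
    | inl j => 0 | inr j => l j (e b) end.
  have Hz i : is_derive (0 : R) 1 (fun t => z b (y t) 0 i) (dz i).
    rewrite /z /dz; under eq_fun do rewrite mxE.
    case: (fintype.split i) => j; under eq_fun do rewrite mxE.
      exact: is_derive_cst.
    under eq_fun do rewrite -[_ * _]addr0; exact: is_derive_affine.
  have := is_derive_comp (c := fun t => z b (y t)) Hp Hz.
  rewrite y0 big_split_ord /= [X in X + _]big1 ?add0r; last first.
    by move=> i _; rewrite /dz (unsplitK (inl i : 'I_r + 'I_k)%type) mul0r.
  rewrite (eq_bigr (fun i => l i (e b) * 'D_(delta_mx 0 (rshift r i)) p (z b 0))); last first.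
    by move=> i _; rewrite /dz (unsplitK (inr i : 'I_r + 'I_k)%type).
  apply: near_eq_is_derive.
  have NS : \forall t \near (0 : R), S (y t).
    have : (y t) @[t --> (0 : R)] --> (0 : 'rV[R]_k).
      rewrite -y0; apply: cvg_row => i.
      have Ha : Cinf (fun t : R => t * l i (e b)).
        by apply: Cinf_mul; [exact: Cinf_id|exact: Cinf_cst].
      exact: (Cinf_cont Ha).
    exact.
  apply: filterS NS => t Sy; rewrite -H//; congr f.
  rewrite -[RHS]Hx ?(vprojZ HV) ?pe//; congr lincomb; apply/rowP => i.
  by rewrite !mxE (fl_Z _ _ (Hl i).2).
apply: (sfun_smooth_at HN); apply: (sfun_sum HN) => i; apply: (sfun_mul HN).
  by apply: He'; case: (Hl i).
pose G (j : 'I_(r + k)) : N -> R := match fintype.split j with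
  | inl j' => g j' | inr _ => fun=> 0 end.
have zG b : z b 0 = \row_j G j b.
  apply/rowP => j; rewrite [RHS]mxE /z /G mxE.
  by case: (fintype.split j) => j'; rewrite mxE.
have HG j : sfun (G j).
  rewrite /G; case: (fintype.split j) => [j'|_]; first exact: Hg.
  exact: sfun_cst HN _.
under eq_fun do rewrite zG.
exact: (@sfun_fin _ _ HN _ G _ HG (Cinf_D _ Hp)).
Qed.

Lemma vproj_cross e v : section V e -> vproj (Tvb V) (cross V e v) = v.
Proof.
move=> He; have [_ pe] := He; have p0 := vproj0 HV.
have Hp := vproj_smooth HV; apply: tvec_eq => [|f Hf].
  by rewrite [LHS]tpt_Tmap tpt_cross// p0.
rewrite [LHS](tval_Tmap HN)// (tval_cross HV)//; last exact: Hp.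
under eq_fun do rewrite p0.
rewrite [X in _ + X](_ : _ = 0) ?addr0//.
apply: (vel_val HE); [exact: line0_smooth|exact: Hp|].
by under eq_fun do rewrite (vprojZ HV); exact: is_derive_cst.
Qed.

Lemma cross_section e : section V e -> section (Tvb V) (cross V e).
Proof. by move=> He; split=> [|v]; [exact: cross_smooth|exact: vproj_cross]. Qed.

(** The source is the identity p + 0 = p of TE -> TN. If the sum is realized by curves, then p is a
    velocity; otherwise [choose_or] returns its default, the zero over the base point of p, which
    therefore equals p. *)
Lemma Tvb_zero_or_vel (p : TS E) :
  p = vzero (Tvb V) (vproj (Tvb V) p) \/
  exists2 d : R -> E, smooth_curve d & p = vel d.
Proof.
have := vaddx0 HVT (erefl (vproj (Tvb V) p)).
rewrite {1}/vadd /= /choose_or; case: pselect => [ex _|_ Ep]; last first.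
  by left; exact: esym Ep.
right; case: (cid ex) => u [d [d' [Hd _ _ [<- _] _]]].
by exists d => //; rewrite velE.
Qed.

(** The two formulas wanted for arbitrary elements, restricted to velocities. They are stable under
    sums of curves and hold for x(t) s(g(t)), hence for every curve, after expansion in a frame. *)
Definition pairs_well (g : R -> N) (d : R -> E) :=
  [/\ smooth_curve d, forall t, pr (d t) = g t & forall e, section V e ->
   cpair cT (Tmap e (vel g)) (vel d) = tval (vel d) (dual_fun V (cpair c) e) /\
   cpair cT (cross V e (vel g)) (vel d) = cpair c (e (g 0)) (d 0)].

Lemma pairs_wellD g d d' : smooth_curve g -> pairs_well g d -> pairs_well g d' ->
  pairs_well g (fun t => vadd V (d t) (d' t)).
Proof.
move=> Hg [Hd pd H] [Hd' pd' H']; have dd' t : pr (d t) = pr (d' t) by rewrite pd pd'.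
have Hs := smooth_vadd HV HR Hd Hd' dd'.
split=> //; first by move=> t; rewrite (vprojD HV) ?pd.
move=> e He; have [E1 E2] := H e He; have [E1' E2'] := H' e He.
have vg : vel g = vproj (Tvb V) (vel d).
  by rewrite vproj_Tvb_vel//; congr vel; apply/funext.
have vg' : vel g = vproj (Tvb V) (vel d').
  by rewrite vproj_Tvb_vel//; congr vel; apply/funext.
have pT w : vproj (Tvb V) (Tmap e w) = w by case: (Tmap_section HV He).
have pX w : vproj (Tvb V) (cross V e w) = w by exact: vproj_cross.
have [_ pe] := He.
rewrite -(Tvb_add HV Hd Hd' dd'); split.
  rewrite (pairDr HVT HPT) ?pT -?vg//.
  rewrite (Tvb_add HV Hd Hd' dd') (vel_add_lin HV Hd Hd' dd') ?E1 ?E1'//.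
  exact: dual_fun_lin.
rewrite (pairDr HVT HPT) ?pX -?vg// E2 E2'.
by rewrite (pairDr HV HP) ?pe ?pd ?pd'.
Qed.

Lemma pairs_well0 g : smooth_curve g -> pairs_well g (fun t => vzero V (g t)).
Proof.
move=> Hg; have [H0 p0] := vzero_section HV.
have Hd : smooth_curve (fun t => vzero V (g t)).
  by move=> f Hf; exact: (Hg _ (H0 f Hf)).
split=> // e He; have [_ pe] := He.
have -> : vel (fun t => vzero V (g t)) = vzero (Tvb V) (vel g).
  by rewrite /= (Tmap_vel HN HE H0 Hg).
rewrite !(pair0r HVT HPT); [|exact: vproj_cross|by case: (Tmap_section HV He)].
rewrite (pair0r HV HP)//; split=> //.
have [Hl fl] := dual_fun_lin HV HP He.
rewrite /= (Tmap_vel HN HE H0 Hg); symmetry; apply: (vel_val HE Hd Hl).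
by under eq_fun do rewrite (fl_0 HV _ fl); exact: is_derive_cst.
Qed.

Lemma pairs_well_scale g (x : R -> R) s : smooth_curve g -> @sfun R (vspace R) x ->
  section V s -> pairs_well g (fun t => vscale V (x t) (s (g t))).
Proof.
move=> Hg Hx Hs; have [Hs' ps] := Hs.
have Hsg : smooth_curve (fun t => s (g t)) by move=> f Hf; exact: (Hg _ (Hs' f Hf)).
have [x' Hx'] : {x' | is_derive (0 : R) 1 x x'}.
  exists (derive1 x 0); rewrite derive1E; apply: derivableP.
  exact: (@Cinf_derivable R R x 0 1 Hx).
have pZ := vprojZ HV; have p0 := vproj0 HV.
pose a t := vscale V (x 0) (s (g t)).
pose b t := vscale V x' (vscale V t (s (g t))).
have Hsc y u : @sfun R (vspace R) y -> smooth_curve u ->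
    smooth_curve (fun t => vscale V (y t) (u t)).
  by move=> Hy Hu; exact: (smooth_vscale HV HR).
have Hid : @sfun R (vspace R) id by exact: Cinf_id.
have Hcst (k : R) : @sfun R (vspace R) (fun=> k) by exact: Cinf_cst.
have Ht := Hsc _ _ Hid Hsg; have Hd := Hsc _ _ Hx Hsg.
have Ha : smooth_curve a := Hsc _ _ (Hcst _) Hsg.
have Hb : smooth_curve b := Hsc _ _ (Hcst _) Ht.
have ab t : pr (a t) = pr (b t) by rewrite !pZ.
have Hab := smooth_vadd HV HR Ha Hb ab.
have dl l : lin_fun V l -> is_derive (0 : R) 1 (fun t => x t * l (s (g t)))
    (x' * l (s (g 0)) + x 0 * tval (vel (fun t => s (g t))) l).
  by move=> [Hl _]; exact: (is_derive_mul Hx' (is_derive_vel HE Hsg Hl)).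
(* The product rule, with the terms x(0) Ts and x'(0) s^times at the velocity of g. On Ts and
   s^times the pairing of TE is prescribed. *)
have Evel : vel (fun t => vscale V (x t) (s (g t))) =
    vadd (Tvb V) (vscale (Tvb V) (x 0) (Tmap s (vel g)))
      (vscale (Tvb V) x' (cross V s (vel g))).
  rewrite (Tmap_vel HN HE Hs' Hg) (cross_velocity HV Hs Hg).
  rewrite (vscale_Tvb_vel _ Hsg) (vscale_Tvb_vel _ Ht) (Tvb_add HV Ha Hb ab).
  apply: (vel_ext HV Hd Hab).
  - by rewrite /a /b (vscale0 HV) (vscale_zero HV) (vaddx0 HV)// !pZ.
  - move=> f Hf; apply: (vel_base HV Hd Hab Hf) => t.
    by rewrite (vprojD HV) ?pZ.
  - move=> l Hl; have [Hl' fl] := Hl.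
    rewrite (vel_add_lin HV Ha Hb ab Hl).
    have -> : tval (vel a) l = x 0 * tval (vel (fun t => s (g t))) l.
      apply: (vel_val HE Ha Hl'); under eq_fun do rewrite (fl_Z _ _ fl).
      exact: (is_deriveZ (x 0) (is_derive_vel HE Hsg Hl')).
    have -> : tval (vel b) l = x' * l (s (g 0)).
      apply: (vel_val HE Hb Hl'); under eq_fun do rewrite !(fl_Z _ _ fl).
      have H := is_derive_mul (is_derive_id (0 : R) 1) (is_derive_vel HE Hsg Hl').
      by rewrite mul1r mul0r addr0 in H; exact: (is_deriveZ x' H).
    apply: (vel_val HE Hd Hl'); under eq_fun do rewrite (fl_Z _ _ fl).
    by rewrite addrC; exact: dl.
split=> // [t|e He]; first by rewrite pZ.
have [He' pe] := He.
have pT s' w : section V s' -> vproj (Tvb V) (Tmap s' w) = w.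
  by move=> Hs1; case: (Tmap_section HV Hs1).
have pX s' w : section V s' -> vproj (Tvb V) (cross V s' w) = w by exact: vproj_cross.
have pZT := vprojZ HVT.
have [_ H] := HT.
have [[TT TX XX] _] := H e s He Hs; have [[_ TX' _] _] := H s e Hs He.
have tg : tpt (vel g) = g 0 by rewrite tpt_vel.
have qT : vproj (Tvb V) (Tmap s (vel g)) = vel g by exact: pT.
have qX : vproj (Tvb V) (cross V s (vel g)) = vel g by exact: pX.
have qTe : vproj (Tvb V) (Tmap e (vel g)) = vel g by exact: pT.
have qXe : vproj (Tvb V) (cross V e (vel g)) = vel g by exact: pX.
have {}TT := TT (vel g); have {}TX := TX (vel g); have {}XX := XX (vel g).
have {TX'}XT : cpair cT (cross V e (vel g)) (Tmap s (vel g)) =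
    spair (cpair c) s e (tpt (vel g)).
  exact: etrans (pairC HPT (etrans qXe (esym qT))) (TX' (vel g)).
have spE (s1 s2 : N -> E) : spair (cpair c) s1 s2 (tpt (vel g)) =
    cpair c (s1 (g 0)) (s2 (g 0)) by rewrite /spair tg.
split.
  have E1 := pair_comb HVT HPT (x 0) x' (etrans qT (esym qTe)) (etrans qX (esym qTe)).
  rewrite -Evel in E1; rewrite {}E1 {}TT {}TX.
  have Hdf := dual_fun_lin HV HP He; have [Hdf' fl] := Hdf.
  symmetry; apply: (vel_val HE Hd Hdf'); under eq_fun do rewrite (fl_Z _ _ fl).
  have -> : tval (vel g) (spair (cpair c) e s) =
      tval (vel (fun t => s (g t))) (dual_fun V (cpair c) e).
    symmetry; apply: (vel_val HE Hsg Hdf').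
    have := is_derive_vel HN Hg (pair_sfun HP He Hs).
    rewrite /dual_fun /spair; congr (is_derive _ _ _ _).
    by apply/funext => t; rewrite ps.
  have -> : spair (cpair c) e s (tpt (vel g)) = dual_fun V (cpair c) e (s (g 0)).
    by rewrite spE /dual_fun ps.
  by rewrite addrC; exact: dl.
have E1 := pair_comb HVT HPT (x 0) x' (etrans qT (esym qXe)) (etrans qX (esym qXe)).
rewrite -Evel in E1; rewrite {}E1 {}XT {}XX mulr0 addr0 spE.
by rewrite (pairZr HV HP) ?pe ?ps// (pairC HP)// pe ps.
Qed.

Lemma pairs_well_all d : smooth_curve d -> pairs_well (fun t => pr (d t)) d.
Proof.
move=> Hd; set g := fun t => pr (d t).
have Hg : smooth_curve g by move=> f Hf; exact: (Hd _ (vproj_smooth HV Hf)).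
have [k [l [s [U [[[HU Hl Hs Hx _] _] Um]]]]] := exists_frame HV (g 0).
pose d' t := lincomb V (g t) (\row_i l i (d t)) s.
have key n (x : 'I_n -> R -> R) (w : 'I_n -> N -> E) :
    (forall i, @sfun R (vspace R) (x i)) -> (forall i, section V (w i)) ->
    pairs_well g (fun t => lincomb V (g t) (\row_i x i t) w).
  elim: n x w => [|n IH] x w Hxi Hw.
    rewrite (_ : (fun t => _) = fun t => vzero V (g t)); first exact: pairs_well0.
    by apply/funext => t; rewrite /lincomb big_ord0.
  rewrite (_ : (fun t => _) = fun t => vadd V (vscale V (x ord0 t) (w ord0 (g t)))
    (lincomb V (g t) (\row_i x (lift ord0 i) t) (fun i => w (lift ord0 i)))).
    by apply: pairs_wellD => //; [exact: pairs_well_scale|exact: IH].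
  apply/funext => t; rewrite lincombS mxE; congr (vadd V _ (lincomb V _ _ _)).
  by apply/rowP => i; rewrite !mxE.
have Hxl i : @sfun R (vspace R) (fun t => l i (d t)) by apply: Hd; case: (Hl i).
have [Hd' pd' H'] := key k (fun i t => l i (d t)) s Hxl Hs.
have Nd : \forall t \near (0 : R), d' t = d t.
  by have := curve_near Hg HU Um; apply: filterS => t /Hx.
have dd : vel d = vel d'.
  by symmetry; exact: (vel_near HE Hd' Hd Nd).
split=> // e He; have [E1 E2] := H' e He.
by rewrite dd E1 E2 -/(d' 0) (nbhs_singleton Nd).
Qed.

(** The tangent Courant algebroid prescribes the pairing of Te with Ts and s^times only. Here the
    second argument is arbitrary, as the elements of Pi_E require. *)
Lemma pair_Tmap e p : section V e ->
  cpair cT (Tmap e (vproj (Tvb V) p)) p = tval p (dual_fun V (cpair c) e).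
Proof.
move=> He; have [Ep|[d Hd ->]] := Tvb_zero_or_vel p; last first.
  have [_ _ H] := pairs_well_all Hd; rewrite vproj_Tvb_vel//.
  by have [] := H e He.
set v := vproj _ p in Ep *; rewrite Ep (pair0r HVT HPT); last first.
  by case: (Tmap_section HV He).
have [H0 p0] := vzero_section HV; have [Hl fl] := dual_fun_lin HV HP He.
rewrite /= (tval_Tmap HE)//; under eq_fun do rewrite (fl_0 HV _ fl).
by rewrite (tval_cst HN).
Qed.

Lemma pair_cross e p : section V e ->
  cpair cT (cross V e (vproj (Tvb V) p)) p = cpair c (e (pr (tpt p))) (tpt p).
Proof.
move=> He; have [Ep|[d Hd ->]] := Tvb_zero_or_vel p; last first.
  have [_ _ H] := pairs_well_all Hd; rewrite vproj_Tvb_vel// tpt_vel.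
  by have [] := H e He.
set v := vproj _ p in Ep *; rewrite Ep (pair0r HVT HPT); last exact: vproj_cross.
have [_ pe] := He.
by rewrite tpt_Tmap (vproj0 HV) (pair0r HV HP).
Qed.

End TangentPairing.

(** * Double vector bundles *)

Section DoubleVectorBundles.
Variables (R : realType) (E Q B C M : smoothSpace R) (D : dvb_ops E Q B C M).
Hypothesis HD : is_dvb D.
Local Notation EQ := (dEQ D).
Local Notation EB := (dEB D).
Local Notation QM := (dQM D).
Local Notation BM := (dBM D).
Local Notation CM := (dCM D).

Lemma dvb_EQ : is_vbundle EQ. Proof. by case: HD => -[]. Qed.
Lemma dvb_EB : is_vbundle EB. Proof. by case: HD => -[]. Qed.
Lemma dvb_QM : is_vbundle QM. Proof. by case: HD => -[]. Qed.
Lemma dvb_BM : is_vbundle BM. Proof. by case: HD => -[]. Qed.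
Lemma dvb_CM : is_vbundle CM. Proof. by case: HD => -[]. Qed.
Let HEQ := dvb_EQ.
Let HEB := dvb_EB.
Let HQM := dvb_QM.
Let HBM := dvb_BM.

Lemma projEB_morph : vb_morphism EQ BM (vproj EB) (vproj QM).
Proof. by case: HD => _ [[]]. Qed.

Lemma zeroEB_morph : vb_morphism BM EQ (vzero EB) (vzero QM).
Proof. by case: HD => _ [[]]. Qed.

Lemma scaleEB_morph t : vb_morphism EQ EQ (vscale EB t) (vscale QM t).
Proof. by case: HD => _ [[]]. Qed.

Lemma coreB_morph : vb_morphism CM EB (dcore D) (vzero BM).
Proof. by case: HD => _ [_ []]. Qed.

Lemma coreQ_morph : vb_morphism CM EQ (dcore D) (vzero QM).
Proof. by case: HD => _ [_ []]. Qed.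

Lemma core_inj : injective (dcore D).
Proof. by case: HD => _ [_ []]. Qed.

Lemma core_ex x m : vproj EQ x = vzero QM m -> vproj EB x = vzero BM m ->
  exists c, x = dcore D c.
Proof. by case: HD => _ [_ [_ _ _]]; apply. Qed.

Lemma projEQ_D x y : vproj EB x = vproj EB y ->
  vproj EQ (vadd EB x y) = vadd QM (vproj EQ x) (vproj EQ y).
Proof. by case: HD => _ [[_ _ _ [+ _] _] _]; apply. Qed.

Lemma scaleEQ_D t x y : vproj EB x = vproj EB y ->
  vscale EQ t (vadd EB x y) = vadd EB (vscale EQ t x) (vscale EQ t y).
Proof. by case: HD => _ [[_ _ _ [_ +] _] _]; apply. Qed.

Lemma interchange x1 x2 y1 y2 :
  vproj EB x1 = vproj EB x2 -> vproj EB y1 = vproj EB y2 ->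
  vproj EQ x1 = vproj EQ y1 -> vproj EQ x2 = vproj EQ y2 ->
  vadd EQ (vadd EB x1 x2) (vadd EB y1 y2) = vadd EB (vadd EQ x1 y1) (vadd EQ x2 y2).
Proof. by case: HD => _ [[_ _ _ _ +] _]; apply. Qed.

Lemma proj_proj x : vproj BM (vproj EB x) = vproj QM (vproj EQ x).
Proof. by case: projEB_morph. Qed.

Lemma projEB_D x y : vproj EQ x = vproj EQ y ->
  vproj EB (vadd EQ x y) = vadd BM (vproj EB x) (vproj EB y).
Proof. by case: projEB_morph => _ _ _ + _; apply. Qed.

Lemma projEB_Z t x : vproj EB (vscale EQ t x) = vscale BM t (vproj EB x).
Proof. by case: projEB_morph => _ _ _ _; apply. Qed.

Lemma projEQ_Z t x : vproj EQ (vscale EB t x) = vscale QM t (vproj EQ x).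
Proof. by case: (scaleEB_morph t). Qed.

Lemma projEQ_zero b : vproj EQ (vzero EB b) = vzero QM (vproj BM b).
Proof. by case: zeroEB_morph. Qed.

Lemma projEB_core c : vproj EB (dcore D c) = vzero BM (vproj CM c).
Proof. by case: coreB_morph. Qed.

Lemma projEQ_core c : vproj EQ (dcore D c) = vzero QM (vproj CM c).
Proof. by case: coreQ_morph. Qed.

Lemma scale_scale_zero t x : vscale EQ 0 (vscale EB t x) = vscale EB t (vscale EQ 0 x).
Proof. by case: (scaleEB_morph t) => _ _ _ _ ->. Qed.

Lemma projEB_zeroQ q : vproj EB (vzero EQ q) = vzero BM (vproj QM q).
Proof.
rewrite -{1}(vproj0 HEQ q) -(vscale0 HEQ) projEB_Z (vscale0 HBM) proj_proj.
by rewrite (vproj0 HEQ).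
Qed.

Lemma zero_zero m : vzero EB (vzero BM m) = vzero EQ (vzero QM m).
Proof.
rewrite -{1}(vproj0 HBM m) -(vscale0 HBM).
have [_ _ _ _ ->] := zeroEB_morph.
by rewrite (vscale0 HEQ) projEQ_zero (vproj0 HBM).
Qed.

Lemma zeroQ_D q q' : vproj QM q = vproj QM q' ->
  vzero EQ (vadd QM q q') = vadd EB (vzero EQ q) (vzero EQ q').
Proof.
move=> qq'; have p : vproj EB (vzero EQ q) = vproj EB (vzero EQ q').
  by rewrite !projEB_zeroQ qq'.
have := scaleEQ_D 0 p; rewrite !(vscale0 HEQ) projEQ_D// !(vproj0 HEQ) => ->.
by [].
Qed.

Lemma zeroQ_Z t q : vzero EQ (vscale QM t q) = vscale EB t (vzero EQ q).
Proof.
have := scale_scale_zero t (vzero EQ q).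
by rewrite !(vscale0 HEQ) projEQ_Z !(vproj0 HEQ).
Qed.

Lemma coreB_D c c' : vproj CM c = vproj CM c' ->
  dcore D (vadd CM c c') = vadd EB (dcore D c) (dcore D c').
Proof. by case: coreB_morph => _ _ _ + _; apply. Qed.

Lemma coreB_Z t c : dcore D (vscale CM t c) = vscale EB t (dcore D c).
Proof. by case: coreB_morph => _ _ _ _; apply. Qed.

Lemma coreQ_D c c' : vproj CM c = vproj CM c' ->
  dcore D (vadd CM c c') = vadd EQ (dcore D c) (dcore D c').
Proof. by case: coreQ_morph => _ _ _ + _; apply. Qed.

Lemma coreQ_Z t c : dcore D (vscale CM t c) = vscale EQ t (dcore D c).
Proof. by case: coreQ_morph => _ _ _ _; apply. Qed.

Definition core_at (b : B) (c : C) : E := vadd EQ (vzero EB b) (dcore D c).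

Lemma projEQ_core_at b c : vproj BM b = vproj CM c ->
  vproj EQ (core_at b c) = vzero QM (vproj BM b).
Proof. by move=> bc; rewrite (vprojD HEQ) projEQ_zero// projEQ_core bc. Qed.

Lemma projEB_core_at b c : vproj BM b = vproj CM c -> vproj EB (core_at b c) = b.
Proof.
move=> bc; rewrite projEB_D ?projEQ_zero ?projEQ_core ?bc//.
by rewrite projEB_core (vproj0 HEB) (vaddx0 HBM).
Qed.

Lemma core_at0 c : core_at (vzero BM (vproj CM c)) c = dcore D c.
Proof. by rewrite /core_at zero_zero (vadd0x HEQ)// projEQ_core. Qed.

Lemma core_atD b c c' : vproj BM b = vproj CM c -> vproj BM b = vproj CM c' ->
  core_at b (vadd CM c c') = vadd EB (core_at b c) (core_at b c').
Proof.
move=> bc bc'; have cc' : vproj CM c = vproj CM c' by rewrite -bc.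
rewrite /core_at coreB_D// -interchange ?projEB_core ?projEQ_core ?projEQ_zero ?bc ?cc'//.
by rewrite (vaddx0 HEB)// (vproj0 HEB).
Qed.

Lemma core_atZ t b c : vproj BM b = vproj CM c ->
  core_at b (vscale CM t c) = vscale EB t (core_at b c).
Proof.
move=> bc; rewrite /core_at coreB_Z.
have [_ _ _ Hadd _] := scaleEB_morph t.
rewrite Hadd; last by rewrite projEQ_zero projEQ_core bc.
by rewrite (vscale_zero HEB).
Qed.

Lemma core_at_inj b c c' : vproj BM b = vproj CM c -> vproj BM b = vproj CM c' ->
  core_at b c = core_at b c' -> c = c'.
Proof.
move=> bc bc' /(congr1 (fun x => vadd EQ (vscale EQ (-1) (vzero EB b)) x)) H.
apply: core_inj.
have pz : vproj EQ (vzero EB b) = vzero QM (vproj BM b) by exact: projEQ_zero.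
have E1 x : vproj EQ x = vzero QM (vproj BM b) ->
    vadd EQ (vscale EQ (-1) (vzero EB b)) (vadd EQ (vzero EB b) x) = x.
  move=> px; rewrite (vaddA HEQ) ?(vprojZ HEQ) ?pz ?px//.
  rewrite [X in vadd _ X _](vaddC HEQ) ?(vprojZ HEQ)//.
  have [_ _ _ [_ [[_ _ _ asub] _]] _] := HEQ.
  by have := asub (vzero EB b); rewrite /vsub => ->; rewrite pz (vadd0x HEQ).
have q1 : vproj EQ (dcore D c) = vzero QM (vproj BM b) by rewrite projEQ_core bc.
have q2 : vproj EQ (dcore D c') = vzero QM (vproj BM b) by rewrite projEQ_core bc'.
by move: H; rewrite /core_at (E1 _ q1) (E1 _ q2).
Qed.

Lemma core_sectionE c b : core_section D c b = core_at b (c (vproj BM b)).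
Proof. by []. Qed.

Lemma core_section_section c : section CM c -> section EB (core_section D c).
Proof.
move=> [Hc pc]; split=> [|b]; last by rewrite projEB_core_at// pc.
have HB := vb_closedM HEB.
apply: (smooth_vadd HEQ HB).
- exact: (vzero_section HEB).1.
- move=> f Hf; have [H _ _ _ _] := coreB_morph.
  exact: (vproj_smooth HBM (Hc _ (H f Hf))).
- by move=> b; rewrite projEQ_zero projEQ_core pc.
Qed.

Definition core_atQ (q : Q) (c : C) : E := vadd EB (vzero EQ q) (dcore D c).

Lemma core_sectionQE c q :
  core_section (flip D) c q = core_atQ q (c (vproj QM q)).
Proof. by []. Qed.

Lemma projEQ_core_atQ q c : vproj QM q = vproj CM c -> vproj EQ (core_atQ q c) = q.
Proof.
move=> qc; rewrite projEQ_D ?projEB_zeroQ ?projEB_core ?qc//.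
by rewrite projEQ_core (vproj0 HEQ) (vaddx0 HQM).
Qed.

Lemma projEB_core_atQ q c : vproj QM q = vproj CM c ->
  vproj EB (core_atQ q c) = vzero BM (vproj QM q).
Proof. by move=> qc; rewrite (vprojD HEB) projEB_zeroQ// projEB_core qc. Qed.

Lemma core_atQ0 c : core_atQ (vzero QM (vproj CM c)) c = dcore D c.
Proof. by rewrite /core_atQ -zero_zero (vadd0x HEB)// projEB_core. Qed.

Lemma core_sectionQ_section c : section CM c -> section EQ (core_section (flip D) c).
Proof.
move=> [Hc pc]; split=> [|q]; last by rewrite projEQ_core_atQ// pc.
have HQ := vb_closedM HEQ.
apply: (smooth_vadd HEB HQ).
- exact: (vzero_section HEQ).1.
- move=> f Hf; have [H _ _ _ _] := coreB_morph.
  exact: (vproj_smooth HQM (Hc _ (H f Hf))).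
- by move=> q; rewrite projEB_zeroQ projEB_core pc.
Qed.

(** The interchange law, applied to x written as its sum over Q with a zero, moves a core element
    from one addition to the other. *)
Lemma add_core_at x c : vproj QM (vproj EQ x) = vproj CM c ->
  vadd EB x (core_at (vproj EB x) c) = vadd EQ x (core_atQ (vproj EQ x) c).
Proof.
move=> xc; have bc : vproj BM (vproj EB x) = vproj CM c by rewrite proj_proj.
have -> : vadd EB x (core_at (vproj EB x) c) =
    vadd EB (vadd EQ x (vzero EQ (vproj EQ x)))
      (vadd EQ (vzero EB (vproj EB x)) (dcore D c)) by rewrite (vaddx0 HEQ).
rewrite -interchange; first by rewrite (vaddx0 HEB).
- by rewrite (vproj0 HEB).
- by rewrite projEB_zeroQ projEB_core xc.
- by rewrite (vproj0 HEQ).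
- by rewrite projEQ_zero projEQ_core bc.
Qed.

Section Splitting.
Variable Sg : Q -> B -> E.
Hypothesis HS : is_splitting D Sg.

Lemma split_proj q b : vproj QM q = vproj BM b ->
  vproj EQ (Sg q b) = q /\ vproj EB (Sg q b) = b.
Proof. by case: HS => _ + _ _ _; apply. Qed.

Lemma split_DB q q' b : vproj QM q = vproj BM b -> vproj QM q' = vproj BM b ->
  Sg (vadd QM q q') b = vadd EB (Sg q b) (Sg q' b).
Proof. by case: HS => _ _ + _ _; apply. Qed.

Lemma split_DQ q b b' : vproj QM q = vproj BM b -> vproj QM q = vproj BM b' ->
  Sg q (vadd BM b b') = vadd EQ (Sg q b) (Sg q b').
Proof. by case: HS => _ _ _ + _; apply. Qed.

Lemma split_ZB t q b : vproj QM q = vproj BM b ->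
  Sg (vscale QM t q) b = vscale EB t (Sg q b).
Proof. by case: HS => _ _ _ _ H qb; case: (H t q b qb). Qed.

Lemma split_ZQ t q b : vproj QM q = vproj BM b ->
  Sg q (vscale BM t b) = vscale EQ t (Sg q b).
Proof. by case: HS => _ _ _ _ H qb; case: (H t q b qb). Qed.

Lemma split_0B b : Sg (vzero QM (vproj BM b)) b = vzero EB b.
Proof.
have pz : vproj QM (vzero QM (vproj BM b)) = vproj BM b by rewrite (vproj0 HQM).
rewrite -{1}(vscale_zero HQM 0) split_ZB// (vscale0 HEB).
by have [_ ->] := split_proj pz.
Qed.

Lemma split_smooth (X : smoothSpace R) (HX : smooth_closed X) (q : X -> Q) (b : X -> B) :
  smooth_map q -> smooth_map b -> (forall x, vproj QM (q x) = vproj BM (b x)) ->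
  smooth_map (fun x => Sg (q x) (b x)).
Proof.
move=> Hq Hb qb f Hf; have [Hsm _ _ _ _] := HS.
pose s x : subS (fun p : prodS Q B => vproj QM p.1 = vproj BM p.2) :=
  exist _ (q x, b x) (qb x).
have Hs : smooth_map s.
  move=> h Hh; apply: (HX); apply: gen_pull Hh => g [g' Hg' ->]; apply: (HX).
  by apply: gen_pull Hg' => g2 [[g3 Hg3 ->]|[g3 Hg3 ->]]; [exact: Hq|exact: Hb].
exact: (Hs _ (Hsm f Hf)).
Qed.

Lemma sigmaQ_section q : section QM q -> section EB (sigmaQ D Sg q).
Proof.
move=> [Hq pq]; split=> [|b]; last first.
  by case: (@split_proj (q (vproj BM b)) b _) => //; rewrite pq.
apply: (split_smooth (vb_closedM HEB)) => //.
by move=> f Hf; exact: (vproj_smooth HBM (Hq f Hf)).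
Qed.

Lemma sigmaB_section b : section BM b -> section EQ (sigmaB D Sg b).
Proof.
move=> [Hb pb]; split=> [|q]; last first.
  by case: (@split_proj q (b (vproj QM q)) _) => //; rewrite pb.
apply: (split_smooth (vb_closedM HEQ)) => //.
by move=> f Hf; exact: (vproj_smooth HQM (Hb f Hf)).
Qed.

(** The difference over B of x and Sg(q, b) projects to zero in Q. Subtracting 0_b from it over Q
    also makes the projection to B zero, which leaves a core element. *)
Lemma split_decomp x : exists2 c, vproj CM c = vproj BM (vproj EB x) &
  x = vadd EB (Sg (vproj EQ x) (vproj EB x)) (core_at (vproj EB x) c).
Proof.
set q := vproj EQ x; set b := vproj EB x.
have qb : vproj QM q = vproj BM b by rewrite /q /b proj_proj.
have [p1 p2] := split_proj qb.
pose y := vsub EB x (Sg q b).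
have yB : vproj EB y = b by rewrite (vprojB HEB)// p2.
have subx (V : vb_ops Q M) (HV : is_vbundle V) z : vsub V z z = vzero V (vproj V z).
  by case: HV => _ _ _ [_ [[]]].
have subB z : vsub BM z z = vzero BM (vproj BM z) by case: HBM => _ _ _ [_ [[]]].
have yQ : vproj EQ y = vzero QM (vproj QM q).
  rewrite projEQ_D ?(vprojZ HEB) ?p2// projEQ_Z p1.
  exact: (subx _ HQM).
have zQ : vproj EQ (vzero EB b) = vproj EQ y by rewrite yQ projEQ_zero qb.
have [c Ec] : exists c, vsub EQ y (vzero EB b) = dcore D c.
  apply: (@core_ex _ (vproj BM b)).
    by rewrite (vprojB HEQ)// yQ qb.
  rewrite projEB_D ?(vprojZ HEQ)// projEB_Z (vproj0 HEB) yB.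
  exact: subB.
have pc : vproj CM c = vproj BM b.
  have := congr1 (vproj EQ) Ec; rewrite projEQ_core (vprojB HEQ)// yQ qb.
  by move/(congr1 (vproj QM)); rewrite !(vproj0 HQM).
exists c => //.
have -> : core_at b c = y.
  rewrite /core_at -Ec; apply: (lin_sep HEQ) => [|l [_ fl]].
    by rewrite (vprojD HEQ) ?zQ// (vprojB HEQ).
  by rewrite (fl_D fl) ?(vprojB HEQ)// (fl_B HEQ fl)// addrC subrK.
apply: (lin_sep HEB) => [|l [_ fl]]; first by rewrite (vprojD HEB) ?p2 ?yB.
by rewrite (fl_D fl) ?p2 ?yB// (fl_B HEB fl) ?p2// addrC subrK.
Qed.

End Splitting.

End DoubleVectorBundles.

(** * Metrics and the Lie algebroid of a VB-algebroid *)

Section Metric.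
Variables (R : realType) (E Q B C M : smoothSpace R) (D : dvb_ops E Q B C M).
Variables (pair : E -> E -> R) (ev : Q -> C -> R).
Hypothesis HD : is_dvb D.
Hypothesis Hmet : is_metric D pair ev.
Local Notation EQ := (dEQ D).
Local Notation EB := (dEB D).
Local Notation QM := (dQM D).
Local Notation BM := (dBM D).
Local Notation CM := (dCM D).
Let HEQ := dvb_EQ HD.
Let HEB := dvb_EB HD.
Let HQM := dvb_QM HD.
Let HBM := dvb_BM HD.
Let HCM := dvb_CM HD.

Lemma metric_pairing : is_fibre_pairing EB pair. Proof. by case: Hmet. Qed.
Lemma metric_nondegenerate : nondegenerate EB pair. Proof. by case: Hmet. Qed.
Let HP := metric_pairing.

Lemma pair_core x b c : vproj EB x = b -> vproj BM b = vproj CM c ->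
  pair x (core_at D b c) = ev (vproj EQ x) c.
Proof. by move=> <- bc; case: Hmet => _ _ H _ _; exact: H. Qed.

Lemma pair_core0 q c : vproj QM q = vproj CM c ->
  pair (vzero EQ q) (dcore D c) = ev q c.
Proof.
move=> qc; rewrite -(core_at0 HD) pair_core ?(vproj0 HEQ) ?(vproj0 HBM)//.
by rewrite (projEB_zeroQ HD) qc.
Qed.

Lemma ev_Dc q c c' : vproj QM q = vproj CM c -> vproj QM q = vproj CM c' ->
  ev q (vadd CM c c') = ev q c + ev q c'.
Proof.
move=> qc qc'; have cc' : vproj CM c = vproj CM c' by rewrite -qc.
rewrite -!pair_core0 ?(vprojD HCM)// (coreB_D HD)//.
by apply: (pairDr HEB HP); rewrite (projEB_core HD) (projEB_zeroQ HD) -?qc -?qc'.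
Qed.

Lemma ev_Zc t q c : vproj QM q = vproj CM c -> ev q (vscale CM t c) = t * ev q c.
Proof.
move=> qc; rewrite -!pair_core0 ?(vprojZ HCM)// (coreB_Z HD).
by apply: (pairZr HEB HP); rewrite (projEB_core HD) (projEB_zeroQ HD) qc.
Qed.

Lemma ev_Dq q q' c : vproj QM q = vproj CM c -> vproj QM q' = vproj CM c ->
  ev (vadd QM q q') c = ev q c + ev q' c.
Proof.
move=> qc qc'; have qq' : vproj QM q = vproj QM q' by rewrite qc qc'.
rewrite -!pair_core0 ?(vprojD HQM)// (zeroQ_D HD)//.
by apply: (pairDl HP); rewrite ?(projEB_core HD) !(projEB_zeroQ HD) ?qc ?qc'.
Qed.

Lemma ev_Zq t q c : vproj QM q = vproj CM c -> ev (vscale QM t q) c = t * ev q c.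
Proof.
move=> qc; rewrite -!pair_core0 ?(vprojZ HQM)// (zeroQ_Z HD).
by apply: (pairZl HP); rewrite (projEB_core HD) (projEB_zeroQ HD) qc.
Qed.

Lemma ev_0q m c : vproj CM c = m -> ev (vzero QM m) c = 0.
Proof.
by move=> cm; rewrite -(vproj0 HQM m) -(vscale0 HQM) ev_Zq ?mul0r// (vproj0 HQM).
Qed.

Lemma ev_0c q m : vproj QM q = m -> ev q (vzero CM m) = 0.
Proof.
by move=> cm; rewrite -(vproj0 HCM m) -(vscale0 HCM) ev_Zc ?mul0r// (vproj0 HCM).
Qed.

Lemma pair_core_core b c c' : vproj BM b = vproj CM c -> vproj BM b = vproj CM c' ->
  pair (core_at D b c) (core_at D b c') = 0.
Proof.
move=> bc bc'; rewrite pair_core ?(projEB_core_at HD)//.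
by rewrite (projEQ_core_at HD)// ev_0q.
Qed.

(** Nondegeneracy of the metric over the zero of B, where a core element pairs with z through ev and
    the projection of z to Q. *)
Lemma ev_injC c c' : vproj CM c = vproj CM c' ->
  (forall q, vproj QM q = vproj CM c -> ev q c = ev q c') -> c = c'.
Proof.
move=> cc' H; apply: (core_inj HD).
apply: (pair_inj HEB HP metric_nondegenerate) => [|z].
  by rewrite !(projEB_core HD) cc'.
rewrite (projEB_core HD) => zc.
have pz : vproj QM (vproj EQ z) = vproj CM c.
  by rewrite -(proj_proj HD) zc (vproj0 HBM).
rewrite (pairC HP) ?(projEB_core HD)// [RHS](pairC HP) ?(projEB_core HD) -?cc'//.
rewrite -(core_at0 HD) -(core_at0 HD) !pair_core -?cc' ?(vproj0 HBM)//.
exact: H.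
Qed.

Definition ell (tau : M -> C) (q : Q) : R := ev q (tau (vproj QM q)).

Lemma dual_core tau x : section CM tau ->
  dual_fun EB pair (core_section D tau) x = ell tau (vproj EQ x).
Proof.
move=> [_ pt]; rewrite /dual_fun core_sectionE (pairC HP) ?(projEB_core_at HD) ?pt//.
by rewrite pair_core ?pt// (proj_proj HD).
Qed.

Lemma ell_lin tau : section CM tau -> lin_fun QM (ell tau).
Proof.
move=> Ht; have [_ pt] := Ht; split; last first.
  split=> [q q' qq'|t q]; rewrite /ell.
    by rewrite (vprojD HQM)// ev_Dq ?pt// -qq'.
  by rewrite (vprojZ HQM) ev_Zq ?pt.
have [Hd _] := dual_fun_lin HEB HP (core_section_section HD Ht).
have := (vzero_section HEQ).1 _ Hd.
congr (sfun _); apply/funext => q.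
by rewrite dual_core// (vproj0 HEQ).
Qed.

Lemma ev_sfun q tau : section QM q -> section CM tau -> sfun (fun m => ev (q m) (tau m)).
Proof.
move=> [Hq pq] Ht; have [Hl _] := ell_lin Ht.
have := Hq _ Hl; congr (sfun _); apply/funext => m.
by rewrite /ell pq.
Qed.

Variable Sg : Q -> B -> E.
Hypothesis HSg : is_lagrangian_splitting D pair Sg.
Let HS : is_splitting D Sg := HSg.1.

Lemma lagrangian q q' b : vproj QM q = vproj BM b -> vproj QM q' = vproj BM b ->
  pair (Sg q b) (Sg q' b) = 0.
Proof.
move=> qb qb'; have [_ /(_ b) [[_ _ _ _ H] _]] := HSg.
by apply: H; [exists q|exists q'].
Qed.

(** Over the zero b of B, Sg(q, b) pairs to zero with the isotropic image of Sg and through ev with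
    the core. By [split_decomp] these span the fibre, so nondegeneracy of the metric decides. *)
Lemma ev_injQ q q' : vproj QM q = vproj QM q' ->
  (forall c, vproj CM c = vproj QM q -> ev q c = ev q' c) -> q = q'.
Proof.
move=> qq' H; pose b := vzero BM (vproj QM q).
have pb : vproj BM b = vproj QM q by rewrite (vproj0 HBM).
have [p1 p2] := split_proj HS (esym pb).
have pb' : vproj QM q' = vproj BM b by rewrite pb.
have [p1' p2'] := split_proj HS pb'.
suff E1 : Sg q b = Sg q' b by rewrite -p1 E1.
apply: (pair_inj HEB HP metric_nondegenerate) => [|z]; first by rewrite p2 p2'.
rewrite p2 => zb; have [c pc ->] := split_decomp HD HS z.
have zq : vproj QM (vproj EQ z) = vproj BM b by rewrite -(proj_proj HD) zb.
have [r1 r2] := split_proj HS zq.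
rewrite zb; have bc : vproj BM b = vproj CM c by rewrite pc zb.
rewrite !(pairDr HEB HP) ?p2 ?p2' ?r2 ?(projEB_core_at HD)//.
rewrite !lagrangian// !add0r !pair_core// p1 p1'.
by apply: H; rewrite -bc pb.
Qed.

End Metric.

(** * The generating pairs of Pi for a Lie algebroid *)

Section Anchor.
Variables (R : realType) (A N : smoothSpace R) (V : vb_ops A N) (l : lie_ops A N).
Hypothesis HL : is_lie_algebroid V l.
Local Notation rho := (lanchor l).

Lemma la_vb : is_vbundle V. Proof. by case: HL => -[]. Qed.
Let HV := la_vb.
Let HN := vb_closedM HV.
Let HA := vb_closedE HV.

Lemma la_morph : vb_morphism V (tangent_vb N) rho id.
Proof. by case: HL => -[]. Qed.

Lemma tpt_rho x : tpt (rho x) = vproj V x.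
Proof. by have [_ _ H _ _] := la_morph; exact: H. Qed.

Definition rho_fun (F : N -> R) (x : A) : R := tval (rho x) F.

Lemma rho_fun_lin F : sfun F -> lin_fun V (rho_fun F).
Proof.
move=> HF; have [Hs _ _ HDm HZ] := la_morph; split.
  exact: (Hs _ (sfun_tval HF)).
split=> [x y xy|t x]; rewrite /rho_fun.
  by rewrite HDm// (tval_tadd HN)// !tpt_rho.
by rewrite HZ (tval_tscale HN).
Qed.

Lemma rho_zero n f : tval (rho (vzero V n)) f = 0.
Proof.
have [Hf|Hf] := pselect (sfun f); last by case: (tvalP (rho (vzero V n))) => ->.
exact: (fl_0 HV _ (rho_fun_lin Hf).2).
Qed.

Lemma la_br_section a b : section V a -> section V b -> section V (lbr l a b).
Proof. by case: HL => -[_ _ [+ _ _]] _; apply. Qed.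

Lemma la_br0 a : section V a -> lbr l a (vzero V) = vzero V.
Proof.
move=> Ha; have H0 := vzero_section HV.
have -> : vzero V = sscale V (fun=> 0) (vzero V).
  by apply/funext => n; rewrite /sscale (vscale0 HV) (vproj0 HV).
have [[_ _ [_ _ HZ]] _] := HL; have [_ ->] := HZ 0 a _ Ha H0.
have [_ pb] := la_br_section Ha H0.
by apply/funext => n; rewrite /sscale !(vscale0 HV) pb (vproj0 HV).
Qed.

Definition Pi1 (a b c : N -> A) n : TS A :=
  vadd (tangent_vb A) (Tmap b (rho (a n))) (vlift V (b n) (vadd V (lbr l b a n) (c n))).
Definition Pi2 (a b c : N -> A) n : TS A :=
  vadd (tangent_vb A) (Tmap a (rho (b n))) (vlift V (a n) (c n)).

Section PiValues.
Variables (a b c : N -> A) (n : N).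
Hypotheses (Ha : section V a) (Hb : section V b) (Hc : section V c).

Lemma Pi_relI : Pi_rel V l (Pi1 a b c n, Pi2 a b c n).
Proof. by exists a, b, c, n. Qed.

Lemma tpt_Pi1 : tpt (Pi1 a b c n) = b n.
Proof.
by rewrite tpt_tadd tpt_Tmap tpt_rho; case: Ha => _ ->.
Qed.

Lemma tpt_Pi2 : tpt (Pi2 a b c n) = a n.
Proof.
by rewrite tpt_tadd tpt_Tmap tpt_rho; case: Hb => _ ->.
Qed.

Let pb1 : vproj V (b n) = vproj V (vadd V (lbr l b a n) (c n)).
Proof.
have [_ pb] := Hb; have [_ pc] := Hc; have [_ pba] := la_br_section Hb Ha.
by rewrite (vprojD HV) ?pba ?pc ?pb.
Qed.

Let pa1 : vproj V (a n) = vproj V (c n).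
Proof. by case: Ha => _ ->; case: Hc => _ ->. Qed.

Lemma tval_Pi1 f : sfun f -> tval (Pi1 a b c n) f =
  tval (rho (a n)) (fun m => f (b m)) +
  tval (vlift V (b n) (vadd V (lbr l b a n) (c n))) f.
Proof.
move=> Hf; rewrite (tval_tadd HA)//; last first.
  rewrite tpt_Tmap tpt_rho (tpt_vlift HV)//.
  by case: Ha => _ ->.
by rewrite (tval_Tmap HA)//; case: Hb.
Qed.

Lemma tval_Pi2 f : sfun f -> tval (Pi2 a b c n) f =
  tval (rho (b n)) (fun m => f (a m)) + tval (vlift V (a n) (c n)) f.
Proof.
move=> Hf; rewrite (tval_tadd HA)//; last first.
  rewrite tpt_Tmap tpt_rho (tpt_vlift HV)//.
  by case: Hb => _ ->.
by rewrite (tval_Tmap HA)//; case: Ha.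
Qed.

Lemma Pi1_lin f : lin_fun V f -> tval (Pi1 a b c n) f =
  tval (rho (a n)) (fun m => f (b m)) + f (lbr l b a n) + f (c n).
Proof.
move=> [Hf fl]; rewrite tval_Pi1// (vlift_lin HV)// (fl_D fl) ?addrA//.
by have [_ ->] := la_br_section Hb Ha; case: Hc => _ ->.
Qed.

Lemma Pi2_lin f : lin_fun V f -> tval (Pi2 a b c n) f =
  tval (rho (b n)) (fun m => f (a m)) + f (c n).
Proof. by move=> [Hf fl]; rewrite tval_Pi2// (vlift_lin HV). Qed.

Lemma Pi1_base g : sfun g ->
  tval (Pi1 a b c n) (fun x => g (vproj V x)) = tval (rho (a n)) g.
Proof.
move=> Hg; rewrite tval_Pi1; last exact: (vproj_smooth HV).
rewrite (vlift_base HV)// addr0; congr (tval _ _); apply/funext => m.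
by case: Hb => _ ->.
Qed.

Lemma Pi2_base g : sfun g ->
  tval (Pi2 a b c n) (fun x => g (vproj V x)) = tval (rho (b n)) g.
Proof.
move=> Hg; rewrite tval_Pi2; last exact: (vproj_smooth HV).
rewrite (vlift_base HV)// addr0; congr (tval _ _); apply/funext => m.
by case: Ha => _ ->.
Qed.

(* The differential of the exact one-form [rho_fun F] vanishes. *)
Lemma Pi_exact F : sfun F ->
  tval (Pi1 a b c n) (rho_fun F) = tval (Pi2 a b c n) (rho_fun F).
Proof.
move=> HF; have Hl := rho_fun_lin HF.
apply: etrans (Pi1_lin Hl) _; apply: etrans _ (esym (Pi2_lin Hl)).
have [_ [_ _ _ Hanc]] := HL.
by rewrite {2}/rho_fun (Hanc _ _ Hb Ha)// /rho_fun; ring.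
Qed.

End PiValues.
End Anchor.

(** * The Dirac structure *)

Section MaximalIsotropic.
Variables (R : realType) (E N : smoothSpace R) (V : vb_ops E N) (pair : E -> E -> R).
Hypothesis HV : is_vbundle V.
Hypothesis HP : is_fibre_pairing V pair.

(** Adjoining the line of w to L keeps it isotropic, so maximality puts w into L. *)
Lemma maximal_isotropic_mem n (L : E -> Prop) w : maximal_isotropic V pair n L ->
  vproj V w = n -> (forall x, L x -> pair w x = 0) -> pair w w = 0 -> L w.
Proof.
move=> [[Lp L0 LD LZ Liso] Lmax] wn wL ww.
have p0 := vproj0 HV; have pZ := vprojZ HV.
pose L' x := exists y t, L y /\ x = vadd V y (vscale V t w).
have pL y : L y -> vproj V y = vproj V w by move=> /Lp ->.
have pLt y t : L y -> vproj V y = vproj V (vscale V t w) by move=> /pL ->; rewrite pZ.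
apply: (Lmax L'); first split.
- by move=> _ [y [t [Ly ->]]]; rewrite (vprojD HV) ?(pLt _ t)// pZ.
- exists (vzero V n), 0; split=> //.
  by rewrite (vscale0 HV) wn (vaddx0 HV).
- move=> _ _ [y [t [Ly ->]]] [y' [t' [Ly' ->]]].
  have yy' : vproj V y = vproj V y' by rewrite !pL.
  exists (vadd V y y'), (t + t'); split; first exact: LD.
  have q1 := pLt y t Ly; have q2 := pLt y' t' Ly'; have q3 := pLt y (t + t') Ly.
  apply: (lin_sep HV) => [|l [_ fl]].
    by rewrite !(vprojD HV) ?q1// -?q1 ?yy' ?q2// ?pZ.
  rewrite !(fl_D fl)// ?(vprojD HV)// -?q1 -?q2//.
  by rewrite !(fl_Z _ _ fl); ring.
- move=> t _ [y [s [Ly ->]]]; exists (vscale V t y), (t * s); split; first exact: LZ.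
  have q1 := pLt y s Ly; have q2 := pLt y (t * s) Ly.
  have q3 : vproj V (vscale V t y) = vproj V (vscale V (t * s) w) by rewrite pZ.
  apply: (lin_sep HV) => [|l [_ fl]].
    by rewrite pZ (vprojD HV q1) (vprojD HV q3) pZ.
  rewrite (fl_Z _ _ fl) (fl_D fl q1) (fl_D fl q3) !(fl_Z _ _ fl); ring.
- move=> _ _ [y [t [Ly ->]]] [y' [t' [Ly' ->]]].
  have q1 := pL y Ly; have q2 := pL y' Ly'.
  rewrite (pairDl HP) ?pZ// ?(vprojD HV) ?pZ ?q2//.
  rewrite !(pairDr HV HP) ?pZ ?q1 ?q2// !(pairZl HP) ?(vprojD HV) ?pZ//.
  rewrite !(pairZr HV HP) ?q1// Liso// (pairC HP)// wL// wL// ww.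
  by rewrite !mulr0 !addr0.
- by move=> x Lx; exists x, 0; split=> //; rewrite (vscale0 HV) wn (vaddx0 HV)//; exact: Lp.
- exists (vzero V n), 1; split=> //.
  by rewrite (vscale1 HV) (vadd0x HV).
Qed.

End MaximalIsotropic.

Section VBAlgebroid.
Variables (R : realType) (E Q B C M : smoothSpace R) (D : dvb_ops E Q B C M).
Variable L : vb_algebroid_ops E Q B M.
Hypothesis HVA : is_vb_algebroid D L.

Lemma lac_lie : is_lie_algebroid (dEQ D) (va_lie L). Proof. by case: HVA. Qed.

Lemma rho_base x k : sfun k ->
  tval (lanchor (va_lie L) x) (fun q => k (vproj (dQM D) q)) =
  tval (lanchor (va_base L) (vproj (dEB D) x)) k.
Proof.
move=> Hk; have [[[_ _ HQM _ _] _] _ [[_ _ H _ _] _ _ _] _ _] := HVA.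
have := congr1 (fun v : TS M => tval v k) (H x) => /=.
by rewrite (tval_Tmap (vb_closedM HQM))//; exact: vproj_smooth.
Qed.

End VBAlgebroid.

Section Dirac.
Variables (R : realType) (E Q B C M : smoothSpace R) (D : dvb_ops E Q B C M).
Variables (K : vb_courant_ops E Q B C M) (L : vb_algebroid_ops E Q B M).
Hypothesis HVC : is_vb_courant D K.
Hypothesis HVA : is_vb_algebroid D L.
Local Notation EQ := (dEQ D).
Local Notation EB := (dEB D).
Local Notation QM := (dQM D).
Local Notation BM := (dBM D).
Local Notation CM := (dCM D).
Local Notation c := (vc_courant K).
Local Notation ev := (vc_ev K).
Local Notation l := (va_lie L).
Local Notation rho := (lanchor l).
Local Notation rhoB := (lanchor (va_base L)).

Lemma lac_dvb : is_dvb D. Proof. by case: HVC. Qed.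
Lemma lac_metric : is_metric D (cpair c) ev. Proof. by case: HVC. Qed.
Let HD := lac_dvb.
Let HMe := lac_metric.
Let HL := lac_lie HVA.
Let HP := metric_pairing HMe.
Let HEB := dvb_EB HD.
Let HQM := dvb_QM HD.
Let HBM := dvb_BM HD.

Lemma Theta_base x k : sfun k ->
  tval (canchor c x) (fun b => k (vproj BM b)) = tval (vc_rhoQ K (vproj EQ x)) k.
Proof.
move=> Hk; have [_ _ _ [[_ _ H _ _] _ _ _] _] := HVC.
have := congr1 (fun v : TS M => tval v k) (H x) => /=.
by rewrite (tval_Tmap (vb_closedM HBM))//; exact: vproj_smooth.
Qed.

(* [e] represents, through the metric, the fibrewise linear function
   [x |-> rho x (ell tau)] on E -> B.  The core bracket will be
   [core_section (bracket tau1 tau2) = cbr c e1 (core_section tau2)]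
   for [e1] dual to [tau1]. *)
Definition is_dual (tau : M -> C) (e : B -> E) := section EB e /\
  forall x, cpair c (e (vproj EB x)) x = rho_fun l (ell D ev tau) x.

Variables (cT : courant_ops (TS E) (TS B)).
Variables (cP : courant_ops (prodS (TS E) (TS E)) (prodS (TS B) (TS B))).
Hypothesis HT : is_tangent_courant EB c cT.
Hypothesis HPr : is_product_courant (Tvb EB) (Tvb EB) (opp_courant (Tvb EB) cT) cT cP.
Local Notation TE := (Tvb EB).
Local Notation PB := (prod_vb TE TE).
Local Notation Pi := (Pi_rel EQ l).
Variable S : prodS (TS B) (TS B) -> Prop.
Hypothesis HS1 : is_subbundle PB Pi S.
Hypothesis HS2 : forall n, S n ->
  maximal_isotropic PB (cpair cP) n (fun x => Pi x /\ vproj PB x = n).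

Lemma prod_vbundle : is_vbundle PB. Proof. by case: HPr => -[[[]]]. Qed.
Lemma prod_pairing : is_fibre_pairing PB (cpair cP). Proof. by case: HPr => -[[[]]]. Qed.

Lemma prod_pairE x y : vproj PB x = vproj PB y ->
  cpair cP x y = - cpair cT x.1 y.1 + cpair cT x.2 y.2.
Proof. by case: HPr => _ H _ _; exact: H. Qed.

Lemma Pi_iso p p' : Pi p -> Pi p' -> vproj PB p = vproj PB p' ->
  cpair cT p.1 p'.1 = cpair cT p.2 p'.2.
Proof.
move=> Hp Hp' E1; have Sp : S (vproj PB p) by exact: HS1.1.
have [[_ _ _ _ iso] _] := HS2 Sp.
have := iso p p' (conj Hp erefl) (conj Hp' (esym E1)).
by rewrite prod_pairE// => /eqP; rewrite addrC subr_eq0 => /eqP.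
Qed.

Lemma S_witness n : S n -> exists a b d q,
  [/\ section EQ a, section EQ b, section EQ d &
      n = (vproj TE (Pi1 EQ l a b d q), vproj TE (Pi2 EQ l a b d q))].
Proof.
move=> Sn; have [[_ [[a [b [d [q [Ha Hb Hd E1 E2]]]]] E3] _ _ _] _] := HS2 Sn.
exists a, b, d, q; split=> //.
rewrite -[LHS]E3 /Pi1 /Pi2 -E1 -E2.
by [].
Qed.

(* By maximality of the Dirac structure, membership only has to be tested
   against the generators [(Pi1, Pi2)]. *)
Lemma Pi_member n u v : S n -> vproj TE u = n.1 -> vproj TE v = n.2 ->
  (forall a b d q, section EQ a -> section EQ b -> section EQ d ->
    n.1 = vproj TE (Pi1 EQ l a b d q) -> n.2 = vproj TE (Pi2 EQ l a b d q) ->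
    cpair cT u (Pi1 EQ l a b d q) = cpair cT v (Pi2 EQ l a b d q)) ->
  cpair cT u u = cpair cT v v -> Pi (u, v).
Proof.
move=> Sn un vn H Huv.
have pn : vproj PB (u, v) = n.
  by rewrite (surjective_pairing n) -un -vn.
suff [] : Pi (u, v) /\ vproj PB (u, v) = n by [].
apply: (maximal_isotropic_mem prod_vbundle prod_pairing (HS2 Sn) pn).
  move=> p [[a [b [d [q [Ha Hb Hd E1 E2]]]]] E3].
  have Ep1 : p.1 = Pi1 EQ l a b d q := E1.
  have Ep2 : p.2 = Pi2 EQ l a b d q := E2.
  have n1 : n.1 = vproj TE (Pi1 EQ l a b d q) by rewrite -Ep1 -E3.
  have n2 : n.2 = vproj TE (Pi2 EQ l a b d q) by rewrite -Ep2 -E3.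
  rewrite prod_pairE; last by rewrite pn E3.
  apply: (etrans (f_equal2 (fun x y => - x + y) (f_equal (cpair cT u) Ep1)
    (f_equal (cpair cT v) Ep2))).
  by rewrite (H _ _ _ _ Ha Hb Hd n1 n2) addNr.
by rewrite prod_pairE//= Huv addNr.
Qed.

Section Members.
Variables (tau : M -> C) (e : B -> E).
Hypothesis Htau : section CM tau.
Hypothesis He : is_dual tau e.
Local Notation td := (core_section D tau).

Lemma dual_funE : dual_fun EB (cpair c) e = rho_fun l (ell D ev tau).
Proof. by apply/funext => x; case: He => _; apply. Qed.

Lemma dual_core_fun :
  dual_fun EB (cpair c) td = fun x => ell D ev tau (vproj EQ x).
Proof. by apply/funext => x; rewrite (dual_core HD HMe). Qed.

Let Htd : section EB td. Proof. exact: core_section_section. Qed.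
Let Hell := (ell_lin HD HMe Htau).1.

Lemma core_Tmap_self v : cpair cT (Tmap td v) (Tmap td v) = 0.
Proof.
have [_ /(_ _ _ Htd Htd)[[-> _ _] _]] := HT.
have -> : spair (cpair c) td td = fun=> 0; last exact: (tval_cst (vb_closedM HEB)).
apply/funext => b; rewrite /spair !core_sectionE (pair_core_core HD HMe)//;
  by case: Htau => _ ->.
Qed.

Lemma cross_self v : cpair cT (cross EB e v) (cross EB e v) = 0.
Proof. by have [_ /(_ _ _ He.1 He.1)[[_ _ ->] _]] := HT. Qed.

Lemma pair_Tmap_core p :
  cpair cT (Tmap td (vproj TE p)) p = tval p (fun x => ell D ev tau (vproj EQ x)).
Proof. by rewrite (pair_Tmap HEB HP HT) ?dual_core_fun. Qed.

Lemma pair_Tmap_dual p :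
  cpair cT (Tmap e (vproj TE p)) p = tval p (rho_fun l (ell D ev tau)).
Proof. by rewrite (pair_Tmap HEB HP HT) ?dual_funE//; case: He. Qed.

Lemma pair_cross_dual p :
  cpair cT (cross EB e (vproj TE p)) p = tval (rho (tpt p)) (ell D ev tau).
Proof. by rewrite (pair_cross HEB HP HT); case: He. Qed.

(** Both pairings with the generator given by a, b and d equal rho(b)(ell_tau). The cross section
    sees only the foot b of Pi1, and ell_tau, pulled back to E, is a base function for E -> Q, on
    which Pi2 acts as the anchor of b. *)
Lemma x_member n : S n -> Pi (cross EB e n.1, Tmap td n.2).
Proof.
move=> Sn; apply: (Pi_member Sn).
- exact: (vproj_cross HEB _ He.1).
- by case: (Tmap_section HEB Htd).
- move=> a b d q Ha Hb Hd -> ->.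
  rewrite pair_cross_dual pair_Tmap_core (tpt_Pi1 HL)//.
  exact: esym (Pi2_base HL q Ha Hb Hd Hell).
- by rewrite core_Tmap_self cross_self.
Qed.

(** The mirror image of [x_member]: Pi2 has foot a, and Pi1 projects to the anchor of a. *)
Lemma y_member n : S n -> Pi (Tmap td n.1, cross EB e n.2).
Proof.
move=> Sn; apply: (Pi_member Sn).
- by case: (Tmap_section HEB Htd).
- exact: (vproj_cross HEB _ He.1).
- move=> a b d q Ha Hb Hd -> ->.
  rewrite pair_cross_dual pair_Tmap_core (tpt_Pi2 HL)//.
  exact: (Pi1_base HL q Ha Hb Hd Hell).
- by rewrite core_Tmap_self cross_self.
Qed.

(** Against generators this is [Pi_exact] for ell_tau. The self-pairings agree for the same reason:
    <e, e>, pulled back to E, is the exact form of the pullback of k to Q. *)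
Lemma W_member k n : sfun k ->
  (forall b, cpair c (e b) (e b) = tval (rhoB b) k) ->
  S n -> Pi (Tmap e n.1, Tmap e n.2).
Proof.
move=> Hk ee Sn; apply: (Pi_member Sn).
- by case: (Tmap_section HEB He.1).
- by case: (Tmap_section HEB He.1).
- move=> a b d q Ha Hb Hd -> ->.
  apply: etrans (pair_Tmap_dual _) _; apply: etrans _ (esym (pair_Tmap_dual _)).
  exact: (Pi_exact HL q Ha Hb Hd Hell).
have [a [b [d [q [Ha Hb Hd ->]]]]] := S_witness Sn.
have [_ /(_ _ _ He.1 He.1)[[TT _ _] _]] := HT.
apply: etrans (TT _) _; apply: etrans _ (esym (TT _)).
have Hkq : sfun (fun q => k (vproj QM q)) by exact: (vproj_smooth HQM).
have Hs : sfun (spair (cpair c) e e) := pair_sfun HP He.1 He.1.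
have E1 : (fun x => spair (cpair c) e e (vproj EB x)) =
    rho_fun l (fun q => k (vproj QM q)).
  by apply/funext => x; rewrite /rho_fun (rho_base HVA)// -ee.
have E2 p : tval (vproj TE p) (spair (cpair c) e e) =
    tval p (rho_fun l (fun q => k (vproj QM q))).
  by rewrite -E1; exact: (tval_Tmap (vb_closedM HEB) _ (vproj_smooth HEB)).
apply: etrans (E2 _) _; apply: etrans _ (esym (E2 _)).
exact: (Pi_exact HL q Ha Hb Hd Hkq).
Qed.

End Members.

End Dirac.

Section VerticalVectors.
Variables (R : realType) (A N : smoothSpace R) (V : vb_ops A N).
Hypothesis HV : is_vbundle V.

Lemma vlift_affine x y f a b : vproj V x = vproj V y -> sfun f ->
  (forall t, f (vadd V x (vscale V t y)) = t * a + b) -> tval (vlift V x y) f = a.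
Proof.
move=> xy Hf H; have D1 := vlift_val HV xy Hf.
have D2 : is_derive (0 : R) 1 (fun t => f (vadd V x (vscale V t y))) a.
  under eq_fun do rewrite H.
  exact: is_derive_affine.
by rewrite -(@derive_val _ _ _ _ _ _ _ D1) (@derive_val _ _ _ _ _ _ _ D2).
Qed.

Lemma vlift_zero x m f : vproj V x = m -> sfun f -> tval (vlift V x (vzero V m)) f = 0.
Proof.
move=> <- Hf; apply: (vlift_affine (b := f x)) => // [|t]; first by rewrite (vproj0 HV).
by rewrite (vscale_zero HV) (vaddx0 HV)// mulr0 add0r.
Qed.

Variable l : lie_ops A N.
Hypothesis HL : is_lie_algebroid V l.

(** The generator with a = 0, c = 0 and b through x; its vertical parts vanish because [b, 0] =
    0. *)
Lemma Pi_zero x : Pi_rel V l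
  (vzero (tangent_vb A) x, Tmap (vzero V) (lanchor l x)).
Proof.
have HA := vb_closedE HV; have [b Hb bx] := section_through HV x.
have H0 := vzero_section HV; have [_ pb] := Hb; have p0 := vproj0 HV.
have Hba : lbr l b (vzero V) = vzero V := la_br0 HL Hb.
suff [<- <-] : Pi1 V l (vzero V) b (vzero V) (vproj V x) = vzero (tangent_vb A) x /\
    Pi2 V l (vzero V) b (vzero V) (vproj V x) = Tmap (vzero V) (lanchor l x).
  exact: Pi_relI.
split; apply: tvec_eq => [|f Hf].
- by rewrite [LHS](tpt_Pi1 HL)// tpt_tzero.
- rewrite [LHS](tval_Pi1 HL)// (tval_tzero HA) (rho_zero HL) add0r Hba (vaddx0 HV)//.
  by rewrite vlift_zero.
- by rewrite [LHS](tpt_Pi2 HL)// tpt_Tmap (tpt_rho HL).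
- rewrite [LHS](tval_Pi2 HL)// vlift_zero// addr0 bx.
  by rewrite (tval_Tmap HA)//; case: H0.
Qed.

End VerticalVectors.

(** * Evaluation of Pi at base points of the support *)

Section BasePoints.
Variables (R : realType) (E Q B C M : smoothSpace R) (D : dvb_ops E Q B C M).
Variables (K : vb_courant_ops E Q B C M) (L : vb_algebroid_ops E Q B M).
Hypothesis HVC : is_vb_courant D K.
Hypothesis HVA : is_vb_algebroid D L.
Local Notation EQ := (dEQ D).
Local Notation EB := (dEB D).
Local Notation QM := (dQM D).
Local Notation BM := (dBM D).
Local Notation CM := (dCM D).
Local Notation c := (vc_courant K).
Local Notation ev := (vc_ev K).
Local Notation l := (va_lie L).
Local Notation rho := (lanchor l).
Local Notation rhoB := (lanchor (va_base L)).
Let HD := lac_dvb HVC.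
Let HMe := lac_metric HVC.
Let HL := lac_lie HVA.
Let HP := metric_pairing HMe.
Let HEQ := dvb_EQ HD.
Let HEB := dvb_EB HD.
Let HQM := dvb_QM HD.
Let HBM := dvb_BM HD.
Let HB := vb_closedM HEB.
Let HE := vb_closedE HEB.
Let HQ := vb_closedM HEQ.
Let HM := vb_closedM HBM.
Variables (cT : courant_ops (TS E) (TS B)).
Variables (cP : courant_ops (prodS (TS E) (TS E)) (prodS (TS B) (TS B))).
Hypothesis HT : is_tangent_courant EB c cT.
Hypothesis HPr : is_product_courant (Tvb EB) (Tvb EB) (opp_courant (Tvb EB) cT) cT cP.
Local Notation TE := (Tvb EB).
Local Notation PB := (prod_vb TE TE).
Local Notation Pi := (Pi_rel EQ l).
Variable S : prodS (TS B) (TS B) -> Prop.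
Hypothesis HS1 : is_subbundle PB Pi S.
Hypothesis HS2 : forall n, S n ->
  maximal_isotropic PB (cpair cP) n (fun x => Pi x /\ vproj PB x = n).

Let HTP := tangent_pairing HT.

Lemma tpt_rhoB b : tpt (rhoB b) = vproj BM b.
Proof.
have [_ _ [[_ _ H _ _] _ _ _] _ _] := HVA.
have [x Hx pb] := section_through HBM b.
have := congr1 (fun v : TS M => tpt v) (H (vzero EB b)) => /=.
by rewrite tpt_Tmap (tpt_rho HL) (projEQ_zero HD) (vproj0 HQM) (vproj0 HEB) => <-.
Qed.

(** Scaling by 0 over B corresponds under the anchor to the tangent map of scaling by 0 on Q, which
    is the projection followed by the zero section. *)
Lemma rho_zeroB b : rho (vzero EB b) = Tmap (vzero QM) (rhoB b).
Proof.
have [_ _ [[_ _ H1 _ H] _ _ _] _ _] := HVA.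
rewrite -{1}(vproj0 HEB b) -(vscale0 HEB) H /= -{2}(vproj0 HEB b) -H1.
apply: tvec_eq => [|f Hf]; first by rewrite !tpt_Tmap (vscale0 HQM).
have H0 := (vzero_section HQM).1; have Hp := vproj_smooth HQM.
rewrite !(tval_Tmap HQ)//; last first.
  by move=> g Hg; under eq_fun do rewrite (vscale0 HQM); exact: Hp (H0 _ Hg).
rewrite (tval_Tmap HM)//; last exact: H0.
by congr tval; apply/funext => q; rewrite (vscale0 HQM).
Qed.

(* The point of S over which the pairs [Pi_zero x], [vproj EB x = b], lie. *)
Definition base_point (b : B) : prodS (TS B) (TS B) :=
  (vzero (tangent_vb B) b, Tmap (vzero BM) (rhoB b)).

Lemma vproj_Pi_zero x : vproj PB (vzero (tangent_vb E) x, Tmap (vzero EQ) (rho x)) =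
  base_point (vproj EB x).
Proof.
apply: (f_equal2 (fun u v : TS B => (u, v) : prodS (TS B) (TS B)));
  apply: tvec_eq => [|f Hf].
- by rewrite [LHS]tpt_Tmap !tpt_tzero.
- rewrite [LHS](tval_Tmap HB)//; last exact: vproj_smooth.
  by rewrite (tval_tzero HE) (tval_tzero HB).
- rewrite [LHS]tpt_Tmap !tpt_Tmap (tpt_rho HL) tpt_rhoB (projEB_zeroQ HD).
  by rewrite (proj_proj HD).
- have H0 := (vzero_section HEQ).1; have H0' := (vzero_section HBM).1.
  rewrite [LHS](tval_Tmap HB)//; last exact: (vproj_smooth HEB).
  rewrite (tval_Tmap HE)//; last exact: (vproj_smooth HEB).
  rewrite (tval_Tmap HB)// -(rho_base HVA)//; last exact: H0'.
  by congr tval; apply/funext => q; rewrite (projEB_zeroQ HD).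
Qed.

Lemma S_base b : S (base_point b).
Proof.
rewrite -(vproj0 HEB b) -vproj_Pi_zero; apply: HS1.1.
exact: Pi_zero.
Qed.

Lemma Pi_zero_iso u v x : Pi (u, v) -> vproj PB (u, v) = base_point (vproj EB x) ->
  cpair cT u (vzero (tangent_vb E) x) = cpair cT v (Tmap (vzero EQ) (rho x)).
Proof.
move=> Hp Ep.
have := Pi_iso HPr HS1 HS2 Hp (Pi_zero HEQ HL x).
by apply; rewrite vproj_Pi_zero.
Qed.

Section Values.
Variables (u : B -> E) (x : E).
Hypothesis Hu : section EB u.
Local Notation n1 := ((base_point (vproj EB x)).1).
Local Notation n2 := ((base_point (vproj EB x)).2).

Let p1 : n1 = vproj TE (vzero (tangent_vb E) x).
Proof. by rewrite -vproj_Pi_zero. Qed.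

Let p2 : n2 = vproj TE (Tmap (vzero EQ) (rho x)).
Proof. by rewrite -vproj_Pi_zero. Qed.

Lemma cross_base1 : cpair cT (cross EB u n1) (vzero (tangent_vb E) x) =
  cpair c (u (vproj EB x)) x.
Proof. by rewrite p1 (pair_cross HEB HP HT _ Hu) tpt_tzero. Qed.

Lemma cross_base2 : cpair cT (cross EB u n2) (Tmap (vzero EQ) (rho x)) =
  cpair c (u (vzero BM (vproj BM (vproj EB x)))) (vzero EQ (vproj EQ x)).
Proof.
rewrite p2 (pair_cross HEB HP HT _ Hu) tpt_Tmap (tpt_rho HL) (projEB_zeroQ HD).
by rewrite (proj_proj HD).
Qed.

Lemma Tmap_base2 : cpair cT (Tmap u n2) (Tmap (vzero EQ) (rho x)) =
  tval (rho x) (fun q => cpair c (u (vzero BM (vproj QM q))) (vzero EQ q)).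
Proof.
rewrite p2 (pair_Tmap HEB HP HT _ Hu) (tval_Tmap HE).
- by congr tval; apply/funext => q; rewrite /dual_fun (projEB_zeroQ HD).
- exact: (vzero_section HEQ).1.
- exact: (dual_fun_lin HEB HP Hu).1.
Qed.

End Values.

Lemma vproj_pull u v n : section TE u -> section TE v ->
  vproj PB (u n.1, v n.2) = n.
Proof.
move=> [_ pu] [_ pv]; case: n => n1 n2.
exact: (f_equal2 (fun v w : TS B => (v, w) : prodS (TS B) (TS B)) (pu n1) (pv n2)).
Qed.

(** At the base point over b, pairing with the member [Pi_zero x] keeps on the left only the value
    of u at b, and on the right a derivative along rho x on the zero section. For v = tau^dagger
    this is the condition in [is_dual]. *)
Lemma cross_Tmap_dual u v x : section EB u -> section EB v ->
  (forall n, S n -> Pi (cross EB u n.1, Tmap v n.2)) ->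
  cpair c (u (vproj EB x)) x =
  tval (rho x) (fun q => cpair c (v (vzero BM (vproj QM q))) (vzero EQ q)).
Proof.
move=> Hu Hv H; have Sb := S_base (vproj EB x).
have H1 := Pi_zero_iso (H _ Sb) (vproj_pull _ (cross_section HEB HT Hu) (Tmap_section HEB Hv)).
exact: etrans (esym (cross_base1 x Hu)) (etrans H1 (Tmap_base2 x Hv)).
Qed.

Lemma cross_cross_dual u v x : section EB u -> section EB v ->
  (forall n, S n -> Pi (cross EB u n.1, cross EB v n.2)) ->
  cpair c (u (vproj EB x)) x =
  cpair c (v (vzero BM (vproj BM (vproj EB x)))) (vzero EQ (vproj EQ x)).
Proof.
move=> Hu Hv H; have Sb := S_base (vproj EB x).
have H1 := Pi_zero_iso (H _ Sb) (vproj_pull _ (cross_section HEB HT Hu) (cross_section HEB HT Hv)).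
exact: etrans (esym (cross_base1 x Hu)) (etrans H1 (cross_base2 x Hv)).
Qed.

Section DualSections.
Variable Sg : Q -> B -> E.
Hypothesis HSg : is_lagrangian_splitting D (cpair c) Sg.
Let HS : is_splitting D Sg := HSg.1.
Variable P' : two_rep Q B C M.
Hypothesis HP' : is_two_rep D L Sg P'.
Local Notation dQ := (tr_dQ P').
Local Notation nablaC := (tr_nablaC P').

Lemma proj_dQ t : vproj QM (dQ t) = vproj CM t.
Proof. by have [[[_ _ H _ _] _] _ _ _ _] := HP'; apply: (H). Qed.

Lemma nablaC_section b tau : section BM b -> section CM tau ->
  section CM (nablaC b tau).
Proof. by move=> Hb Ht; have [_ _ H _ _] := HP'; case: (H b tau Hb Ht). Qed.

(* The element of [Pi_rel] given by [a = tau^dagger], [b = sigma_B b] and [c = 0]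
   at the zero of the fibre; its pairing with [Pi_zero x] yields [dual_formula]. *)
Section SplitElement.
Variables (tau : M -> C) (b : M -> B) (m : M).
Hypotheses (Htau : section CM tau) (Hb : section BM b).
Local Notation tq := (core_section (flip D) tau).
Local Notation sb := (sigmaB D Sg b).
Local Notation p1 := (Pi1 EQ l tq sb (vzero EQ) (vzero QM m)).
Local Notation p2 := (Pi2 EQ l tq sb (vzero EQ) (vzero QM m)).

Let Htq : section EQ tq. Proof. exact: core_sectionQ_section. Qed.
Let Hsb : section EQ sb. Proof. exact: sigmaB_section. Qed.
Let H0 := vzero_section HEQ.
Let pb : vproj BM (b m) = m. Proof. by case: Hb. Qed.
Let pt : vproj CM (tau m) = m. Proof. by case: Htau. Qed.
Let pN : vproj CM (nablaC b tau m) = m.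
Proof. by case: (nablaC_section Hb Htau). Qed.

Let sb0 : sb (vzero QM m) = vzero EB (b m).
Proof. by rewrite /sigmaB (vproj0 HQM) -{1}pb (split_0B HD HS). Qed.

Let tq0 : tq (vzero QM m) = dcore D (tau m).
Proof. by rewrite core_sectionQE (vproj0 HQM) -{1}pt (core_atQ0 HD). Qed.

Let brE : vadd EQ (lbr l sb tq (vzero QM m)) (vzero EQ (vzero QM m)) =
  dcore D (nablaC b tau m).
Proof.
have [_ _ /(_ b tau Hb Htau)[_ ->] _ _] := HP'.
rewrite core_sectionQE (vproj0 HQM) -{1}pN (core_atQ0 HD) (vaddx0 HEQ)//.
by rewrite (projEQ_core HD) pN.
Qed.

Let anchor_tq : rho (tq (vzero QM m)) = vlift QM (vzero QM m) (dQ (tau m)).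
Proof. by have [[_ H] _ _ _ _] := HP'; rewrite (H _ Htau) (vproj0 HQM). Qed.

Let core_line t : vadd EQ (vzero EB (b m)) (vscale EQ t (dcore D (nablaC b tau m))) =
  vscale EB t (core_at D (b m) (nablaC b tau m)).
Proof. by rewrite -(core_atZ HD) ?pN// -(coreQ_Z HD). Qed.

Let tval_p1 f : sfun f -> tval p1 f =
  tval (vlift QM (vzero QM m) (dQ (tau m))) (fun q => f (Sg q (b (vproj QM q)))) +
  tval (vlift EQ (vzero EB (b m)) (dcore D (nablaC b tau m))) f.
Proof.
move=> Hf; have := tval_Pi1 HL (vzero QM m) Htq Hsb H0 Hf.
by rewrite brE anchor_tq sb0.
Qed.

Let dQm : vproj QM (vzero QM m) = vproj QM (dQ (tau m)).
Proof. by rewrite (vproj0 HQM) proj_dQ. Qed.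

Let cm0 : vproj EQ (vzero EB (b m)) = vproj EQ (dcore D (nablaC b tau m)).
Proof. by rewrite (projEQ_zero HD) (projEQ_core HD) pb pN. Qed.

(** The anchor of tau^dagger at 0 is vertical and sigma_B(b) is linear, so p1 is a sum of two
    vectors tangent to lines through 0 in the fibre of E -> B over b(m). A linear function
    differentiates along such a line to its value. *)
Lemma split_element_pair e : section EB e ->
  tval p1 (dual_fun EB (cpair c) e) =
  cpair c (e (b m)) (vadd EB (Sg (dQ (tau m)) (b m))
    (core_at D (b m) (nablaC b tau m))).
Proof.
move=> He; have [Hd fd] := dual_fun_lin HEB HP He; have [_ pe] := He.
have qb q : vproj QM q = vproj BM (b (vproj QM q)) by case: Hb => _ ->.
have qbm : vproj QM (dQ (tau m)) = vproj BM (b m) by rewrite pb proj_dQ.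
have [r1 r2] := split_proj HS qbm.
have bN : vproj BM (b m) = vproj CM (nablaC b tau m) by rewrite pb pN.
have r3 : vproj EB (core_at D (b m) (nablaC b tau m)) = b m by exact: projEB_core_at.
rewrite tval_p1// (pairDr HEB HP) ?r2 ?r3 ?pe//.
apply: f_equal2.
  apply: (vlift_affine HQM (b := 0)) => // [|t].
    have [Hs _] := Hsb; exact: (Hs _ Hd).
  rewrite (vprojD HQM) ?(vprojZ HQM)// (vproj0 HQM).
  rewrite -{2}pb (split_DB HS) ?(split_ZB HS) ?(vprojZ HQM) ?(vproj0 HQM) ?proj_dQ ?pt ?pb//.
  rewrite (fl_D fd) ?(vprojZ HEB) ?r2; last first.
    by case: (split_proj HS (_ : vproj QM (vzero QM m) = vproj BM (b m))) => //;
      rewrite (vproj0 HQM) pb.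
  by rewrite -{1}pb (split_0B HD HS) (fl_0 HEB _ fd) (fl_Z _ _ fd) add0r addr0
    /dual_fun r2.
apply: (vlift_affine HEQ (b := 0)) => // t.
by rewrite core_line (fl_Z _ _ fd) addr0 /dual_fun r3.
Qed.

Lemma split_element_proj1 : vproj TE p1 = vzero (tangent_vb B) (b m).
Proof.
have bN : vproj BM (b m) = vproj CM (nablaC b tau m) by rewrite pb pN.
have r3 : vproj EB (core_at D (b m) (nablaC b tau m)) = b m by exact: projEB_core_at.
apply: tvec_eq => [|f Hf].
  by rewrite [LHS]tpt_Tmap (tpt_Pi1 HL)// sb0 (vproj0 HEB) tpt_tzero.
have Hf' := vproj_smooth HEB Hf.
rewrite [LHS](tval_Tmap HB)//; last exact: vproj_smooth.
rewrite tval_p1// (tval_tzero HB) [X in _ + X](_ : _ = 0) ?addr0; last first.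
  apply: (vlift_affine HEQ (b := f (b m))) => // t.
  by rewrite core_line (vprojZ HEB) r3 mulr0 add0r.
rewrite -(vlift_base HQM dQm (_ : sfun (fun n => f (b n)))); last first.
  by case: Hb => Hbs _; exact: Hbs.
congr tval; apply/funext => q.
have qb : vproj QM q = vproj BM (b (vproj QM q)) by case: Hb => _ ->.
by have [_ ->] := split_proj HS qb.
Qed.

(** At the zero of Q, sigma_B(b) equals 0_b, whose anchor is tangent to the zero section of Q, and
    along that section tau^dagger is the core element of tau. *)
Lemma split_element2 : p2 = Tmap (fun n => dcore D (tau n)) (rhoB (b m)).
Proof.
have Hdt : smooth_map (fun n => dcore D (tau n)).
  have [Hc _ _ _ _] := coreB_morph HD; have [Ht _] := Htau.
  by move=> f Hf; exact: Ht _ (Hc _ Hf).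
apply: tvec_eq => [|f Hf].
  by rewrite [LHS](tpt_Pi2 HL)// tq0 tpt_Tmap tpt_rhoB pb.
rewrite [LHS](tval_Pi2 HL)// sb0 rho_zeroB vlift_zero ?addr0//; last first.
  by rewrite tq0 (projEQ_core HD) pt.
have [Htqs _] := Htq.
rewrite (tval_Tmap HQ); last exact: (Htqs _ Hf).
  rewrite (tval_Tmap HE)//; congr tval; apply/funext => n.
  rewrite core_sectionQE (vproj0 HQM); have [_ ptn] := Htau.
  by rewrite -{1}(ptn n) (core_atQ0 HD).
exact: (vzero_section HQM).1.
Qed.

Lemma dual_formula x : vproj EB x = b m ->
  cpair c (vadd EB (Sg (dQ (tau m)) (b m)) (core_at D (b m) (nablaC b tau m))) x =
  rho_fun l (ell D ev tau) x.
Proof.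
move=> xb; have [e He ex] := section_through HEB x.
have Htd := core_section_section HD Htau.
have Hp : Pi (p1, p2) by exact: Pi_relI.
have n1 : vproj TE p1 = (base_point (vproj EB x)).1.
  by rewrite split_element_proj1 xb.
have Hdt : smooth_map (fun n => dcore D (tau n)).
  have [Hc _ _ _ _] := coreB_morph HD; have [Ht _] := Htau.
  by move=> f Hf; exact: Ht _ (Hc _ Hf).
have tcore n : dcore D (tau n) = core_section D tau (vzero BM n).
  have [_ ptn] := Htau.
  by rewrite core_sectionE (vproj0 HBM) -{2}(ptn n) (core_at0 HD).
have n2' : p2 = Tmap (core_section D tau) (base_point (vproj EB x)).2.
  rewrite split_element2 xb; have [Hs _] := Htd; have H0B := (vzero_section HBM).1.
  apply: tvec_eq => [|f Hf].
    by rewrite !tpt_Tmap tcore.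
  rewrite [LHS](tval_Tmap HE)// (tval_Tmap HE)// (tval_Tmap HB)//; last exact: Hs.
  by congr tval; apply/funext => n; rewrite tcore.
have n2 : vproj TE p2 = (base_point (vproj EB x)).2.
  by rewrite n2'; case: (Tmap_section HEB Htd).
have En : vproj PB (p1, p2) = base_point (vproj EB x).
  exact: (f_equal2 (fun v w : TS B => (v, w) : prodS (TS B) (TS B)) n1 n2).
have H1 := Pi_zero_iso Hp En.
(* Written as the image of a zero vector under Te, the zero vector at x pairs with p1 by
   [pair_Tmap]. *)
have E0 : vzero (tangent_vb E) x = Tmap e (vproj TE p1).
  rewrite split_element_proj1 -xb; apply: tvec_eq => [|f Hf].
    by rewrite tpt_Tmap !tpt_tzero ex.
  by rewrite (tval_tzero HE) (tval_Tmap HE)// ?(tval_tzero HB)//; case: He.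
have pTe : vproj TE (Tmap e (vproj TE p1)) = vproj TE p1.
  by case: (Tmap_section HEB He) => _; apply.
have H2 : cpair cT p1 (vzero (tangent_vb E) x) = tval p1 (dual_fun EB (cpair c) e).
  apply: etrans (f_equal (cpair cT p1) E0) _.
  apply: etrans (pairC HTP (esym pTe)) _.
  exact: (pair_Tmap HEB HP HT).
have H3 : cpair cT p2 (Tmap (vzero EQ) (rho x)) = rho_fun l (ell D ev tau) x.
  apply: etrans (f_equal (fun v => cpair cT v (Tmap (vzero EQ) (rho x))) n2') _.
  apply: etrans (Tmap_base2 x Htd) _; congr tval; apply/funext => q.
  rewrite (pairC HP); last first.
    by case: Htd => _ ->; rewrite (projEB_zeroQ HD).
  have [_ ptn] := Htau.
  rewrite -tcore (pair_core0 HD HMe) ?ptn//.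
rewrite -H3 -H1 H2 (split_element_pair He) -xb ex.
have qbm : vproj QM (dQ (tau m)) = vproj BM (b m) by rewrite pb proj_dQ pt.
have [r1 r2] := split_proj HS qbm.
apply: (pairC HP); rewrite (vprojD HEB) xb ?r2 ?(projEB_core_at HD)//.
by rewrite pb pN.
Qed.

End SplitElement.
End DualSections.

End BasePoints.

(** * Consequences of involutivity *)

Section Involutivity.
Variables (R : realType) (E Q B C M : smoothSpace R) (D : dvb_ops E Q B C M).
Variables (K : vb_courant_ops E Q B C M) (L : vb_algebroid_ops E Q B M).
Hypothesis HVC : is_vb_courant D K.
Hypothesis HVA : is_vb_algebroid D L.
Local Notation EQ := (dEQ D).
Local Notation EB := (dEB D).
Local Notation QM := (dQM D).
Local Notation BM := (dBM D).
Local Notation CM := (dCM D).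
Local Notation c := (vc_courant K).
Local Notation ev := (vc_ev K).
Local Notation l := (va_lie L).
Local Notation rho := (lanchor l).
Local Notation rhoB := (lanchor (va_base L)).
Let HD := lac_dvb HVC.
Let HMe := lac_metric HVC.
Let HP := metric_pairing HMe.
Let HEQ := dvb_EQ HD.
Let HEB := dvb_EB HD.
Let HBM := dvb_BM HD.
Variables (cT : courant_ops (TS E) (TS B)).
Variables (cP : courant_ops (prodS (TS E) (TS E)) (prodS (TS B) (TS B))).
Hypothesis HT : is_tangent_courant EB c cT.
Hypothesis HPr : is_product_courant (Tvb EB) (Tvb EB) (opp_courant (Tvb EB) cT) cT cP.
Local Notation TE := (Tvb EB).
Local Notation PB := (prod_vb TE TE).
Local Notation Pi := (Pi_rel EQ l).
Variable S : prodS (TS B) (TS B) -> Prop.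
Hypothesis HS1 : is_subbundle PB Pi S.
Hypothesis HS2 : forall n, S n ->
  maximal_isotropic PB (cpair cP) n (fun x => Pi x /\ vproj PB x = n).

Hypothesis HS3 : forall e1 e2, section PB e1 -> section PB e2 ->
  (forall n, S n -> Pi (e1 n)) -> (forall n, S n -> Pi (e2 n)) ->
  forall n, S n -> Pi (cbr cP e1 e2 n).

Let HTE := tangent_vbundle HT.
Let HTP := tangent_pairing HT.
Let HPB := prod_vbundle HPr.

Definition pull (u v : TS B -> TS E) : prodS (TS B) (TS B) -> prodS (TS E) (TS E) :=
  fun n => (u n.1, v n.2).

Lemma pull_section u v : section TE u -> section TE v -> section PB (pull u v).
Proof.
move=> Hu Hv; split=> [|n]; last exact: (vproj_pull _ Hu Hv).
apply: (smooth_pair (vb_closedM HPB)).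
  by move=> f Hf; have [H _] := Hu; exact: (smooth_fst (H f Hf)).
by move=> f Hf; have [H _] := Hv; exact: (smooth_snd (H f Hf)).
Qed.

Lemma pull_bracket u v u' v' : section TE u -> section TE v ->
  section TE u' -> section TE v' ->
  (forall n, S n -> Pi (pull u v n)) -> (forall n, S n -> Pi (pull u' v' n)) ->
  forall n, S n -> Pi (cbr cT u u' n.1, cbr cT v v' n.2).
Proof.
move=> Hu Hv Hu' Hv' H H' n Sn.
have := HS3 (pull_section Hu Hv) (pull_section Hu' Hv') H H' Sn.
by have [_ _ _ ->] := HPr.
Qed.

Section Brackets.
Variables (tau1 tau2 tau12 : M -> C) (e1 e2 : B -> E).
Hypotheses (Ht1 : section CM tau1) (Ht2 : section CM tau2).
Hypotheses (He1 : is_dual D K L tau1 e1) (He2 : is_dual D K L tau2 e2).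
Hypothesis Ht12 : section CM tau12.
Hypothesis Hbr : cbr c e1 (core_section D tau2) = core_section D tau12.

Let Htd1 := core_section_section HD Ht1.
Let Htd2 := core_section_section HD Ht2.
Let Htd12 := core_section_section HD Ht12.
Let HC : is_degenerate_courant EB c. Proof. by case: HVC => _ _ []. Qed.

Let br_section u v : section EB u -> section EB v -> section EB (cbr c u v).
Proof. by have [[_ _ _ [H _ _] _] _] := HC; exact: H. Qed.

Lemma core_zero_pair q : cpair c (core_section D tau12 (vzero BM (vproj QM q)))
  (vzero EQ q) = ell D ev tau12 q.
Proof.
have [_ pt] := Ht12.
rewrite core_sectionE (vproj0 HBM) -{1}(pt (vproj QM q)) (core_at0 HD).
rewrite (pairC HP) ?(pair_core0 HD HMe) ?pt//.
by rewrite (projEB_core HD) (projEB_zeroQ HD) pt.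
Qed.

Lemma dual_bracket k : sfun k ->
  (forall b, cpair c (e1 b) (e1 b) = tval (rhoB b) k) ->
  is_dual D K L tau12 (cbr c e1 e2).
Proof.
move=> Hk ek; have Hb := br_section He1.1 He2.1; split=> // x.
have := cross_Tmap_dual HVC HVA HT HPr HS1 HS2 x Hb Htd12.
rewrite /rho_fun => ->; first by congr tval; apply/funext => q; exact: core_zero_pair.
have [_ /(_ _ _ He1.1 He2.1)[_ [[_ b2 _ _] _]]] := HT.
have [_ /(_ _ _ He1.1 Htd2)[_ [[b1 _ _ _] _]]] := HT.
(* In both components the pair is a bracket of members: [T e1, e2^times] on the left and
   [T e1, T tau2^dagger] on the right. *)
rewrite -b2 -Hbr -b1; apply: pull_bracket.
- exact: (Tmap_section HEB He1.1).
- exact: (Tmap_section HEB He1.1).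
- exact: (cross_section HEB HT He2.1).
- exact: (Tmap_section HEB Htd2).
- by move=> n Sn; exact: (W_member HVC HVA HT HPr HS2 Ht1 He1 Hk ek Sn).
- by move=> n Sn; exact: (x_member HVC HVA HT HPr HS2 Ht2 He2 Sn).
Qed.

(** The bracket of (e1^times, T tau1^dagger) with (T tau2^dagger, e2^times) has both components of
    cross type. Its membership compares [e1, tau2^dagger] with [tau1^dagger, e2] over the zero of B,
    and so relates tau1 and tau2 in opposite roles. *)
Lemma dual_bracket_sym q : ell D ev tau12 q =
  cpair c (cbr c (core_section D tau1) e2 (vzero BM (vproj QM q))) (vzero EQ q).
Proof.
have Hb := br_section Htd1 He2.1.
have := cross_cross_dual HVC HVA HT HPr HS1 HS2 (vzero EQ q) Htd12 Hb.
rewrite (projEB_zeroQ HD) (vproj0 HEQ) (vproj0 HBM) core_zero_pair.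
apply; rewrite -Hbr.
have [_ /(_ _ _ Htd1 He2.1)[_ [[_ b2 _ _] _]]] := HT.
have [_ /(_ _ _ He1.1 Htd2)[_ [[_ _ b1 _] _]]] := HT.
rewrite -b2 -b1; apply: pull_bracket.
- exact: (cross_section HEB HT He1.1).
- exact: (Tmap_section HEB Htd1).
- exact: (Tmap_section HEB Htd2).
- exact: (cross_section HEB HT He2.1).
- by move=> n Sn; exact: (x_member HVC HVA HT HPr HS2 Ht1 He1 Sn).
- by move=> n Sn; exact: (y_member HVC HVA HT HPr HS2 Ht2 He2 Sn).
Qed.

End Brackets.

Local Notation base b := (base_point D L b).

(* The anchor of a section of the Dirac structure annihilates the functions [F]
   that vanish on S: bracket with the section [F z], which is zero on S, where
   [z = (u^times, 0)]. *)
Lemma tangency (x : prodS (TS B) (TS B) -> prodS (TS E) (TS E)) F u xi :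
  section PB x -> (forall n, S n -> Pi (x n)) -> sfun F ->
  (forall n, S n -> F n = 0) -> section EB u ->
  cpair c (u (vproj EB xi)) xi <> 0 ->
  tval (canchor cP (x (base (vproj EB xi)))) F = 0.
Proof.
move=> Hx Px HF F0 Hu u0; have H0 := vzero_section HTE.
have Hz := pull_section (cross_section HEB HT Hu) H0.
set z := pull _ _ in Hz.
have HFz := sscale_section HPB HF Hz.
have PFz n : S n -> Pi (sscale PB F z n).
  move=> Sn; have [[_ [] + _ _ _ _] _] := HS2 Sn.
  by rewrite /sscale F0// (vscale0 HPB) (vproj_pull _ (cross_section HEB HT Hu) H0).
set n := base _; have Sn : S n := S_base HVC HVA HS1 _.
have [[[[_ _ _ [Hbs _ _] _] [_ _ _ _ Hleib]] _] _ _ _] := HPr.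
have Pbr := HS3 Hx HFz Px PFz Sn.
rewrite (Hleib _ _ Hx Hz _ HF) /sadd /sscale (F0 _ Sn) in Pbr.
move: Pbr; set r := tval _ _ => Pbr.
have [_ pbr] := Hbs _ _ Hx Hz; have [_ pz] := Hz.
have pzn : vproj PB (vscale PB r (z n)) = n by rewrite (vprojZ HPB) pz.
rewrite (vscale0 HPB) pbr (vadd0x HPB pzn) in Pbr.
have Ez : vscale PB r (z n) =
    (vscale TE r (cross EB u n.1), vscale TE r (vzero TE n.2)) by [].
rewrite Ez in Pbr pzn.
have H1 := Pi_zero_iso HVC HVA HPr HS1 HS2 Pbr pzn.
have pc : vproj TE (cross EB u n.1) = vproj TE (vzero (tangent_vb E) xi).
  rewrite (vproj_cross HEB _ Hu); apply: esym.
  exact: (f_equal (fun p : prodS (TS B) (TS B) => p.1) (vproj_Pi_zero HVC HVA xi)).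
have p2 : vproj TE (Tmap (vzero EQ) (rho xi)) = n.2.
  exact: (f_equal (fun p : prodS (TS B) (TS B) => p.2) (vproj_Pi_zero HVC HVA xi)).
have H2 : r * cpair c (u (vproj EB xi)) xi = 0.
  rewrite -(cross_base1 HVC HVA HT xi Hu); apply: etrans (esym (pairZl HTP r pc)) _.
  apply: etrans H1 _.
  apply: etrans (f_equal (fun v => cpair cT v _) (vscale_zero HTE r _)) _.
  exact: (pair0l HTE HTP p2).
by move/eqP: H2; rewrite mulf_eq0 => /orP[/eqP//|/eqP].
Qed.

Lemma anchor_cross_Tmap e v b F : section EB e -> section EB v -> sfun F ->
  tval (canchor cP (pull (cross EB e) (Tmap v) (base b))) F =
  tval (vlift (tangent_vb B) (base b).1 (canchor c (e b))) (fun s => F (s, (base b).2)) +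
  tval (canchor cT (Tmap v (base b).2)) (fun s => F ((base b).1, s)).
Proof.
move=> He Hv HF; have [_ _ H _] := HPr; apply: etrans (H _ _ HF) _.
have [_ /(_ _ _ He Hv)[_ [_ [_ Hc]]]] := HT.
have [_ p1] := cross_section HEB HT He; have [_ p2] := Tmap_section HEB Hv.
apply: f_equal2.
  apply: (f_equal2 (fun w G => tval w G)).
    by apply: etrans (Hc _) _; rewrite tpt_tzero.
  by apply/funext => s; exact: (f_equal (fun w : TS B => F (s, w)) (p2 _)).
apply: (f_equal (tval _)); apply/funext => s.
exact: (f_equal (fun w : TS B => F (w, s)) (p1 _)).
Qed.

End Involutivity.

Section LieForm.
Variables (R : realType) (A N : smoothSpace R) (V : vb_ops A N) (l : lie_ops A N).
Hypothesis HL : is_lie_algebroid V l.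
Local Notation rho := (lanchor l).
Let HV := la_vb HL.
Variable lam : A -> R.
Hypothesis Hlam : lin_fun V lam.

(* The Lie algebroid differential of the one-form [lam], up to sign. *)
Definition dlie (a b : N -> A) n := tval (rho (a n)) (fun m => lam (b m)) -
  tval (rho (b n)) (fun m => lam (a m)) + lam (lbr l b a n).

Let lam_sec s : section V s -> sfun (fun m => lam (s m)).
Proof. by case=> Hs _; case: Hlam => Hl _; exact: Hs _ Hl. Qed.

Lemma dlieC a b n : section V a -> section V b -> dlie a b n = - dlie b a n.
Proof.
move=> Ha Hb; have [_ [H _ _ _]] := HL; rewrite /dlie (H _ _ Ha Hb).
by rewrite /sscale (fl_Z _ _ Hlam.2); ring.
Qed.

Lemma dlieD a a' b n : section V a -> section V a' -> section V b ->
  dlie (sadd V a a') b n = dlie a b n + dlie a' b n.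
Proof.
move=> Ha Ha' Hb; have [[_ _ [_ HD _]] _] := HL.
have [_ pa] := Ha; have [_ pa'] := Ha'.
have paa m : vproj V (a m) = vproj V (a' m) by rewrite pa pa'.
have [Hf fl] := Hlam; have Hr := (rho_fun_lin HL (lam_sec Hb)).2.
rewrite /dlie (HD _ _ _ Ha Ha' Hb).2 /sadd (fl_D fl); last first.
  by have [_ ->] := la_br_section HL Hb Ha; have [_ ->] := la_br_section HL Hb Ha'.
have -> : tval (rho (vadd V (a n) (a' n))) (fun m => lam (b m)) =
    tval (rho (a n)) (fun m => lam (b m)) + tval (rho (a' n)) (fun m => lam (b m)).
  exact: (fl_D Hr).
under [X in tval (rho (b n)) X]eq_fun do rewrite (fl_D fl)//.
by rewrite (tvalD _ (lam_sec Ha) (lam_sec Ha')); ring.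
Qed.

Lemma dlieZ f a b n : sfun f -> section V a -> section V b ->
  dlie (sscale V f a) b n = f n * dlie a b n.
Proof.
move=> Hf Ha Hb; have [_ [_ _ HZ _]] := HL.
have [_ pa] := Ha; have [_ pb] := Hb.
have [_ fl] := Hlam; have Hr := (rho_fun_lin HL (lam_sec Hb)).2.
rewrite /dlie (HZ _ _ Hb Ha _ Hf) /sadd /sscale (fl_D fl); last first.
  by rewrite !(vprojZ HV) pa; have [_ ->] := la_br_section HL Hb Ha.
have -> : tval (rho (vscale V (f n) (a n))) (fun m => lam (b m)) =
    f n * tval (rho (a n)) (fun m => lam (b m)).
  exact: (fl_Z _ _ Hr).
under [X in tval (rho (b n)) X]eq_fun do rewrite (fl_Z _ _ fl).
rewrite (tvalM _ Hf (lam_sec Ha)) !(fl_Z _ _ fl) (tpt_rho HL) pb; ring.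
Qed.

Lemma dlie_local a a' b n : section V a -> section V a' -> section V b ->
  a n = a' n -> dlie a b n = dlie a' b n.
Proof.
move=> Ha Ha' Hb; apply: (pointwise HV (F := fun s => dlie s b n)) => //.
  by move=> s1 s2 H1 H2; exact: dlieD.
by move=> f s Hf Hs; exact: dlieZ.
Qed.

Lemma dlie_local2 a a' b b' n : section V a -> section V a' -> section V b ->
  section V b' -> a n = a' n -> b n = b' n -> dlie a b n = dlie a' b' n.
Proof.
move=> Ha Ha' Hb Hb' aa bb; rewrite (dlie_local Ha Ha' Hb aa) dlieC//.
by rewrite (dlie_local Hb Hb' Ha' bb) -dlieC.
Qed.

End LieForm.

(** * Differentials of linear forms on B and of their pullbacks to E -> Q *)

Section VBAlgebroidForm.
Variables (R : realType) (E Q B C M : smoothSpace R) (D : dvb_ops E Q B C M).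
Variable L : vb_algebroid_ops E Q B M.
Hypothesis HVA : is_vb_algebroid D L.
Local Notation EQ := (dEQ D).
Local Notation EB := (dEB D).
Local Notation QM := (dQM D).
Local Notation BM := (dBM D).
Local Notation CM := (dCM D).
Local Notation l := (va_lie L).
Local Notation rho := (lanchor l).
Local Notation rhoB := (lanchor (va_base L)).
Local Notation brB := (lbr (va_base L)).
Let HD : is_dvb D. Proof. by case: HVA. Qed.
Let HL := lac_lie HVA.
Let HEQ := dvb_EQ HD.
Let HEB := dvb_EB HD.
Let HQM := dvb_QM HD.
Let HBM := dvb_BM HD.
Let HCM := dvb_CM HD.
Let HM := vb_closedM HBM.
Let HQ := vb_closedM HEQ.

Lemma rhoB_lin F : sfun F -> lin_fun BM (rho_fun (va_base L) F).
Proof.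
move=> HF; have [_ _ [_ _ [Hs _ Hp HDm HZ] _] _ _] := HVA.
split; first exact: (Hs _ (sfun_tval HF)).
split=> [x y xy|t x]; rewrite /rho_fun.
  rewrite (HDm _ _ xy) (tval_tadd HM)//.
  exact: etrans (Hp x) (etrans xy (esym (Hp y))).
by rewrite HZ (tval_tscale HM).
Qed.

Variable Sg : Q -> B -> E.
Hypothesis HS : is_splitting D Sg.
Local Notation sigma b := (sigmaB D Sg b).

Lemma sigmaB_linear b : section BM b -> linear_section (flip D) (sigma b) b.
Proof.
move=> Hb; have [Hbs pb] := Hb; split=> //; first exact: (sigmaB_section HD HS).
have Hsb := sigmaB_section HD HS Hb.
have qb q : vproj QM q = vproj BM (b (vproj QM q)) by rewrite pb.
split=> //; first by case: Hsb.
- by move=> q; have [_ ->] := split_proj HS (qb q).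
- move=> x y xy; rewrite /sigmaB /= (vprojD HQM)// xy (split_DB HS) ?pb//.
- by move=> t x; rewrite /sigmaB /= (vprojZ HQM) (split_ZB HS)// pb.
Qed.

Lemma brB_linear b b' : section BM b -> section BM b' ->
  linear_section (flip D) (lbr l (sigma b) (sigma b')) (brB b b').
Proof.
move=> Hb Hb'; have [_ _ _ _ H] := HVA.
exact: H (sigmaB_linear Hb) (sigmaB_linear Hb').
Qed.

Lemma brB_section b b' : section BM b -> section BM b' -> section BM (brB b b').
Proof. by move=> Hb Hb'; case: (brB_linear Hb Hb'). Qed.

Lemma projEB_br b b' q : section BM b -> section BM b' ->
  vproj EB (lbr l (sigma b) (sigma b') q) = brB b b' (vproj QM q).
Proof. by move=> Hb Hb'; case: (brB_linear Hb Hb') => _ _ [_ _ H _ _]; exact: H. Qed.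

Lemma projEB_sigma b q : section BM b -> vproj EB (sigma b q) = b (vproj QM q).
Proof.
move=> [_ pb]; have qb : vproj QM q = vproj BM (b (vproj QM q)) by rewrite pb.
by case: (split_proj HS qb).
Qed.

Lemma brB_anti b b' : section BM b -> section BM b' ->
  brB b b' = sscale BM (fun=> -1) (brB b' b).
Proof.
move=> Hb Hb'; apply/funext => m.
rewrite -{1}(vproj0 HQM m) -(projEB_br _ Hb Hb').
have [_ [H _ _ _]] := HL.
rewrite (H _ _ (sigmaB_section HD HS Hb) (sigmaB_section HD HS Hb')) /sscale.
by rewrite (projEB_Z HD) (projEB_br _ Hb' Hb) (vproj0 HQM).
Qed.

Variable ell : B -> R.
Hypothesis Hell : lin_fun BM ell.

Lemma ell_proj_lin : lin_fun EQ (fun x => ell (vproj EB x)).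
Proof.
have [Hl fl] := Hell; split; first exact: (vproj_smooth HEB).
split=> [x y xy|t x].
  by rewrite (projEB_D HD)// (fl_D fl)// !(proj_proj HD) xy.
by rewrite (projEB_Z HD) (fl_Z _ _ fl).
Qed.
Let Hlam := ell_proj_lin.
Local Notation lam := (fun x => ell (vproj EB x)).

(** The expression [dlie] for B. The bracket on B is given through linear sections of E -> Q, so
    skew-symmetry and tensoriality of this expression are derived from those of [dlie] on E. *)
Definition dbase (a b : M -> B) m := tval (rhoB (a m)) (fun n => ell (b n)) -
  tval (rhoB (b m)) (fun n => ell (a n)) + ell (brB b a m).

Let ell_sec b : section BM b -> sfun (fun n => ell (b n)).
Proof. by case=> Hb _; case: Hell => Hl _; exact: Hb _ Hl. Qed.

Lemma dlie_sigma a b q : section BM a -> section BM b ->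
  dlie l lam (sigma a) (sigma b) q = dbase a b (vproj QM q).
Proof.
move=> Ha Hb; rewrite /dlie /dbase projEB_br//.
have F1 b' x : section BM b' -> tval (rho x) (fun q => ell (vproj EB (sigma b' q))) =
    tval (rhoB (vproj EB x)) (fun n => ell (b' n)).
  move=> Hb'; rewrite -(rho_base HVA); last exact: ell_sec.
  by congr tval; apply/funext => r; rewrite projEB_sigma.
by rewrite !F1// !projEB_sigma.
Qed.

Lemma dbase_smooth a b : section BM a -> section BM b -> sfun (dbase a b).
Proof.
move=> Ha Hb; have H1 a' b' : section BM a' -> section BM b' ->
    sfun (fun m => tval (rhoB (a' m)) (fun n => ell (b' n))).
  by move=> [Ha' _] Hb'; exact: Ha' _ (rhoB_lin (ell_sec Hb')).1.
apply: (sfun_add HM); last exact: (ell_sec (brB_section Hb Ha)).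
by apply: (sfun_sub HM); exact: H1.
Qed.

Let core_br chi tau : section CM tau ->
  (exists b, section BM b /\ chi = sigma b) \/
  (exists2 tau', section CM tau' & chi = core_section (flip D) tau') ->
  forall q, lam (lbr l chi (core_section (flip D) tau) q) = 0.
Proof.
have [_ _ _ [_ H1 H2] _] := HVA; have [_ fl] := Hell.
move=> Ht [[b [Hb ->]]|[tau' Ht' ->]] q.
  have [tau'' [_ pt] ->] := H1 _ _ _ (sigmaB_linear Hb) Ht.
  by rewrite core_sectionQE (projEB_core_atQ HD) ?pt// (fl_0 HBM _ fl).
by rewrite H2// (projEB_zeroQ HD) (fl_0 HBM _ fl).
Qed.

Let lam_core tau : section CM tau ->
  (fun q => lam (core_section (flip D) tau q)) = fun=> 0.
Proof.
move=> [_ pt]; apply/funext => q; have [_ fl] := Hell.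
by rewrite core_sectionQE (projEB_core_atQ HD) ?pt// (fl_0 HBM _ fl).
Qed.

Let rho_core tau b q : section CM tau -> section BM b ->
  tval (rho (core_section (flip D) tau q)) (fun q => lam (sigma b q)) = 0.
Proof.
move=> Ht Hb; rewrite (_ : (fun q => _) = fun q => ell (b (vproj QM q))); last first.
  by apply/funext => r; rewrite projEB_sigma.
have [_ pt] := Ht.
apply: etrans (rho_base HVA _ (ell_sec Hb)) _.
rewrite core_sectionQE (projEB_core_atQ HD) ?pt//.
exact: (fl_0 HBM _ (rhoB_lin (ell_sec Hb)).2).
Qed.

Lemma dlie_sigma_core b tau q : section BM b -> section CM tau ->
  dlie l lam (sigma b) (core_section (flip D) tau) q = 0.
Proof.
move=> Hb Ht; rewrite (dlieC HL Hlam); last 2 first.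
- exact: (sigmaB_section HD HS).
- exact: (core_sectionQ_section HD).
rewrite /dlie (rho_core _ Ht Hb) lam_core// (tval_cst HQ) subr0 add0r.
by rewrite core_br ?oppr0//; left; exists b.
Qed.

Lemma dlie_core_core tau tau' q : section CM tau -> section CM tau' ->
  dlie l lam (core_section (flip D) tau) (core_section (flip D) tau') q = 0.
Proof.
move=> Ht Ht'; rewrite /dlie !lam_core// !(tval_cst HQ) subr0 add0r.
by rewrite core_br//; right; exists tau'.
Qed.

Lemma split_section a a' q : section EQ a -> section BM a' ->
  vproj EB (a q) = a' (vproj QM q) -> exists2 tau, section CM tau &
    a q = sadd EQ (sigma a') (core_section (flip D) tau) q.
Proof.
move=> [_ pa] [_ pa'] Ea; have [t pt Et] := split_decomp HD HS (a q).
have [tau Ht tq] := section_through HCM t; exists tau => //.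
have [_ ptau] := Ht.
have mq : vproj CM t = vproj QM q by rewrite pt (proj_proj HD) pa.
rewrite Et /sadd /sigmaB core_sectionQE -Ea -mq tq pa.
set y := Sg q _; have [p1 p2] : vproj EQ y = q /\ vproj EB y = vproj EB (a q).
  by apply: (split_proj HS); rewrite (proj_proj HD) pa.
rewrite -{1}p2 (add_core_at HD) ?p1//.
Qed.

(** The differential commutes with pullback along E -> B. By tensoriality a and b may be replaced by
    linear lifts plus core sections; the pulled back form vanishes on core sections, and every term
    that contains one is zero. *)
Lemma dlie_proj a b a' b' q : section EQ a -> section EQ b ->
  section BM a' -> section BM b' ->
  vproj EB (a q) = a' (vproj QM q) -> vproj EB (b q) = b' (vproj QM q) ->
  dlie l lam a b q = dbase a' b' (vproj QM q).
Proof.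
move=> Ha Hb Ha' Hb' /(split_section Ha Ha')[tau Ht Ea].
move=> /(split_section Hb Hb')[tau' Ht' Eb].
have Hsa := sigmaB_section HD HS Ha'; have Hsb := sigmaB_section HD HS Hb'.
have Hta := core_sectionQ_section HD Ht; have Htb := core_sectionQ_section HD Ht'.
have Hsab := sadd_section HEQ Hsb Htb; have Hsaa := sadd_section HEQ Hsa Hta.
rewrite (dlie_local2 HL Hlam Ha Hsaa Hb Hsab Ea Eb).
have X s : section EQ s -> dlie l lam s (sadd EQ (sigma b') (core_section (flip D) tau')) q =
    dlie l lam s (sigma b') q + dlie l lam s (core_section (flip D) tau') q.
  move=> Hs; rewrite (dlieC HL Hlam q Hs Hsab) (dlieD HL Hlam q Hsb Htb Hs) opprD.
  by rewrite -(dlieC HL Hlam q Hs Hsb) -(dlieC HL Hlam q Hs Htb).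
rewrite (dlieD HL Hlam _ Hsa Hta Hsab) (X _ Hsa) (X _ Hta) dlie_sigma//.
rewrite dlie_sigma_core// dlie_core_core// (dlieC HL Hlam q Hta Hsb).
by rewrite dlie_sigma_core// oppr0 !addr0.
Qed.

Lemma dbaseC a b m : section BM a -> section BM b -> dbase a b m = - dbase b a m.
Proof.
move=> Ha Hb; rewrite /dbase (brB_anti Hb Ha) /sscale (fl_Z _ _ Hell.2); ring.
Qed.

(** The sum over Q of two linear lifts projects to the sum in B, so additivity is inherited from
    [dlie] at the zero of Q over m. *)
Lemma dbaseD a a' b m : section BM a -> section BM a' -> section BM b ->
  dbase (sadd BM a a') b m = dbase a b m + dbase a' b m.
Proof.
move=> Ha Ha' Hb; have Haa := sadd_section HBM Ha Ha'.
have Hsa := sigmaB_section HD HS Ha; have Hsa' := sigmaB_section HD HS Ha'.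
have Hsb := sigmaB_section HD HS Hb; have [_ pa] := Ha; have [_ pa'] := Ha'.
rewrite -{1}(vproj0 HQM m).
rewrite -(dlie_proj (a := sadd EQ (sigma a) (sigma a')) (b := sigma b))//.
- by rewrite (dlieD HL Hlam)// !dlie_sigma// (vproj0 HQM).
- exact: sadd_section.
- rewrite /sadd (projEB_D HD) ?projEB_sigma//.
  by case: Hsa => _ ->; case: Hsa' => _ ->.
- exact: projEB_sigma.
Qed.

Lemma dbaseZ f a b m : sfun f -> section BM a -> section BM b ->
  dbase (sscale BM f a) b m = f m * dbase a b m.
Proof.
move=> Hf Ha Hb; have Hfa := sscale_section HBM Hf Ha.
have Hsa := sigmaB_section HD HS Ha; have Hsb := sigmaB_section HD HS Hb.
have Hfq : sfun (fun q => f (vproj QM q)) by exact: vproj_smooth.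
rewrite -{1}(vproj0 HQM m).
rewrite -(dlie_proj (a := sscale EQ (fun q => f (vproj QM q)) (sigma a)) (b := sigma b))//.
- by rewrite (dlieZ HL Hlam)// !dlie_sigma// (vproj0 HQM).
- exact: sscale_section.
- by rewrite /sscale (projEB_Z HD) projEB_sigma.
- exact: projEB_sigma.
Qed.

(** Writes the form as a smooth expression in the two points a(m) and b(m) of B, as needed for a
    function on TB x TB. *)
Lemma dbase_frame k (g : 'I_k -> B -> R) (e : 'I_k -> M -> B) a b m :
  (forall i, section BM (e i)) -> section BM a -> section BM b ->
  lincomb BM m (\row_i g i (a m)) e = a m -> lincomb BM m (\row_i g i (b m)) e = b m ->
  dbase a b m = \sum_i \sum_j g i (b m) * g j (a m) * dbase (e j) (e i) m.
Proof.
move=> He Ha Hb Ea Eb.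
have D1 s : section BM s -> dbase a s m = \sum_j g j (a m) * dbase (e j) s m.
  move=> Hs; have HF1 s1 s2 H1 H2 := @dbaseD s1 s2 s m H1 H2 Hs.
  have HF2 f s1 Hf H1 := @dbaseZ f s1 s m Hf H1 Hs.
  have Hg i : @sfun R M (fun=> g i (a m)) by exact: sfun_cst HM _.
  rewrite -(tensor_lincomb HBM HF1 HF2 Hg He).
  by apply: (pointwise HBM HF1 HF2) => //; exact: lincomb_section.
have D2 s : section BM s -> dbase s b m = \sum_i g i (b m) * dbase s (e i) m.
  move=> Hs; have HF1 s1 s2 H1 H2 := @dbaseD s1 s2 s m H1 H2 Hs.
  have HF2 f s1 Hf H1 := @dbaseZ f s1 s m Hf H1 Hs.
  have Hg i : @sfun R M (fun=> g i (b m)) by exact: sfun_cst HM _.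
  rewrite dbaseC//; under eq_bigr do rewrite dbaseC// mulrN.
  rewrite sumrN -(tensor_lincomb HBM HF1 HF2 Hg He); congr (- _).
  by apply: (pointwise HBM HF1 HF2) => //; exact: lincomb_section.
rewrite D1//; under eq_bigr do rewrite D2// mulr_sumr.
rewrite exchange_big; apply: eq_bigr => i _; apply: eq_bigr => j _.
by rewrite mulrA (mulrC (g j _)).
Qed.

End VBAlgebroidForm.

Section Locality.
Variables (R : realType) (X : smoothSpace R).
Hypothesis HX : smooth_closed X.

Lemma tval_local (v : tvec X) f (U : X -> Prop) : sopen U -> U (tpt v) -> sfun f ->
  (forall x, U x -> f x = 0) -> tval v f = 0.
Proof.
move=> HU Uv Hf f0; have [chi [Hchi [W [HW Wv W1]] chi0]] := bump HX HU Uv.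
have E0 : (fun x => chi x * f x) = fun=> 0.
  apply/funext => x; have [Ux|[N1 [_ Nx N0]]] := chi0 x; first by rewrite f0 ?mulr0.
  by rewrite N0// mul0r.
have := tvalM v Hchi Hf; rewrite E0 tval_cst// f0// (W1 _ Wv).2.
by rewrite mulr0 add0r mul1r => <-.
Qed.

Hypothesis HTX : smooth_closed (TS X).

Lemma tangent_vlift_affine (w x : TS X) f a b : tpt w = tpt x -> sfun f ->
  (forall t, f (vadd (tangent_vb X) w (vscale (tangent_vb X) t x)) = t * a + b) ->
  tval (vlift (tangent_vb X) w x) f = a.
Proof.
move=> wx Hf H; rewrite /vlift velE; apply: (vel_val HTX) => //; last first.
  by under eq_fun do rewrite H; exact: is_derive_affine.
have HR : smooth_closed (vspace R^o) := @vspace_closed R _.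
apply: (smooth_into_TS HR) => g Hg.
  by under eq_fun do rewrite tpt_tadd; exact: (sfun_cst HR).
under eq_fun do rewrite (tval_tadd HX) ?tpt_tscale// (tval_tscale HX)//.
apply: (sfun_add HR); first exact: (sfun_cst HR).
by apply: (sfun_mul HR); [exact: Cinf_id|exact: (sfun_cst HR)].
Qed.

End Locality.

(** * Tangency to the support and the map from the core to B *)

Section Tangency.
Variables (R : realType) (E Q B C M : smoothSpace R) (D : dvb_ops E Q B C M).
Variables (K : vb_courant_ops E Q B C M) (L : vb_algebroid_ops E Q B M).
Hypothesis HVC : is_vb_courant D K.
Hypothesis HVA : is_vb_algebroid D L.
Local Notation EQ := (dEQ D).
Local Notation EB := (dEB D).
Local Notation QM := (dQM D).
Local Notation BM := (dBM D).
Local Notation CM := (dCM D).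
Local Notation c := (vc_courant K).
Local Notation l := (va_lie L).
Local Notation rhoB := (lanchor (va_base L)).
Let HD := lac_dvb HVC.
Let HMe := lac_metric HVC.
Let HL := lac_lie HVA.
Let HEB := dvb_EB HD.
Let HQM := dvb_QM HD.
Let HBM := dvb_BM HD.
Let HCM := dvb_CM HD.
Let HB := vb_closedM HEB.
Let HM := vb_closedM HBM.
Variables (cT : courant_ops (TS E) (TS B)).
Variables (cP : courant_ops (prodS (TS E) (TS E)) (prodS (TS B) (TS B))).
Hypothesis HT : is_tangent_courant EB c cT.
Hypothesis HPr : is_product_courant (Tvb EB) (Tvb EB) (opp_courant (Tvb EB) cT) cT cP.
Local Notation TE := (Tvb EB).
Local Notation PB := (prod_vb TE TE).
Local Notation Pi := (Pi_rel EQ l).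
Variable S : prodS (TS B) (TS B) -> Prop.
Hypothesis HS1 : is_subbundle PB Pi S.
Hypothesis HS2 : forall n, S n ->
  maximal_isotropic PB (cpair cP) n (fun x => Pi x /\ vproj PB x = n).

Hypothesis HS3 : forall e1 e2, section PB e1 -> section PB e2 ->
  (forall n, S n -> Pi (e1 n)) -> (forall n, S n -> Pi (e2 n)) ->
  forall n, S n -> Pi (cbr cP e1 e2 n).

Let HTE := tangent_vbundle HT.
Let HPB := prod_vbundle HPr.

(** The case excluded in [tangency]. Nondegeneracy makes the fibre of E over b zero, so the core
    fibre is zero as well, and by local triviality the core vanishes near the base point. *)
Lemma trivial_fibre b : (forall u xi, section EB u -> vproj EB xi = b ->
    cpair c (u b) xi = 0) ->
  (forall x, vproj EB x = b -> x = vzero EB b) /\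
  exists U, [/\ sopen U, U (vproj BM b) &
    forall t, U (vproj CM t) -> t = vzero CM (vproj CM t)].
Proof.
move=> H; have H1 x : vproj EB x = b -> x = vzero EB b.
  move=> xb; rewrite -xb; apply: (metric_nondegenerate HMe) => y yb.
  have [u Hu ux] := section_through HEB x.
  by rewrite -ux xb H// yb.
split=> //.
have C0 t : vproj CM t = vproj BM b -> t = vzero CM (vproj BM b).
  move=> tb; apply: (core_at_inj HD (b := b)); rewrite ?(vproj0 HCM)//.
  by rewrite [LHS]H1 ?[RHS]H1// (projEB_core_at HD) ?(vproj0 HCM).
exact: (zero_fibre_near HCM C0).
Qed.

(** Both relations are read off from a generator of Pi over n. In the second one the terms with d
    cancel, which leaves the differential of the pullback of ell. *)
Lemma S_values n : S n -> exists a b q,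
  [/\ section EQ a, section EQ b, tpt n.1 = vproj EB (b q), tpt n.2 = vproj EB (a q) &
   (forall f, sfun f -> tval n.1 (fun x => f (vproj BM x)) =
      rho_fun (va_base L) f (tpt n.2)) /\
   forall ell, lin_fun BM ell ->
     tval n.1 ell - tval n.2 ell = dlie l (fun x => ell (vproj EB x)) a b q].
Proof.
move=> Sn; have [a [b [d [q [Ha Hb Hd En]]]]] := S_witness HS2 Sn.
have E1 : n.1 = vproj TE (Pi1 EQ l a b d q) := f_equal (fun p => p.1) En.
have E2 : n.2 = vproj TE (Pi2 EQ l a b d q) := f_equal (fun p => p.2) En.
have Hp := vproj_smooth HEB.
have t2 : tpt n.2 = vproj EB (a q).
  by rewrite E2 [LHS]tpt_Tmap (tpt_Pi2 HL).
exists a, b, q; split=> //; first by rewrite E1 [LHS]tpt_Tmap (tpt_Pi1 HL).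
split=> [f Hf|ell Hell].
  have Hf' : sfun (fun x => f (vproj BM x)) by exact: (vproj_smooth HBM).
  rewrite t2 /rho_fun -(rho_base HVA)// E1 [LHS](tval_Tmap HB)//.
  rewrite -(Pi1_base HL q Ha Hb Hd); last exact: (vproj_smooth HQM).
  by congr tval; apply/funext => x; rewrite (proj_proj HD).
have Hlam := ell_proj_lin HVA Hell; have [Hl _] := Hell.
have V p : tval (vproj TE p) ell = tval p (fun x => ell (vproj EB x)).
  exact: (tval_Tmap HB _ Hp Hl).
have V1 := etrans (f_equal (fun w => tval w ell) E1) (V _).
have V2 := etrans (f_equal (fun w => tval w ell) E2) (V _).
apply: etrans (f_equal2 (fun x y => x - y) V1 V2) _.
apply: etrans (f_equal2 (fun x y => x - y) (Pi1_lin HL q Ha Hb Hd Hlam)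
  (Pi2_lin HL q Ha Hb Hd Hlam)) _.
by rewrite /dlie; ring.
Qed.

Variables (dB : C -> B) (tau : M -> C) (e : B -> E).
Hypothesis HdB : vb_morphism CM BM dB id.
Hypothesis Htau : section CM tau.
Hypothesis Theta_core' : forall tau, section CM tau -> forall b,
  canchor c (core_section D tau b) = vlift BM b (dB (tau (vproj BM b))).
Hypothesis He : is_dual D K L tau e.
Local Notation td := (core_section D tau).
Local Notation base b := (base_point D L b).
Let Htd := core_section_section HD Htau.

Let Theta_core := Theta_core' Htau.

Let pdB m : vproj BM (dB (tau m)) = m.
Proof. by have [_ _ H _ _] := HdB; rewrite H /=; case: Htau. Qed.

Lemma dB_section : section BM (fun m => dB (tau m)).
Proof.
split=> // f Hf; have [H _ _ _ _] := HdB; have [Ht _] := Htau.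
exact: Ht _ (H _ Hf).
Qed.

Lemma complete_pt v f : sfun f -> tval (canchor cT (Tmap td v)) (fun s : TS B => f (tpt s)) =
  tval (canchor c (td (tpt v))) f.
Proof.
move=> Hf; have [_ /(_ _ _ Htd Htd)[_ [_ [H _]]]] := HT.
by have [_ /(_ f Hf)[H1 H2]] := H v.
Qed.

Lemma complete_val v f : sfun f -> tval (canchor cT (Tmap td v)) (fun s : TS B => tval s f) =
  tval v (fun b => tval (canchor c (td b)) f).
Proof.
move=> Hf; have [_ /(_ _ _ Htd Htd)[_ [_ [H _]]]] := HT.
by have [_ /(_ f Hf)[H1 H2]] := H v.
Qed.

Lemma tangency_dual F xi u : sfun F -> (forall n, S n -> F n = 0) ->
  section EB u -> cpair c (u (vproj EB xi)) xi <> 0 ->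
  let b := vproj EB xi in
  tval (vlift (tangent_vb B) (base b).1 (canchor c (e b))) (fun s => F (s, (base b).2)) +
  tval (canchor cT (Tmap td (base b).2)) (fun s => F ((base b).1, s)) = 0.
Proof.
move=> HF F0 Hu u0 b; have Hp := pull_section HPr (cross_section HEB HT He.1) (Tmap_section HEB Htd).
apply: etrans (esym (anchor_cross_Tmap L HVC HT HPr b He.1 Htd HF)) _.
apply: (tangency HVC HVA HT HPr HS1 HS2 HS3 Hp _ HF F0 Hu u0) => n Sn.
exact: (x_member HVC HVA HT HPr HS2 Htau He Sn).
Qed.

Let HC : is_degenerate_courant EB c. Proof. by case: HVC => _ _ []. Qed.

Lemma tpt_Theta x : tpt (canchor c x) = vproj EB x.
Proof. by have [[_ [_ _ H _ _] _ _ _] _] := HC; exact: H. Qed.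

Lemma rhoQ_lin F : sfun F -> lin_fun QM (fun q => tval (vc_rhoQ K q) F).
Proof.
move=> HF; have [_ _ _ [_ _ [Hs _ Hp HDm HZ] _] _] := HVC.
split; first exact: (Hs _ (sfun_tval HF)).
split=> [x y xy|t x].
  rewrite (HDm _ _ xy) (tval_tadd HM)//.
  exact: etrans (Hp x) (etrans xy (esym (Hp y))).
by rewrite HZ (tval_tscale HM).
Qed.

Lemma dB_zero m : dB (vzero CM m) = vzero BM m.
Proof.
have [_ _ Hp _ HZ] := HdB.
rewrite -{1}(vproj0 HCM m) -(vscale0 HCM) HZ (vscale0 HBM) Hp.
by rewrite (vproj0 HCM).
Qed.

Lemma tpt_base2 b : tpt (base b).2 = vzero BM (vproj BM b).
Proof. by rewrite [LHS]tpt_Tmap (tpt_rhoB HVC HVA). Qed.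

Lemma anchor_compat m f : sfun f ->
  tval (rhoB (dB (tau m))) f = tval (vc_rhoQ K (vproj EQ (e (vzero BM m)))) f.
Proof.
move=> Hf; pose b := vzero BM m; have pb : vproj BM b = m by rewrite (vproj0 HBM).
have [tr|] := pselect (forall u xi, section EB u -> vproj EB xi = b -> cpair c (u b) xi = 0).
  have [H0 [U [_ Um Uz]]] := trivial_fibre tr.
  rewrite (H0 (e b)); last by case: He => -[_ ->].
  rewrite (projEQ_zero HD) (fl_0 HQM _ (rhoQ_lin Hf).2).
  have [_ pt] := Htau; rewrite (Uz (tau m)) pt -?pb// dB_zero.
  exact: (fl_0 HBM _ (rhoB_lin HVA Hf).2).
move=> /existsNP[u /existsNP[xi /not_implyP[Hu /not_implyP[xib u0]]]].
(* The first relation of [S_values] for f. Along the anchor at the base point over 0_m, its first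
   component contributes the anchor of e at 0_m applied to f, its second -rho_B(d_B tau) f. *)
pose F (n : prodS (TS B) (TS B)) := tval n.1 (fun x => f (vproj BM x)) -
  rho_fun (va_base L) f (tpt n.2).
have Hfp : sfun (fun x => f (vproj BM x)) by exact: (vproj_smooth HBM).
have [Hrf frf] := rhoB_lin HVA Hf.
have HF : sfun F.
  apply: (sfun_sub (vb_closedM HPB)).
    exact: (smooth_fst (sfun_tval Hfp)).
  exact: (smooth_snd (sfun_tpt Hrf)).
have F0 n : S n -> F n = 0.
  by move=> /S_values[a [b' [q [_ _ _ _ [H _]]]]]; rewrite /F H// subrr.
have := tangency_dual HF F0 Hu; rewrite -xib in u0 => /(_ _ u0); rewrite xib.
move=> AA; apply/eqP; rewrite eq_sym -subr_eq0; apply/eqP; apply: etrans _ AA.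
apply: f_equal2.
  rewrite -(Theta_base HVC _ Hf); apply: esym; apply: (tangent_vlift_affine HB
    (vb_closedM HTE) (b := - rho_fun (va_base L) f (tpt (base b).2))).
  - by rewrite tpt_tzero tpt_Theta; case: He => -[_ ->].
  - exact: (sfun_slice (vb_closedM HTE) _ HF).
  - move=> t; rewrite /F /= (tval_tadd HB)//; last first.
      by rewrite tpt_tscale tpt_tzero tpt_Theta; case: He => -[_ ->].
    by rewrite (tval_tzero HB) add0r (tval_tscale HB).
rewrite /F (tvalB (vb_closedM HTE)); last 2 first.
- exact: (sfun_cst (vb_closedM HTE)).
- exact: sfun_tpt.
rewrite (tval_cst (vb_closedM HTE)) sub0r complete_pt// Theta_core tpt_base2 pb.
by rewrite (vproj0 HBM) (vlift_lin HBM) ?(vproj0 HBM) ?pdB.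
Qed.

Lemma Theta_lin F : sfun F -> lin_fun EB (fun x => tval (canchor c x) F).
Proof.
move=> HF; have [[_ [Hs _ Hp HDm HZ] _ _ _] _] := HC.
split; first exact: (Hs _ (sfun_tval HF)).
split=> [x y xy|t x].
  rewrite (HDm _ _ xy) (tval_tadd HB)//.
  exact: etrans (Hp x) (etrans xy (esym (Hp y))).
by rewrite HZ (tval_tscale HB).
Qed.

Lemma Theta_core_lin b ell : lin_fun BM ell ->
  tval (canchor c (td b)) ell = ell (dB (tau (vproj BM b))).
Proof. by move=> [Hl fl]; rewrite Theta_core (vlift_lin HBM)// pdB. Qed.

Variable Sg : Q -> B -> E.
Hypothesis HS : is_splitting D Sg.
Local Notation dtau := (fun n => dB (tau n)).

(* The vector field [Theta e] on B is the linear vector field of the derivation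
   [dB tau, -]. *)
Lemma Theta_dual ell b m : lin_fun BM ell -> section BM b ->
  tval (canchor c (e (b m))) ell =
  tval (rhoB (b m)) (fun n => ell (dtau n)) + dbase L ell dtau b m.
Proof.
move=> Hell Hb; have [_ pb] := Hb; have Hdt := dB_section; have [Hl fl] := Hell.
have [_ pt] := Htau.
have Hld : sfun (fun n => ell (dtau n)) by case: Hdt => H _; exact: H _ Hl.
have [tr|] := pselect (forall u xi, section EB u -> vproj EB xi = b m ->
    cpair c (u (b m)) xi = 0).
  have [H0 [U [HU Um Uz]]] := trivial_fibre tr.
  have Uz' n : U n -> dtau n = vzero BM n.
    by move=> Un; rewrite (Uz (tau n)) pt ?dB_zero.
  rewrite (H0 (e (b m))); last by case: He => -[_ ->].
  rewrite (fl_0 HEB _ (Theta_lin Hl).2).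
  rewrite (tval_local HM HU _ Hld) => [||n Un]; last 2 first.
  - by rewrite (tpt_rhoB HVC HVA).
  - by rewrite Uz'// (fl_0 HBM _ fl).
  have HF1 s1 s2 H1 H2 := dbaseD HVA HS Hell m H1 H2 Hb (a := s1) (a' := s2).
  have HF2 f s1 Hf H1 := dbaseZ HVA HS Hell m Hf H1 Hb (f := f) (a := s1).
  rewrite add0r (pointwise HBM HF1 HF2 Hdt (vzero_section HBM)).
    by rewrite (tensor_zero HBM HF2).
  by apply: Uz'; rewrite -(pb m).
move=> /existsNP[u /existsNP[xi /not_implyP[Hu /not_implyP[xib u0]]]].
have [k [g [f [U [[[HU Hg Hf Hx _] _] Um]]]]] := exists_frame HBM m.
have [chi [Hchi [W [HW Wm W1]] chi0]] := bump HM HU Um.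
have [_ chi1] := W1 _ Wm.
pose Kij i j := dbase L ell (f j) (f i).
have HK i j : sfun (Kij i j) by exact: (dbase_smooth HVA HS Hell).
(* The second relation of [S_values]: the differential of ell at the two feet is expanded in a frame
   by [dbase_frame], and chi makes the expansion valid globally. *)
pose F (n : prodS (TS B) (TS B)) :=
  chi (vproj BM (tpt n.1)) * (tval n.1 ell - tval n.2 ell) -
  \sum_i \sum_j g i (tpt n.1) * g j (tpt n.2) *
     (chi (vproj BM (tpt n.1)) * Kij i j (vproj BM (tpt n.1))).
have H1 h : sfun h -> @sfun R (prodS (TS B) (TS B)) (fun n => h (tpt n.1)).
  by move=> Hh; exact: (smooth_fst (sfun_tpt Hh)).
have H2 h : sfun h -> @sfun R (prodS (TS B) (TS B)) (fun n => h (tpt n.2)).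
  by move=> Hh; exact: (smooth_snd (sfun_tpt Hh)).
have HPBM := vb_closedM HPB; have Hpr := vproj_smooth HBM.
have HF : sfun F.
  apply: (sfun_sub HPBM).
    apply: (sfun_mul HPBM); first exact: H1 _ (Hpr _ Hchi).
    apply: (sfun_sub HPBM); first exact: (smooth_fst (sfun_tval Hl)).
    exact: (smooth_snd (sfun_tval Hl)).
  apply: (sfun_sum HPBM) => i; apply: (sfun_sum HPBM) => j.
  apply: (sfun_mul HPBM).
    by apply: (sfun_mul HPBM); [exact: H1 _ (Hg i).1|exact: H2 _ (Hg j).1].
  by apply: (sfun_mul HPBM); [exact: H1 _ (Hpr _ Hchi)|exact: H1 _ (Hpr _ (HK i j))].
have F0 n : S n -> F n = 0.
  move=> /S_values[a [b' [q [Ha Hb' E1 E2 [_ /(_ _ Hell) E3]]]]].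
  rewrite /F E3; set m1 := vproj BM (tpt n.1).
  have [Um1|[N1 [_ Nm N0]]] := chi0 m1; last first.
    rewrite N0// mul0r big1 ?subrr// => i _; rewrite big1// => j _.
    by rewrite mul0r mulr0.
  have [_ pa] := Ha; have [_ pb'] := Hb'.
  have m1q : m1 = vproj QM q by rewrite /m1 E1 (proj_proj HD) pb'.
  have pq : vproj BM (vproj EB (a q)) = m1 by rewrite (proj_proj HD) pa.
  have pq' : vproj BM (vproj EB (b' q)) = m1 by rewrite (proj_proj HD) pb'.
  have [a1 Ha1 a1q] := section_through HBM (vproj EB (a q)).
  have [b1 Hb1 b1q] := section_through HBM (vproj EB (b' q)).
  rewrite pq in a1q; rewrite pq' in b1q.
  rewrite (dlie_proj HVA HS Hell Ha Hb' Ha1 Hb1) -?m1q// E1 E2.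
  rewrite (dbase_frame HVA HS Hell Hf Ha1 Hb1 (g := g)).
  - rewrite a1q b1q mulr_sumr; apply/eqP; rewrite subr_eq0; apply/eqP.
    apply: eq_bigr => i _; rewrite mulr_sumr; apply: eq_bigr => j _.
    by rewrite /Kij; ring.
  - by rewrite a1q -pq Hx// pq.
  - by rewrite b1q -pq' Hx// pq'.
have AA := tangency_dual HF F0 Hu; rewrite -xib in u0; have := AA xi u0.
rewrite {AA u0} xib => AA.
(* The sum in F with its first foot frozen at b(m), as a linear function of the second foot. It
   enters through the second component of the anchor, which evaluates it at d_B tau. *)
pose G y := \sum_i \sum_j g i (b m) * g j y * Kij i j m.
have HG : lin_fun BM G.
  split.
    apply: (sfun_sum HB) => i; apply: (sfun_sum HB) => j.
    apply: (sfun_mul HB); last exact: (sfun_cst HB).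
    by apply: (sfun_mul HB); [exact: (sfun_cst HB)|exact: (Hg j).1].
  split=> [x y xy|t x]; rewrite /G.
    rewrite -big_split /=; apply: eq_bigr => i _; rewrite -big_split /=.
    by apply: eq_bigr => j _; rewrite (fl_D (Hg j).2)//; ring.
  rewrite mulr_sumr; apply: eq_bigr => i _; rewrite mulr_sumr.
  by apply: eq_bigr => j _; rewrite (fl_Z _ _ (Hg j).2); ring.
have -> : dbase L ell dtau b m = G (dtau m).
  rewrite (dbase_frame HVA HS Hell Hf Hdt Hb (g := g))//.
    by have := Hx (dtau m); rewrite pdB; apply.
  by have := Hx (b m); rewrite pb; apply.
apply/eqP; rewrite -subr_eq0 opprD addrA -addrA; apply/eqP; apply: etrans _ AA.
have HTB := vb_closedM HTE.
apply: f_equal2.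
  apply: esym; apply: (tangent_vlift_affine HB HTB (b := F (vzero (tangent_vb B) (b m), (base (b m)).2))).
  - by rewrite tpt_tzero tpt_Theta; case: He => -[_ ->].
  - exact: (sfun_slice HTB _ HF).
  - move=> t; set r := tval (canchor c (e (b m))) ell.
    have key (w : TS B) : tpt w = b m -> tval w ell = t * r ->
        F (w, (base (b m)).2) = t * r + F (vzero (tangent_vb B) (b m), (base (b m)).2).
      move=> wt wv; rewrite /F [(w, _).1]/= [(vzero _ _, _).1]/= wt tpt_tzero pb chi1 wv.
      by rewrite (tval_tzero HB); ring.
    apply: key; first by rewrite tpt_tadd tpt_tzero.
    rewrite (tval_tadd HB)// ?(tval_tzero HB) ?add0r ?(tval_tscale HB)//.
    by rewrite tpt_tscale tpt_tzero tpt_Theta; case: He => -[_ ->].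
have -> : (fun s : TS B => F ((base (b m)).1, s)) = fun s : TS B => - tval s ell - G (tpt s).
  apply/funext => s; rewrite /F /= tpt_tzero pb chi1 mul1r (tval_tzero HB) sub0r.
  by congr (_ - _); apply: eq_bigr => i _; apply: eq_bigr => j _; rewrite mul1r.
rewrite (tvalB HTB); last 2 first.
- exact: (sfun_opp HTB (sfun_tval Hl)).
- exact: sfun_tpt HG.1.
rewrite complete_pt ?tpt_base2 ?pb; last exact: HG.1.
rewrite (Theta_core_lin _ HG) (vproj0 HBM); congr (_ - _).
have -> : (fun s : TS B => - tval s ell) = fun s : TS B => -1 * tval s ell.
  by apply/funext => s; rewrite mulN1r.
rewrite tvalZ; last exact: sfun_tval.
rewrite mulN1r complete_val// (tval_Tmap HB).
- by congr (- tval _ _); apply/funext => n; rewrite Theta_core_lin// (vproj0 HBM).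
- exact: (vzero_section HBM).1.
- under eq_fun do rewrite Theta_core_lin//.
  exact: (vproj_smooth HBM Hld).
Qed.

(** The anchor of [e, tau2^dagger], as a commutator of vector fields on B, is applied to ell at 0_m.
    One term is given by [anchor_compat]; the other differentiates the function of [Theta_dual]
    along the line t d_B tau2 and contributes the bracket of B. *)
Lemma dB_bracket tau2 tau12 m : section CM tau2 -> section CM tau12 ->
  cbr c e (core_section D tau2) = core_section D tau12 ->
  dB (tau12 m) = lbr (va_base L) dtau (fun n => dB (tau2 n)) m.
Proof.
move=> Ht2 Ht12 Hbr; have Htd2 := core_section_section HD Ht2.
have Hdt := dB_section; have [_ _ HpB _ _] := HdB.
have Hd2 : section BM (fun n => dB (tau2 n)).
  split=> [f Hf|n]; last by rewrite HpB /=; case: Ht2.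
  by have [H _ _ _ _] := HdB; have [Ht _] := Ht2; exact: Ht _ (H _ Hf).
have Hbb := brB_section HVA HS Hdt Hd2; have [_ pbb] := Hbb.
have [_ p12] := Ht12; have [_ p2] := Ht2.
apply: (lin_sep HBM) => [|ell Hell]; first by rewrite HpB /= p12 pbb.
have [Hl fl] := Hell.
have Hl2 : sfun (fun n => ell (dB (tau2 n))) by case: Hd2 => H _; exact: H _ Hl.
have Hl1 : sfun (fun n => ell (dtau n)) by case: Hdt => H _; exact: H _ Hl.
have Tc t b : section CM t -> tval (canchor c (core_section D t b)) ell =
    ell (dB (t (vproj BM b))).
  move=> Ht; rewrite (Theta_core' Ht) (vlift_lin HBM)// HpB /=.
  by case: Ht => _ ->.
have [_ [_ _ _ Hanc _]] := HC.
have := Hanc _ _ He.1 Htd2 _ (vzero BM m) Hl.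
rewrite Hbr Tc// (vproj0 HBM) => ->.
have -> : (fun b => tval (canchor c (core_section D tau2 b)) ell) =
    fun b => ell (dB (tau2 (vproj BM b))) by apply/funext => b; rewrite Tc.
have -> : tval (canchor c (e (vzero BM m))) (fun b => ell (dB (tau2 (vproj BM b)))) =
    tval (rhoB (dB (tau m))) (fun n => ell (dB (tau2 n))).
  by rewrite anchor_compat//; exact: (Theta_base HVC _ Hl2).
rewrite (Theta_core' Ht2) (vproj0 HBM).
have -> : tval (vlift BM (vzero BM m) (dB (tau2 m))) (fun b => tval (canchor c (e b)) ell) =
    tval (rhoB (dB (tau2 m))) (fun n => ell (dtau n)) +
    dbase L ell dtau (fun n => dB (tau2 n)) m.
  apply: (vlift_affine HBM (b := 0)).
  - by rewrite (vproj0 HBM) HpB /= p2.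
  - case: He => -[Hes _] _; exact: Hes _ (Theta_lin Hl).1.
  - move=> t; have Ht := sscale_section HBM (sfun_cst HM t) Hd2.
    rewrite (vadd0x HBM); last by rewrite (vprojZ HBM) HpB /= p2.
    rewrite addr0 mulrDr; apply: etrans (Theta_dual m Hell Ht) _.
    apply: f_equal2; first exact: (fl_Z _ _ (rhoB_lin HVA Hl1).2).
    rewrite (dbaseC HVA HS Hell m Hdt Ht) (dbaseZ HVA HS Hell m (sfun_cst HM t) Hd2 Hdt).
    by rewrite (dbaseC HVA HS Hell m Hd2 Hdt) mulrN opprK.
rewrite /dbase (brB_anti HVA HS Hdt Hd2) /sscale (fl_Z _ _ fl); ring.
Qed.

End Tangency.

(** * The bracket on the core *)

Section DualSections.
Variables (R : realType) (E Q B C M : smoothSpace R) (D : dvb_ops E Q B C M).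
Variables (K : vb_courant_ops E Q B C M) (L : vb_algebroid_ops E Q B M).
Hypothesis HVC : is_vb_courant D K.
Hypothesis HVA : is_vb_algebroid D L.
Local Notation EQ := (dEQ D).
Local Notation EB := (dEB D).
Local Notation QM := (dQM D).
Local Notation BM := (dBM D).
Local Notation CM := (dCM D).
Local Notation c := (vc_courant K).
Local Notation ev := (vc_ev K).
Local Notation l := (va_lie L).
Local Notation rho := (lanchor l).
Local Notation rhoB := (lanchor (va_base L)).
Let HD := lac_dvb HVC.
Let HMe := lac_metric HVC.
Let HL := lac_lie HVA.
Let HP := metric_pairing HMe.
Let HEQ := dvb_EQ HD.
Let HEB := dvb_EB HD.
Let HQM := dvb_QM HD.
Let HBM := dvb_BM HD.
Let HCM := dvb_CM HD.
Let HB := vb_closedM HEB.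
Let HM := vb_closedM HBM.
Variable Sg : Q -> B -> E.
Hypothesis HSg : is_lagrangian_splitting D (cpair c) Sg.
Let HS : is_splitting D Sg := HSg.1.
Variables (P : dorfman_rep Q B C M) (P' : two_rep Q B C M).
Hypothesis HPd : is_dorfman_rep D K Sg P.
Hypothesis HP' : is_two_rep D L Sg P'.
Local Notation dQ := (tr_dQ P').
Local Notation dB := (dr_dB P).
Local Notation Delta := (dr_Delta P).
Local Notation nablaC := (tr_nablaC P').
Local Notation nablaQ := (tr_nablaQ P').
Local Notation sigma b := (sigmaB D Sg b).
Local Notation tq tau := (core_section (flip D) tau).

Lemma dQ_morph : vb_morphism CM QM dQ id. Proof. by have [[H _] _ _ _ _] := HP'. Qed.
Lemma dB_morph : vb_morphism CM BM dB id. Proof. by have [[H _] _ _ _ _] := HPd. Qed.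

Lemma dQ_section tau : section CM tau -> section QM (fun m => dQ (tau m)).
Proof.
move=> [Ht pt]; have [H _ Hp _ _] := dQ_morph; split=> [f Hf|m].
  exact: Ht _ (H _ Hf).
by rewrite Hp.
Qed.

Lemma Theta_core tau : section CM tau -> forall b,
  canchor c (core_section D tau b) = vlift BM b (dB (tau (vproj BM b))).
Proof. by have [[_ H] _ _ _ _] := HPd; exact: H. Qed.

Lemma rho_core tau : section CM tau -> forall q,
  rho (tq tau q) = vlift QM q (dQ (tau (vproj QM q))).
Proof. by have [[_ H] _ _ _ _] := HP'; exact: H. Qed.

Let projC b tau m : section BM b -> section CM tau -> vproj CM (nablaC b tau m) = m.
Proof. by move=> Hb Ht; case: (nablaC_section HP' Hb Ht). Qed.

Lemma nablaC_br b tau : section BM b -> section CM tau ->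
  lbr l (sigma b) (tq tau) = tq (nablaC b tau).
Proof. by move=> Hb Ht; have [_ _ H _ _] := HP'; case: (H b tau Hb Ht). Qed.

Lemma tq0 t m : section CM t -> tq t (vzero QM m) = dcore D (t m).
Proof.
by move=> [_ pt]; rewrite core_sectionQE (vproj0 HQM) -{1}(pt m) (core_atQ0 HD).
Qed.

Lemma td0 t m : section CM t -> core_section D t (vzero BM m) = dcore D (t m).
Proof.
by move=> [_ pt]; rewrite core_sectionE (vproj0 HBM) -{1}(pt m) (core_at0 HD).
Qed.

Lemma tq_inj t t' m : section CM t -> section CM t' ->
  tq t (vzero QM m) = tq t' (vzero QM m) -> t m = t' m.
Proof. by move=> Ht Ht'; rewrite !tq0//; exact: core_inj. Qed.

Lemma nablaC_D b b' tau m : section BM b -> section BM b' -> section CM tau ->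
  nablaC (sadd BM b b') tau m = vadd CM (nablaC b tau m) (nablaC b' tau m).
Proof.
move=> Hb Hb' Ht; have Hbb := sadd_section HBM Hb Hb'.
have N1 := nablaC_section HP' Hb Ht; have N2 := nablaC_section HP' Hb' Ht.
apply: (tq_inj (nablaC_section HP' Hbb Ht) (sadd_section HCM N1 N2)).
rewrite -nablaC_br//.
have -> : sigma (sadd BM b b') = sadd EQ (sigma b) (sigma b').
  apply/funext => q; have [_ pb] := Hb; have [_ pb'] := Hb'.
  by rewrite /sigmaB /sadd (split_DQ HS) ?pb ?pb'.
have [[_ _ [_ HD' _]] _] := HL.
rewrite (HD' _ _ _ (sigmaB_section HD HS Hb) (sigmaB_section HD HS Hb')
  (core_sectionQ_section HD Ht)).1 /sadd !nablaC_br//.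
have [_ p1] := N1; have [_ p2] := N2.
rewrite !tq0//; last exact: sadd_section.
by rewrite (coreQ_D HD) ?p1 ?p2.
Qed.

(** The lift sigma_B is linear over functions from M. The Leibniz rule is used after exchanging the
    arguments; its extra term contains the anchor of a core section, which annihilates functions
    from M. *)
Lemma nablaC_Z f b tau m : sfun f -> section BM b -> section CM tau ->
  nablaC (sscale BM f b) tau m = vscale CM (f m) (nablaC b tau m).
Proof.
move=> Hf Hb Ht; have Hfb := sscale_section HBM Hf Hb.
have N1 := nablaC_section HP' Hb Ht; have Hsb := sigmaB_section HD HS Hb.
have Htq := core_sectionQ_section HD Ht.
have Hfq : sfun (fun q => f (vproj QM q)) by exact: vproj_smooth.
apply: (tq_inj (nablaC_section HP' Hfb Ht) (sscale_section HCM Hf N1)).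
rewrite -nablaC_br//.
have -> : sigma (sscale BM f b) = sscale EQ (fun q => f (vproj QM q)) (sigma b).
  apply/funext => q; have [_ pb] := Hb.
  by rewrite /sigmaB /sscale (split_ZQ HS) ?pb.
have [_ [Hanti _ Hleib _]] := HL.
rewrite (Hanti _ _ (sscale_section HEQ Hfq Hsb) Htq).
rewrite (Hleib _ _ Htq Hsb _ Hfq) (Hanti _ _ Htq Hsb) nablaC_br// /sadd /sscale.
rewrite (rho_base HVA) // (_ : vproj EB _ = vzero BM m); last first.
  by rewrite tq0// (projEB_core HD); case: Ht => _ ->.
have -> : tval (rhoB (vzero BM m)) f = 0 := fl_0 HBM _ (rhoB_lin HVA Hf).2.
have [_ psb] := Hsb; have [_ pt] := N1.
rewrite (vscale0 HEQ) psb (vproj0 HQM) !tq0//; last exact: sscale_section.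
rewrite (vaddx0 HEQ); last by rewrite !(vprojZ HEQ) (projEQ_core HD) pt.
rewrite !(vscaleA HEQ) (coreQ_Z HD); congr vscale; ring.
Qed.

(* By [nablaC_atE] below the choice of the section through [x] is irrelevant. *)
Definition nablaC_at tau (x : B) : C :=
  nablaC (sval (cid2 (section_through HBM x))) tau (vproj BM x).

(** The section \widetilde{phi} of E -> B for phi(b) = nabla^{Q^*}_b tau. *)
Definition theta tau (x : B) : E := core_at D x (nablaC_at tau x).

Definition dual_sec tau (x : B) : E :=
  vadd EB (sigmaQ D Sg (fun m => dQ (tau m)) x) (theta tau x).

Lemma nablaC_at_proj tau x : section CM tau -> vproj CM (nablaC_at tau x) = vproj BM x.
Proof.
by move=> Ht; rewrite /nablaC_at; case: cid2 => b Hb bx /=; exact: projC.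
Qed.

Lemma theta_proj tau x : section CM tau ->
  vproj EB (theta tau x) = x /\ vproj EQ (theta tau x) = vzero QM (vproj BM x).
Proof.
move=> Ht; have H := nablaC_at_proj x Ht.
by rewrite (projEB_core_at HD)// (projEQ_core_at HD).
Qed.

Hypothesis dual_eq : forall tau b, section CM tau -> section BM b ->
  forall m x, vproj EB x = b m ->
  cpair c (vadd EB (Sg (dQ (tau m)) (b m)) (core_at D (b m) (nablaC b tau m))) x =
  rho_fun l (ell D ev tau) x.

Section DualSection.
Variable tau : M -> C.
Hypothesis Htau : section CM tau.

(** The right side of [dual_eq] depends on the section b only through the point b(m), and by
    nondegeneracy it determines the core part on the left. *)
Lemma nablaC_atE b m : section BM b -> nablaC_at tau (b m) = nablaC b tau m.
Proof.
move=> Hb; rewrite /nablaC_at; case: cid2 => b' Hb' /=.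
have [_ pb] := Hb; rewrite pb => bm.
have p1 := projC m Hb Htau; have p2 := projC m Hb' Htau.
apply: (core_at_inj HD (b := b m)); rewrite ?pb//.
have qb : vproj QM (dQ (tau m)) = vproj BM (b m).
  by have [_ ->] := dQ_section Htau; rewrite pb.
have [r1 r2] := split_proj HS qb.
have q1 : vproj EB (core_at D (b m) (nablaC b tau m)) = b m.
  by rewrite (projEB_core_at HD) ?pb.
have q2 : vproj EB (core_at D (b m) (nablaC b' tau m)) = b m.
  by rewrite (projEB_core_at HD) ?pb.
apply: (pair_inj HEB HP (metric_nondegenerate HMe)) => [|x]; first by rewrite q1.
rewrite q2 => xb.
have D1 := dual_eq Htau Hb xb.
have xb' : vproj EB x = b' m by rewrite bm.
have D2 := dual_eq Htau Hb' xb'; rewrite bm in D2.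
by move: D1; rewrite -D2 !(pairDl HP) ?r2 ?q1 ?q2// => /addrI.
Qed.

Lemma theta_section : section EB (theta tau).
Proof.
split=> [|x]; last by case: (theta_proj x Htau).
apply: (smooth_criterion HEB HB) => [f Hf|la [Hla fla]].
  by under eq_fun => x do rewrite (theta_proj x Htau).1.
apply: (sfun_local HB) => x0.
have [k [g [f [U [[[HU Hg Hf Hx _] _] Um]]]]] := exists_frame HBM (vproj BM x0).
have HUB := sopen_pull (vproj_smooth HBM) HU.
have Hn i := nablaC_section HP' (Hf i) Htau.
apply: (smooth_at_eq HB HUB Um (g := fun x =>
    \sum_i g i x * la (core_section D (nablaC (f i) tau) x))); last first.
  apply: (sfun_smooth_at HB); apply: (sfun_sum HB) => i; apply: (sfun_mul HB).
    exact: (Hg i).1.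
  by have [H _] := core_section_section HD (Hn i); exact: H _ Hla.
(* The section through x is chosen with constant coefficients in the frame, so tensoriality writes
   theta(x) as a combination of the core sections of nabla_{f_i} tau. *)
move=> x Ux; have Hgx i : @sfun R M (fun=> g i x) by exact: sfun_cst.
pose b n := lincomb BM n (\row_i g i x) f.
have Hb : section BM b := lincomb_section HBM Hgx Hf.
have bx : b (vproj BM x) = x by exact: Hx.
have -> : theta tau x = core_at D x (nablaC b tau (vproj BM x)).
  by rewrite /theta -(nablaC_atE _ Hb) bx.
have HF1 s1 s2 : section BM s1 -> section BM s2 ->
    la (core_at D x (nablaC (sadd BM s1 s2) tau (vproj BM x))) =
    la (core_at D x (nablaC s1 tau (vproj BM x))) +
    la (core_at D x (nablaC s2 tau (vproj BM x))).
  move=> H1 H2; rewrite nablaC_D// (core_atD HD) ?projC// (fl_D fla)//.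
  by rewrite !(projEB_core_at HD) ?projC.
have HF2 h s : sfun h -> section BM s ->
    la (core_at D x (nablaC (sscale BM h s) tau (vproj BM x))) =
    h (vproj BM x) * la (core_at D x (nablaC s tau (vproj BM x))).
  by move=> Hh H1; rewrite nablaC_Z// (core_atZ HD) ?projC// (fl_Z _ _ fla).
by rewrite (tensor_lincomb HBM HF1 HF2 Hgx Hf).
Qed.

Lemma dual_sec_dual : is_dual D K L tau (dual_sec tau).
Proof.
have Hsq := sigmaQ_section HD HS (dQ_section Htau); have [_ ps] := Hsq.
split; first exact: (sadd_section HEB Hsq theta_section).
move=> x; have [b Hb bx] := section_through HBM (vproj EB x).
have xb : vproj EB x = b (vproj BM (vproj EB x)) by rewrite bx.
rewrite -(dual_eq Htau Hb xb) bx; congr (cpair c (vadd _ _ _) _).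
by rewrite /theta -(nablaC_atE _ Hb) bx.
Qed.

Lemma projEQ_dual_sec x : vproj EQ (dual_sec tau x) = dQ (tau (vproj BM x)).
Proof.
have [_ ps] := sigmaQ_section HD HS (dQ_section Htau).
have [t1 t2] := theta_proj x Htau; have [_ pt] := dQ_section Htau.
rewrite (projEQ_D HD) ?ps ?t1// t2.
have [-> _] := split_proj HS (pt (vproj BM x) : _ = vproj BM x).
by rewrite (vaddx0 HQM).
Qed.

(** The anchor of E -> Q maps [sigma_B(b), tau^dagger] to a commutator of a linear and a vertical
    vector field on Q, evaluated on linear functions at the zero of Q. *)
Lemma dQ_nabla b m : section BM b ->
  dQ (nablaC b tau m) = nablaQ b (fun n => dQ (tau n)) m.
Proof.
move=> Hb; have Hq := dQ_section Htau; have [_ pq] := Hq.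
have [_ /(_ b Hb)[[Dsec DD DZ _] [_ Dl]] _ _ _] := HP'.
have [_ pD] := Dsec _ Hq; have pN := projC m Hb Htau.
have [_ _ pdQ _ _] := dQ_morph; have [_ pt] := Htau; have [_ pb] := Hb.
apply: (lin_sep HQM) => [|la Hla]; first by rewrite pdQ /= pN pD.
have [Hl fl] := Hla.
have Hlq : sfun (fun n => la (dQ (tau n))) by case: Hq => H _; exact: H _ Hl.
have Hsb := sigmaB_section HD HS Hb; have Htq := core_sectionQ_section HD Htau.
have [_ [_ _ _ Hanc]] := HL.
have := Hanc _ _ Hsb Htq _ (vzero QM m) Hl.
rewrite nablaC_br// (rho_core (nablaC_section HP' Hb Htau)) (vproj0 HQM).
rewrite (vlift_lin HQM) ?(vproj0 HQM) ?pdQ//= => ->.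
have -> : (fun q => tval (rho (tq tau q)) la) = fun q => la (dQ (tau (vproj QM q))).
  by apply/funext => q; rewrite rho_core// (vlift_lin HQM)// pdQ /= pt.
rewrite [X in X - _](_ : _ = tval (rhoB (b m)) (fun n => la (dQ (tau n)))); last first.
  apply: etrans (rho_base HVA _ Hlq) _.
  by rewrite (projEB_sigma HS)// (vproj0 HQM).
rewrite rho_core// (vproj0 HQM).
rewrite (vlift_affine HQM (b := 0) (a := tval (rhoB (b m)) (fun n => la (dQ (tau n))) -
  la (nablaQ b (fun n => dQ (tau n)) m))).
- by rewrite opprB addrC subrK.
- by rewrite (vproj0 HQM) pq.
- by case: Hsb => H _; exact: H _ (rho_fun_lin HL Hl).1.
move=> t; have Ht := sscale_section HQM (sfun_cst HM t) Hq.
rewrite (vadd0x HQM) ?(vprojZ HQM) ?pq// addr0.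
apply: etrans (Dl la Hl fl _ m Ht) _.
rewrite (DZ _ _ (sfun_cst HM t) Hq) /sadd /sscale (tval_cst HM) (vscale0 HQM).
rewrite (vaddx0 HQM) ?(vprojZ HQM) ?pq ?pD// (fl_Z _ _ fl) mulrBr; congr (_ - _).
by under eq_fun do rewrite (fl_Z _ _ fl); exact: tvalZ.
Qed.

End DualSection.

(** Both sides are the pairing of e_tau with the core element of tau' over the zero of B: once
    through the projection of e_tau to Q, once through duality and the vertical anchor of
    tau'^dagger. *)
Lemma ev_dQ_sym tau tau' m : section CM tau -> section CM tau' ->
  ev (dQ (tau m)) (tau' m) = ev (dQ (tau' m)) (tau m).
Proof.
move=> Ht Ht'; have [_ H] := dual_sec_dual Ht; have [_ pt] := Ht; have [_ pt'] := Ht'.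
have := H (tq tau' (vzero QM m)); rewrite tq0//.
rewrite (projEB_core HD) pt' -{1}(core_at0 HD) pt'.
have [_ pd] : section EB (dual_sec tau) by case: (dual_sec_dual Ht).
rewrite (pair_core HMe) ?(vproj0 HBM) ?pt'// projEQ_dual_sec// (vproj0 HBM) => ->.
rewrite -tq0// /rho_fun rho_core// (vproj0 HQM).
have [Hl fl] := ell_lin HD HMe Ht; have [_ pq] := dQ_section Ht'.
by rewrite (vlift_lin HQM)// ?(vproj0 HQM) ?pq// /ell pq.
Qed.

(** By duality the left side is rho(e_tau)(ell_tau). The split part, as a value of sigma_B(b), gives
    the right side minus <tau, nabla^Q d_Q tau>, and the core part gives <tau, d_Q nabla^{Q^*} tau>;
    the last two cancel by [dQ_nabla]. The result supplies k in [W_member]. *)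
Lemma dual_sec_norm tau x : section CM tau ->
  cpair c (dual_sec tau x) (dual_sec tau x) =
  tval (rhoB x) (fun m => ev (dQ (tau m)) (tau m)).
Proof.
move=> Ht; have [[_ pd] H] := dual_sec_dual Ht.
have -> : cpair c (dual_sec tau x) (dual_sec tau x) = rho_fun l (ell D ev tau) (dual_sec tau x).
  by rewrite -H pd.
have [b Hb bx] := section_through HBM x; have Hq := dQ_section Ht.
have Hell := ell_lin HD HMe Ht; have [Hl fl] := Hell.
set m := vproj BM x in bx *; pose q := dQ (tau m).
have [_ pq] := Hq; have qm : vproj QM q = m by exact: pq.
have qx : vproj QM q = vproj BM x by rewrite qm.
have [r1 r2] := split_proj HS qx.
have tx : theta tau x = core_at D (vproj EB (Sg q x)) (nablaC b tau m).
  by rewrite r2 /theta -(nablaC_atE Ht m Hb) bx.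
have pN := projC m Hb Ht; have [_ pt] := Ht.
rewrite /dual_sec tx (add_core_at HD) ?r1 ?qm ?pN//.
rewrite (fl_D (rho_fun_lin HL Hl).2); last by rewrite (projEQ_core_atQ HD) ?r1 ?qm ?pN.
have [_ /(_ b Hb)[[Dsec _ _ _] [_ Dl]] _ _ _] := HP'.
have -> : rho_fun l (ell D ev tau) (Sg q x) =
    tval (rhoB x) (fun n => ev (dQ (tau n)) (tau n)) -
    ev (nablaQ b (fun n => dQ (tau n)) m) (tau m).
  have := Dl _ Hl fl _ m Hq; rewrite /sigmaB pq bx => H1; apply: etrans H1 _.
  rewrite /ell; have [_ ->] := Dsec _ Hq.
  by congr (tval _ _ - _); apply/funext => n; rewrite pq.
have -> : core_atQ D q (nablaC b tau m) = tq (nablaC b tau) q.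
  by rewrite core_sectionQE qm.
rewrite /rho_fun (rho_core (nablaC_section HP' Hb Ht)) qm.
have [_ pq'] := dQ_section (nablaC_section HP' Hb Ht).
rewrite (vlift_lin HQM) ?qm ?pq'// /ell pq' dQ_nabla//.
by rewrite subrK.
Qed.

Let HC : is_degenerate_courant EB c. Proof. by case: HVC => _ _ []. Qed.

Lemma cbr_section u v : section EB u -> section EB v -> section EB (cbr c u v).
Proof. by have [[_ _ _ [H _ _] _] _] := HC; exact: H. Qed.

Lemma cD_pair k x : sfun k -> cpair c (cD c k (vproj EB x)) x = tval (canchor c x) k.
Proof. by move=> Hk; have [[_ _ _ _ H] _] := HC; case: (H k Hk). Qed.

Lemma cD_section k : sfun k -> section EB (cD c k).
Proof. by move=> Hk; have [[_ _ _ _ H] _] := HC; case: (H k Hk). Qed.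

Lemma cbr_anti u v x z : section EB u -> section EB v -> vproj EB z = x ->
  cpair c (cbr c u v x) z =
  tval (canchor c z) (spair (cpair c) u v) - cpair c (cbr c v u x) z.
Proof.
move=> Hu Hv zx; have [_ [_ _ H3 _ _]] := HC.
have [_ p1] := cbr_section Hu Hv; have [_ p2] := cbr_section Hv Hu.
rewrite -(cD_pair _ (pair_sfun HP Hu Hv)) zx -(H3 _ _ Hu Hv) /sadd.
by rewrite (pairDl HP) ?p1 ?p2// addrK.
Qed.

Lemma Theta_zeroQ x k : sfun k -> vproj EQ x = vzero QM (vproj BM (vproj EB x)) ->
  tval (canchor c x) (fun b => k (vproj BM b)) = 0.
Proof.
by move=> Hk H; rewrite (Theta_base HVC)// H (fl_0 HQM _ (rhoQ_lin HVC Hk).2).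
Qed.

(** * The bracket of a dual section with a core section *)

Section CoreBracket.
Variables tau1 tau2 : M -> C.
Hypotheses (Ht1 : section CM tau1) (Ht2 : section CM tau2).
Local Notation td := (core_section D).
Local Notation N := (nablaC (fun n => dB (tau2 n)) tau1).
Let Htd2 := core_section_section HD Ht2.
Let Hth := theta_section Ht1.
Let HdB2 : section BM (fun n => dB (tau2 n)) := dB_section dB_morph Ht2.
Let HN := nablaC_section HP' HdB2 Ht1.
Let core_core0 : forall t1 t2, section CM t1 -> section CM t2 ->
  cbr c (td t1) (td t2) = vzero EB.
Proof. by have [_ _ _ _ [_ _ H]] := HVC. Qed.

Let pair_theta_core x t : vproj CM t = vproj BM x ->
  cpair c (theta tau1 x) (core_at D x t) = 0.
Proof. by move=> tx; rewrite (pair_core_core HD HMe)// nablaC_at_proj. Qed.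

Let pair_theta_sigma q x : section QM q ->
  cpair c (theta tau1 x) (sigmaQ D Sg q x) = ev (q (vproj BM x)) (nablaC_at tau1 x).
Proof.
move=> Hq; have [_ pq] := Hq; have qx : vproj QM (q (vproj BM x)) = vproj BM x by [].
have [r1 r2] := split_proj HS qx; have [t1 t2] := theta_proj x Ht1.
by rewrite (pairC HP) ?t1 ?r2// (pair_core HMe) ?r1// nablaC_at_proj.
Qed.

(** Tested by CA2 against sigma_Q(q) and core sections. The anchor of tau2^dagger is vertical, so it
    differentiates b |-> <q, nabla_b tau1>, a linear function of b, in the direction d_B tau2. *)
Lemma core_theta_bracket x : cbr c (td tau2) (theta tau1) x = core_at D x (N (vproj BM x)).
Proof.
set m := vproj BM x; have [_ pN] := HN; have [_ pcb] := cbr_section Htd2 Hth.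
have pc : vproj EB (core_at D x (N m)) = x by rewrite (projEB_core_at HD) ?pN.
have [_ [_ CA2 _ _ _]] := HC.
apply: (pair_inj HEB HP (metric_nondegenerate HMe)) => [|z]; first by rewrite pcb pc.
rewrite pcb => zx; have [t pt Ez] := split_decomp HD HS z.
have zm : vproj QM (vproj EQ z) = m by rewrite -(proj_proj HD) zx.
have [q Hq Eq] := section_through HQM (vproj EQ z).
have [tau Ht Et] := section_through HCM t.
have Hsq := sigmaQ_section HD HS Hq; have Htd := core_section_section HD Ht.
have [_ psq] := Hsq; have [_ ptd] := Htd; have [_ pq] := Hq.
rewrite zm in Eq; rewrite pt zx -/m in Et.
have -> : z = vadd EB (sigmaQ D Sg q x) (td tau x).
  by rewrite Ez /sigmaQ core_sectionE -/m Eq Et zx.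
rewrite !(pairDr HEB HP) ?pcb ?pc ?psq ?ptd//; apply: f_equal2.
  have := CA2 _ _ _ Htd2 Hth Hsq x.
  (* Up to sign and D of a function pulled back from M, the bracket [tau2^dagger, sigma_Q(q)] is a
     core section. Elements of core type pair to zero with both. *)
  have -> : cpair c (theta tau1 x) (cbr c (td tau2) (sigmaQ D Sg q) x) = 0.
    have [t1 t2] := theta_proj x Ht1; have [_ pc2] := cbr_section Htd2 Hsq.
    rewrite (pairC HP) ?t1 ?pc2// cbr_anti ?t1//.
    have -> : spair (cpair c) (td tau2) (sigmaQ D Sg q) =
        fun b => ev (q (vproj BM b)) (tau2 (vproj BM b)).
      apply/funext => b; have [_ pt2] := Ht2.
      have qb : vproj QM (q (vproj BM b)) = vproj BM b by [].
      have [r1 r2] := split_proj HS qb.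
      by rewrite /spair core_sectionE (pairC HP) ?(projEB_core_at HD) ?pt2 ?r2//
        (pair_core HMe) ?pt2// r1.
    have E0 : vproj EQ (theta tau1 x) = vzero QM (vproj BM (vproj EB (theta tau1 x))).
      by rewrite t1.
    have -> := Theta_zeroQ (ev_sfun HD HMe Hq Ht2) E0.
    have [_ _ /(_ q tau2 Hq Ht2)[[_ pD] ->] _ _] := HPd.
    by rewrite sub0r (pairC HP) ?t1 ?(projEB_core_at HD) ?pD// pair_theta_core ?pD// oppr0.
  rewrite addr0 => <-; rewrite Theta_core// -/m.
  have [b Hb bx] := section_through HBM x; rewrite -/m in bx.
  have [_ pb2] := HdB2.
  apply: (vlift_affine HBM (b := ev (q m) (nablaC b tau1 m))).
  - by rewrite pb2.
  - exact: (pair_sfun HP Hth Hsq).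
  move=> r; have Hr := sscale_section HBM (sfun_cst HM r) HdB2.
  have pbr : vproj BM (vadd BM x (vscale BM r (dB (tau2 m)))) = m.
    by rewrite (vprojD HBM) ?(vprojZ HBM) ?pb2.
  rewrite /spair pair_theta_sigma// pbr.
  have -> : nablaC_at tau1 (vadd BM x (vscale BM r (dB (tau2 m)))) =
      vadd CM (nablaC b tau1 m) (vscale CM r (N m)).
    rewrite -(nablaC_Z _ (sfun_cst HM r) HdB2 Ht1) -nablaC_D//.
    by rewrite -(nablaC_atE Ht1 _ (sadd_section HBM Hb Hr)) /sadd /sscale bx.
  have pNb := projC m Hb Ht1.
  rewrite (ev_Dc HD HMe) ?(vprojZ HCM) ?pNb ?pN// (ev_Zc HD HMe) ?pN// addrC.
  have [r1 r2] := split_proj HS (pq m : _ = vproj BM x).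
  suff -> : cpair c (core_at D x (N m)) (sigmaQ D Sg q x) = ev (q m) (N m) by [].
  by rewrite (pairC HP) ?pc ?r2// (pair_core HMe) ?pN// r1.
have := CA2 _ _ _ Htd2 Hth Htd x; rewrite core_core0//.
have [t1 t2] := theta_proj x Ht1; have [_ pta] := Ht.
rewrite (pair0r HEB HP) ?t1// addr0 => <-.
have -> : spair (cpair c) (theta tau1) (td tau) = fun=> 0.
  by apply/funext => y; rewrite /spair pair_theta_core ?pta.
by rewrite (tval_cst HB) (pair_core_core HD HMe) ?pN ?pta.
Qed.

Definition core_br m := vsub CM (Delta (fun n => dQ (tau1 n)) tau2 m) (N m).

Lemma Delta_section q : section QM q -> section CM (Delta q tau2).
Proof. by move=> Hq; have [_ _ H _ _] := HPd; case: (H q tau2 Hq Ht2). Qed.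

Lemma core_br_section : section CM core_br.
Proof.
have HDl := Delta_section (dQ_section Ht1).
exact: (sadd_section HCM HDl (sscale_section HCM (sfun_cst HM (-1)) HN)).
Qed.

(** Since theta and tau2^dagger pair to zero, their bracket is skew and [core_theta_bracket] yields
    the term with nabla; the part sigma_Q(d_Q tau1) yields Delta by its definition. *)
Lemma dual_sec_bracket : cbr c (dual_sec tau1) (td tau2) = td core_br.
Proof.
have Hq := dQ_section Ht1; have HDl := Delta_section Hq.
have Hsq := sigmaQ_section HD HS Hq.
have [[_ _ _ [_ HDbr _] _] _] := HC.
have -> : dual_sec tau1 = sadd EB (sigmaQ D Sg (fun m => dQ (tau1 m))) (theta tau1) by [].
rewrite (HDbr _ _ _ Hsq Hth Htd2).1.
have [_ _ /(_ _ _ Hq Ht2)[_ ->] _ _] := HPd.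
have [_ pDl] := HDl; have [_ pN] := HN.
have [_ p1] := core_section_section HD HDl; have [_ p2] := cbr_section Hth Htd2.
apply/funext => x; set m := vproj BM x; have [_ pcb] := core_section_section HD core_br_section.
have pc : vproj EB (core_at D x (N m)) = x by rewrite (projEB_core_at HD) ?pN.
apply: (pair_inj HEB HP (metric_nondegenerate HMe)) => [|z].
  by rewrite pcb /sadd (vprojD HEB) p1 ?p2.
have -> : vproj EB (sadd EB (td (Delta (fun m => dQ (tau1 m)) tau2))
    (cbr c (theta tau1) (td tau2)) x) = x by rewrite /sadd (vprojD HEB) p1 ?p2.
move=> zx.
rewrite core_sectionE -/m /core_br (core_atD HD) ?(vprojZ HCM) ?pDl ?pN//.
have pa : vproj EB (core_at D x (Delta (fun n => dQ (tau1 n)) tau2 m)) = x.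
  by rewrite (projEB_core_at HD) ?pDl.
rewrite (core_atZ HD) ?pN// /sadd !(pairDl HP) ?(vprojZ HEB) ?pa ?pc ?p1 ?p2//.
congr (_ + _); rewrite (pairZl HP) ?pc// mulN1r cbr_anti//.
have -> : spair (cpair c) (theta tau1) (td tau2) = fun=> 0.
  apply/funext => y; rewrite /spair pair_theta_core//.
  by case: Ht2 => _ ->.
by rewrite (tval_cst HB) sub0r core_theta_bracket.
Qed.

End CoreBracket.

End DualSections.

(** * The degenerate Courant algebroid *)

Section CoreCourant.
Variables (R : realType) (E Q B C M : smoothSpace R) (D : dvb_ops E Q B C M).
Variables (K : vb_courant_ops E Q B C M) (L : vb_algebroid_ops E Q B M).
Hypothesis HVC : is_vb_courant D K.
Hypothesis HVA : is_vb_algebroid D L.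
Local Notation EQ := (dEQ D).
Local Notation EB := (dEB D).
Local Notation QM := (dQM D).
Local Notation BM := (dBM D).
Local Notation CM := (dCM D).
Local Notation c := (vc_courant K).
Local Notation ev := (vc_ev K).
Local Notation l := (va_lie L).
Let HD := lac_dvb HVC.
Let HMe := lac_metric HVC.
Let HP := metric_pairing HMe.
Let HEQ := dvb_EQ HD.
Let HEB := dvb_EB HD.
Let HQM := dvb_QM HD.
Let HBM := dvb_BM HD.
Let HCM := dvb_CM HD.
Let HB := vb_closedM HEB.
Let HQ := vb_closedM HEQ.
Let HM := vb_closedM HBM.
Variable Sg : Q -> B -> E.
Hypothesis HSg : is_lagrangian_splitting D (cpair c) Sg.
Let HS : is_splitting D Sg := HSg.1.
Variables (P : dorfman_rep Q B C M) (P' : two_rep Q B C M).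
Hypothesis HPd : is_dorfman_rep D K Sg P.
Hypothesis HP' : is_two_rep D L Sg P'.
Local Notation dQ := (tr_dQ P').
Local Notation Delta := (dr_Delta P).
Local Notation nablaC := (tr_nablaC P').

Let HC : is_degenerate_courant EB c. Proof. by case: HVC => _ _ []. Qed.
Local Notation td := (core_section D).

(** The element is D(k o q_B) at 0_m. The anchor of a core element annihilates k o q_B, so the
    projection of this element to Q pairs to zero with the core and vanishes; hence it lies in the
    core. *)
Lemma rho_star_exists k m : sfun k -> exists t, vproj CM t = m /\
  forall q, vproj QM q = m -> ev q t = tval (vc_rhoQ K q) k.
Proof.
move=> Hk; have Hkb : sfun (fun b => k (vproj BM b)) by exact: vproj_smooth.
pose x := cD c (fun b => k (vproj BM b)) (vzero BM m).
have [_ pcD] := cD_section HVC Hkb; have px : vproj EB x = vzero BM m := pcD _.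
have Hx z : vproj EB z = vzero BM m -> cpair c x z = tval (vc_rhoQ K (vproj EQ z)) k.
  move=> zm; rewrite -(Theta_base HVC)// -(cD_pair HVC z Hkb) zm.
  by [].
have pm : vproj QM (vproj EQ x) = m by rewrite -(proj_proj HD) px (vproj0 HBM).
have qx : vproj EQ x = vzero QM m.
  apply: (ev_injQ HD HMe HSg) => [|t tm]; first by rewrite pm (vproj0 HQM).
  have tm' : vproj CM t = m by rewrite tm.
  rewrite -(pair_core HMe px) ?(vproj0 HBM)// Hx; last first.
    by rewrite (projEB_core_at HD) ?(vproj0 HBM).
  rewrite (projEQ_core_at HD) ?(vproj0 HBM)//.
  by rewrite (fl_0 HQM _ (rhoQ_lin HVC Hk).2) (ev_0q HD HMe).
have [t xt] := core_ex HD qx px.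
have pt : vproj CM t = m.
  by move/(congr1 (fun y => vproj BM (vproj EB y))): xt;
    rewrite px (projEB_core HD) !(vproj0 HBM).
exists t; split=> // q qm.
rewrite -(pair_core0 HD HMe) ?pt// -xt (pairC HP) ?px ?(projEB_zeroQ HD) ?qm//.
by rewrite Hx ?(projEB_zeroQ HD) ?qm// (vproj0 HEQ).
Qed.

Lemma rho_star_spec k m : sfun k -> vproj CM (rho_star_d D K k m) = m /\
  forall q, vproj QM q = m -> ev q (rho_star_d D K k m) = tval (vc_rhoQ K q) k.
Proof.
move=> Hk; rewrite /rho_star_d /choose_or; case: pselect => [h|[]].
  by case: (cid h).
exact: rho_star_exists.
Qed.

Let Delta_section q tau : section QM q -> section CM tau -> section CM (Delta q tau).
Proof. by move=> Hq Ht; have [_ _ H _ _] := HPd; case: (H q tau Hq Ht). Qed.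

Let pair_td0 t q : section CM t -> cpair c (td t (vzero BM (vproj QM q))) (vzero EQ q) =
  ev q (t (vproj QM q)).
Proof.
move=> Ht; have [_ pt] := Ht; rewrite (td0 HVC)// (pairC HP).
  by rewrite (pair_core0 HD HMe) ?pt.
by rewrite (projEB_core HD) (projEB_zeroQ HD) pt.
Qed.

(* The defect of linearity of [Delta] in [q]; dividing it by [ev q tau] shows
   that [rho_star_d] is smooth. *)
Lemma Delta_scale f q tau m : sfun f -> section QM q -> section CM tau ->
  Delta (sscale QM f q) tau m =
  vadd CM (vscale CM (f m) (Delta q tau m))
    (vscale CM (ev (q m) (tau m)) (rho_star_d D K f m)).
Proof.
move=> Hf Hq Ht; have Hfq := sscale_section HQM Hf Hq.
have HDl := Delta_section Hq Ht; have HDf := Delta_section Hfq Ht.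
have [_ pD] := HDl; have [_ pDf] := HDf; have [pr Hr] := rho_star_spec m Hf.
have [_ pq] := Hq; have [_ pt] := Ht.
apply: (ev_injC HD HMe) => [|q' qm].
  by rewrite (vprojD HCM) !(vprojZ HCM) ?pD ?pDf ?pr.
rewrite pDf in qm.
rewrite (ev_Dc HD HMe) ?(vprojZ HCM) ?pD ?pr// !(ev_Zc HD HMe) ?pD ?pr// Hr//.
have Htd := core_section_section HD Ht.
have Hsq := sigmaQ_section HD HS Hq; have Hsf := sigmaQ_section HD HS Hfq.
have [_ psq] := Hsq; have [_ psf] := Hsf.
have pz : vproj EB (vzero EQ q') = vzero BM m by rewrite (projEB_zeroQ HD) qm.
have E1 q0 : section QM q0 -> ev q' (Delta q0 tau m) =
    cpair c (cbr c (sigmaQ D Sg q0) (td tau) (vzero BM m)) (vzero EQ q').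
  move=> H0; have [_ _ /(_ _ _ H0 Ht)[_ ->] _ _] := HPd.
  by rewrite -qm pair_td0//; exact: Delta_section.
have Esp q0 : section QM q0 -> spair (cpair c) (sigmaQ D Sg q0) (td tau) =
    fun b => ev (q0 (vproj BM b)) (tau (vproj BM b)).
  move=> [_ p0]; apply/funext => b.
  have [r1 r2] := split_proj HS (p0 (vproj BM b) : _ = vproj BM b).
  by rewrite /spair core_sectionE (pair_core HMe) ?r1 ?r2 ?pt.
have E2 : spair (cpair c) (sigmaQ D Sg (sscale QM f q)) (td tau) =
    fun b => f (vproj BM b) * spair (cpair c) (sigmaQ D Sg q) (td tau) b.
  rewrite !Esp//; apply/funext => b.
  by rewrite /sscale (ev_Zq HD HMe) ?pq ?pt.
have Es : sigmaQ D Sg (sscale QM f q) = sscale EB (fun b => f (vproj BM b)) (sigmaQ D Sg q).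
  apply/funext => b; rewrite /sigmaQ /sscale (split_ZB HS)//.
have Hfb : sfun (fun b => f (vproj BM b)) by exact: vproj_smooth.
rewrite (E1 _ Hfq) (E1 _ Hq) (cbr_anti HVC Hsf Htd pz) (cbr_anti HVC Hsq Htd pz) E2.
rewrite (tvalM _ Hfb (pair_sfun HP Hsq Htd)) (Theta_base HVC _ Hf) (vproj0 HEQ) Es.
have [_ [_ _ _ _ Hleib]] := HC.
have [_ pc] := cbr_section HVC Htd Hsq.
rewrite (Hleib _ _ Htd Hsq _ Hfb) /sadd /sscale (vproj0 HBM).
have [_ ptd] := Htd.
rewrite (pairDl HP) ?(vprojZ HEB) ?pc ?psq ?pz// !(pairZl HP) ?pc ?psq ?pz//.
have -> : tval (canchor c (td tau (vzero BM m))) (fun b => f (vproj BM b)) = 0.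
  apply: (Theta_zeroQ HVC) => //.
  by rewrite (td0 HVC)// (projEQ_core HD) (projEB_core HD) (vproj0 HBM).
have -> : tpt (canchor c (vzero EQ q')) = vzero BM m by rewrite (tpt_Theta HVC) pz.
rewrite (vproj0 HBM) Esp//= (vproj0 HBM); ring.
Qed.

(** Where some ev q tau is nonzero, [Delta_scale] is solved for [rho_star_d]. At any other point the
    core fibre is zero, hence zero nearby. *)
Lemma rho_star_section k : sfun k -> section CM (rho_star_d D K k).
Proof.
move=> Hk; have pr m : vproj CM (rho_star_d D K k m) = m by case: (rho_star_spec m Hk).
apply: (section_criterion HCM pr) => la Hla; have [Hl fl] := Hla.
apply: (sfun_local HM) => m.
have [[q [tau [Hq Ht n0]]]|no] :=
  pselect (exists q tau, [/\ section QM q, section CM tau & ev (q m) (tau m) <> 0]).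
  have He := ev_sfun HD HMe Hq Ht.
  have HU : sopen (fun n => ev (q n) (tau n) <> 0).
    by move=> x Ux; exists (fun n => ev (q n) (tau n)).
  have Hfq := sscale_section HQM Hk Hq.
  have [D1 pD1] := Delta_section Hfq Ht; have [D2 pD2] := Delta_section Hq Ht.
  apply: (smooth_at_eq HM HU n0 (g := fun n => (ev (q n) (tau n))^-1 *
      (la (Delta (sscale QM k q) tau n) - k n * la (Delta q tau n)))) => [n n1|].
    rewrite Delta_scale// (fl_D fl) ?(vprojZ HCM) ?pD2 ?pr// !(fl_Z _ _ fl).
    by rewrite addrC addKr mulKf//; apply/eqP.
  apply: (smooth_at_mul HM); first exact: (smooth_at_inv HM).
  apply: (sfun_smooth_at HM); apply: (sfun_sub HM); first exact: D1.
  by apply: (sfun_mul HM) => //; exact: D2.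
have C0 t : vproj CM t = m -> t = vzero CM m.
  move=> tm; apply: (ev_injC HD HMe) => [|p pm]; first by rewrite (vproj0 HCM).
  have [q Hq Eq] := section_through HQM p; have [tau Ht Et] := section_through HCM t.
  rewrite tm in pm Et; rewrite pm in Eq; rewrite (ev_0c HD HMe)//.
  by apply: contra_notP no => n0; exists q, tau; split=> //; rewrite Eq Et.
have [U [HU Um Uz]] := zero_fibre_near HCM C0.
apply: (smooth_at_eq HM HU Um (g := fun=> 0)) => [n Un|].
  by rewrite (Uz (rho_star_d D K k n)) ?pr// (fl_0 HCM _ fl).
exact: (sfun_smooth_at HM) (sfun_cst HM 0).
Qed.

Hypothesis dual_eq : forall tau b, section CM tau -> section BM b ->
  forall m x, vproj EB x = b m ->
  cpair c (vadd EB (Sg (dQ (tau m)) (b m)) (core_at D (b m) (nablaC b tau m))) x =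
  rho_fun l (ell D ev tau) x.
Local Notation e := (dual_sec HVC Sg P').
Local Notation cb := (core_br D P P').
Let e_dual tau (Ht : section CM tau) : is_dual D K L tau (e tau) :=
  dual_sec_dual HVC HVA HSg HP' dual_eq Ht.
Let cb_section t t' (Ht : section CM t) (Ht' : section CM t') : section CM (cb t t') :=
  core_br_section HVC HPd HP' Ht Ht'.
Let td_section t (Ht : section CM t) : section EB (td t) := core_section_section HD Ht.

Lemma dual_unique tau u v : is_dual D K L tau u -> is_dual D K L tau v -> u = v.
Proof.
move=> [[_ pu] Hu] [[_ pv] Hv]; apply/funext => x.
apply: (pair_inj HEB HP (metric_nondegenerate HMe)) => [|z]; first by rewrite pu pv.
by rewrite pu => zx; rewrite -zx Hu Hv.
Qed.

Lemma td_inj t t' : section CM t -> section CM t' -> td t = td t' -> t = t'.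
Proof.
move=> Ht Ht' E1; apply/funext => m; apply: (core_inj HD).
by rewrite -!(td0 HVC)// E1.
Qed.

(** Any dual section may take the place of e_tau1, whether it arises as a bracket or from another
    splitting. The Jacobi identity uses the first case, independence of the splitting the second. *)
Lemma core_brE t1 t2 u : section CM t1 -> section CM t2 -> is_dual D K L t1 u ->
  cbr c u (td t2) = td (cb t1 t2).
Proof.
move=> H1 H2 Hu; rewrite (dual_unique Hu (e_dual H1)).
exact: (dual_sec_bracket HVC HVA HSg HPd HP' dual_eq).
Qed.

Let ell_fun t (Ht : section CM t) : sfun (ell D ev t) := (ell_lin HD HMe Ht).1.

Lemma dual_comb r t t' u u' : section CM t -> section CM t' ->
  is_dual D K L t u -> is_dual D K L t' u' ->
  is_dual D K L (sadd CM (sscale CM (fun=> r) t) t') (sadd EB (sscale EB (fun=> r) u) u').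
Proof.
move=> Ht Ht' [Hu Du] [Hu' Du']; have [_ pu] := Hu; have [_ pu'] := Hu'.
have [_ pt] := Ht; have [_ pt'] := Ht'.
have Hru := sscale_section HEB (sfun_cst HB r) Hu; split; first exact: sadd_section.
move=> x; rewrite /sadd /sscale (pairDl HP) ?(vprojZ HEB) ?pu ?pu'// (pairZl HP) ?pu//.
rewrite Du Du' /rho_fun.
have -> : ell D ev (fun m => vadd CM (vscale CM r (t m)) (t' m)) =
    fun q => r * ell D ev t q + ell D ev t' q.
  apply/funext => q; rewrite /ell (ev_Dc HD HMe) ?(vprojZ HCM) ?pt ?pt'//.
  by rewrite (ev_Zc HD HMe) ?pt.
rewrite tvalD; [|exact: (sfun_mul HQ (sfun_cst HQ r) (ell_fun Ht))|exact: ell_fun].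
by rewrite tvalZ//; exact: ell_fun.
Qed.

Lemma td_comb r t t' : section CM t -> section CM t' ->
  td (sadd CM (sscale CM (fun=> r) t) t') = sadd EB (sscale EB (fun=> r) (td t)) (td t').
Proof.
move=> [_ pt] [_ pt']; apply/funext => x.
rewrite /sadd /sscale !core_sectionE (core_atD HD) ?(vprojZ HCM) ?pt ?pt'//.
by rewrite (core_atZ HD) ?pt.
Qed.

Let bilin : is_bilinear_bracket EB (cbr c). Proof. by have [[_ _ _ H _] _] := HC. Qed.

(** A combination of dual sections is dual to the combination, so linearity descends from the
    bracket of E through the injective map tau |-> tau^dagger. *)
Lemma core_br_combl r t t' s : section CM t -> section CM t' -> section CM s ->
  cb (sadd CM (sscale CM (fun=> r) t) t') s =
  sadd CM (sscale CM (fun=> r) (cb t s)) (cb t' s).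
Proof.
move=> Ht Ht' Hs; have Hr : sfun (fun _ : M => r) := sfun_cst HM r.
have Hrt := sscale_section HCM Hr Ht; have Hc := sadd_section HCM Hrt Ht'.
have H1 := cb_section Ht Hs; have H2 := cb_section Ht' Hs.
have Hrc := sscale_section HCM Hr H1; have Hd := sadd_section HCM Hrc H2.
apply: (td_inj (cb_section Hc Hs) Hd).
have De := dual_comb r Ht Ht' (e_dual Ht) (e_dual Ht').
rewrite -(core_brE Hc Hs De) td_comb//.
rewrite -(core_brE Ht Hs (e_dual Ht)) -(core_brE Ht' Hs (e_dual Ht')).
have [[Hu _] [Hu' _]] := (e_dual Ht, e_dual Ht').
have Hru := sscale_section HEB (sfun_cst HB r) Hu; have [_ b1 b2] := bilin.
by rewrite (b1 _ _ _ Hru Hu' (td_section Hs)).1 (b2 _ _ _ Hu (td_section Hs)).1.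
Qed.

Lemma core_br_combr r t t' s : section CM t -> section CM t' -> section CM s ->
  cb s (sadd CM (sscale CM (fun=> r) t) t') =
  sadd CM (sscale CM (fun=> r) (cb s t)) (cb s t').
Proof.
move=> Ht Ht' Hs; have Hr : sfun (fun _ : M => r) := sfun_cst HM r.
have Hrt := sscale_section HCM Hr Ht; have Hc := sadd_section HCM Hrt Ht'.
have H1 := cb_section Hs Ht; have H2 := cb_section Hs Ht'.
have Hrc := sscale_section HCM Hr H1; have Hd := sadd_section HCM Hrc H2.
apply: (td_inj (cb_section Hs Hc) Hd).
have De := e_dual Hs; have [Hu _] := De.
rewrite -(core_brE Hs Hc De) !td_comb//.
rewrite -(core_brE Hs Ht De) -(core_brE Hs Ht' De).
have Hrd := sscale_section HEB (sfun_cst HB r) (td_section Ht); have [_ b1 b2] := bilin.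
by rewrite (b1 _ _ _ Hrd (td_section Ht') Hu).2 (b2 _ _ _ Hu (td_section Ht)).2.
Qed.

Lemma core_br_bilinear : is_bilinear_bracket CM cb.
Proof.
split; first exact: cb_section.
  move=> t t' s Ht Ht' Hs; split.
    apply: (comb_linear HCM (G := fun t => cb t s) _ _).1 => // [u Hu|r u u' Hu Hu'].
      exact: cb_section.
    exact: core_br_combl.
  apply: (comb_linear HCM (G := cb s) _ _).1 => // [u Hu|r u u' Hu Hu'].
    exact: cb_section.
  exact: core_br_combr.
move=> r t s Ht Hs; split.
  apply: (comb_linear HCM (G := fun t => cb t s) _ _).2 => // [u Hu|r' u u' Hu Hu'].
    exact: cb_section.
  exact: core_br_combl.
apply: (comb_linear HCM (G := cb t) _ _).2 => // [u Hu|r' u u' Hu Hu'].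
  exact: cb_section.
exact: core_br_combr.
Qed.

Lemma dual_proj tau u m : section CM tau -> is_dual D K L tau u ->
  vproj EQ (u (vzero BM m)) = dQ (tau m).
Proof.
move=> Ht Hu; rewrite (dual_unique Hu (e_dual Ht)).
by rewrite (projEQ_dual_sec HVC HSg HP' Ht) (vproj0 HBM).
Qed.

Hypothesis br_dual : forall t1 t2, section CM t1 -> section CM t2 ->
  is_dual D K L (cb t1 t2) (cbr c (e t1) (e t2)).
Hypothesis br_sym : forall t1 t2, section CM t1 -> section CM t2 -> forall q,
  ell D ev (cb t1 t2) q =
  cpair c (cbr c (td t1) (e t2) (vzero BM (vproj QM q))) (vzero EQ q).

(** The Jacobi identity of E for e_tau1, e_tau2 and tau3^dagger. The inner bracket [e_tau1, e_tau2]
    is a dual section by [br_dual], so [core_brE] applies to its bracket with tau3^dagger. *)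
Lemma core_jacobi : jacobi CM cb.
Proof.
move=> t1 t2 t3 H1 H2 H3; have H12 := cb_section H1 H2.
have H23 := cb_section H2 H3; have H13 := cb_section H1 H3.
have HA := cb_section H1 H23; have HB' := cb_section H12 H3; have HC' := cb_section H2 H13.
have [D1 D2] := (e_dual H1, e_dual H2).
apply: (td_inj HA (sadd_section HCM HB' HC')).
have Eadd : td (sadd CM (cb (cb t1 t2) t3) (cb t2 (cb t1 t3))) =
    sadd EB (td (cb (cb t1 t2) t3)) (td (cb t2 (cb t1 t3))).
  have [_ pB] := HB'; have [_ pC] := HC'; apply/funext => x.
  by rewrite /sadd !core_sectionE (core_atD HD) ?pB ?pC.
rewrite Eadd -(core_brE H1 H23 D1) -(core_brE H2 H3 D2).
rewrite -(core_brE H12 H3 (br_dual H1 H2)) -(core_brE H2 H13 D2) -(core_brE H1 H3 D1).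
have [_ [Hj _ _ _ _]] := HC.
exact: (Hj _ _ _ D1.1 D2.1 (td_section H3)).
Qed.

Let pair_dual_td t1 t2 x : section CM t1 -> section CM t2 ->
  cpair c (e t1 x) (td t2 x) = ev (dQ (t1 (vproj BM x))) (t2 (vproj BM x)).
Proof.
move=> H1 [_ p2]; have [[_ pe] _] := e_dual H1.
by rewrite core_sectionE (pair_core HMe) ?p2// (projEQ_dual_sec HVC HSg HP' H1).
Qed.

(** CA2 of E for e_tau1, e_tau3 and tau2^dagger over the zero of B, where dual sections project to
    d_Q of their core sections. *)
Lemma core_invariant t1 t2 t3 m : section CM t1 -> section CM t2 -> section CM t3 ->
  tval (vc_rhoQ K (dQ (t1 m))) (fun n => ev (dQ (t3 n)) (t2 n)) =
  ev (dQ (t3 m)) (cb t1 t2 m) + ev (dQ (cb t1 t3 m)) (t2 m).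
Proof.
move=> H1 H2 H3; have H12 := cb_section H1 H2; have H13 := cb_section H1 H3.
have [D1 D3] := (e_dual H1, e_dual H3); have [_ [_ CA2 _ _ _]] := HC.
have := CA2 _ _ _ D1.1 D3.1 (td_section H2) (vzero BM m).
rewrite (core_brE H1 H2 D1).
have -> : spair (cpair c) (e t3) (td t2) =
    fun x => ev (dQ (t3 (vproj BM x))) (t2 (vproj BM x)).
  by apply/funext => x; exact: pair_dual_td.
have Hs := ev_sfun HD HMe (dQ_section HP' H3) H2.
have -> := Theta_base HVC (e t1 (vzero BM m)) Hs.
rewrite (dual_proj m H1 D1) pair_dual_td// (vproj0 HBM) => ->; rewrite addrC.
congr (_ + _); have Db := br_dual H1 H3; have [[_ pb] _] := Db; have [_ p2] := H2.
by rewrite core_sectionE (pair_core HMe) ?p2// (vproj0 HBM) (dual_proj m H13 Db).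
Qed.

(** By [br_sym] the first bracket is represented by [tau1^dagger, e_tau2]. CA3 of E turns it into
    -[e_tau2, tau1^dagger] plus D of a function from M, and D pairs with 0_q as the derivative along
    rho_Q(q). *)
Lemma core_skew t1 t2 : section CM t1 -> section CM t2 ->
  sadd CM (cb t1 t2) (cb t2 t1) = rho_star_d D K (fun m => ev (dQ (t2 m)) (t1 m)).
Proof.
move=> H1 H2; have H12 := cb_section H1 H2; have H21 := cb_section H2 H1.
have [_ p12] := H12; have [_ p21] := H21; have Hk := ev_sfun HD HMe (dQ_section HP' H2) H1.
apply/funext => m; have [pr Hr] := rho_star_spec m Hk.
apply: (ev_injC HD HMe) => [|q]; rewrite /sadd (vprojD HCM) ?p12 ?p21// => qm.
rewrite (ev_Dc HD HMe) ?p12 ?p21// Hr//.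
have := br_sym H1 H2 q; rewrite {1}/ell qm => ->.
have D2 := e_dual H2; have Htd := td_section H1.
rewrite (cbr_anti HVC Htd D2.1); last by rewrite (projEB_zeroQ HD) qm.
have E2 : cpair c (td (cb t2 t1) (vzero BM m)) (vzero EQ q) = ev q (cb t2 t1 m).
  by rewrite -qm pair_td0.
rewrite (core_brE H2 H1 D2) E2 subrK.
have -> : spair (cpair c) (td t1) (e t2) =
    fun x => ev (dQ (t2 (vproj BM x))) (t1 (vproj BM x)).
  apply/funext => x; rewrite /spair (pairC HP); first exact: pair_dual_td.
  by case: Htd => _ ->; case: D2 => -[_ ->].
have -> := Theta_base HVC (vzero EQ q) Hk.
by rewrite (vproj0 HEQ).
Qed.

(** CA4 of E for e_tau1 and e_tau2 on functions pulled back from M, on which the anchor of e_tau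
    acts as rho_Q(d_Q tau). *)
Lemma core_anchor t1 t2 f m : section CM t1 -> section CM t2 -> sfun f ->
  tval (vc_rhoQ K (dQ (cb t1 t2 m))) f =
  tval (vc_rhoQ K (dQ (t1 m))) (fun n => tval (vc_rhoQ K (dQ (t2 n))) f) -
  tval (vc_rhoQ K (dQ (t2 m))) (fun n => tval (vc_rhoQ K (dQ (t1 n))) f).
Proof.
move=> H1 H2 Hf; have [D1 D2] := (e_dual H1, e_dual H2).
have H12 := cb_section H1 H2; have Hfb : sfun (fun x => f (vproj BM x)) by exact: vproj_smooth.
have [_ [_ _ _ Hanc _]] := HC.
have := Hanc _ _ D1.1 D2.1 _ (vzero BM m) Hfb.
rewrite (Theta_base HVC _ Hf) (dual_proj m H12 (br_dual H1 H2)) => ->.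
have T t : section CM t -> (fun x => tval (canchor c (e t x)) (fun x => f (vproj BM x))) =
    fun x => tval (vc_rhoQ K (dQ (t (vproj BM x)))) f.
  move=> Ht; apply/funext => x; rewrite (Theta_base HVC _ Hf).
  by rewrite (projEQ_dual_sec HVC HSg HP' Ht).
have Hs t : section CM t -> sfun (fun n => tval (vc_rhoQ K (dQ (t n))) f).
  move=> Ht; have [Hq _] := dQ_section HP' Ht.
  exact: Hq _ (rhoQ_lin HVC Hf).1.
rewrite (T _ H1) (T _ H2).
have -> := Theta_base HVC (e t1 (vzero BM m)) (Hs _ H2).
have -> := Theta_base HVC (e t2 (vzero BM m)) (Hs _ H1).
by rewrite (dual_proj m H1 D1) (dual_proj m H2 D2).
Qed.

Lemma core_leibniz t1 t2 f : section CM t1 -> section CM t2 -> sfun f ->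
  cb t1 (sscale CM f t2) = sadd CM (sscale CM f (cb t1 t2))
    (sscale CM (fun n => tval (vc_rhoQ K (dQ (t1 n))) f) t2).
Proof.
move=> H1 H2 Hf; have D1 := e_dual H1; have H12 := cb_section H1 H2.
have Hf2 := sscale_section HCM Hf H2; have Hf12 := sscale_section HCM Hf H12.
have Hr : sfun (fun n => tval (vc_rhoQ K (dQ (t1 n))) f).
  by have [Hq _] := dQ_section HP' H1; exact: Hq _ (rhoQ_lin HVC Hf).1.
have Hr2 := sscale_section HCM Hr H2.
apply: (td_inj (cb_section H1 Hf2) (sadd_section HCM Hf12 Hr2)).
rewrite -(core_brE H1 Hf2 D1); have [_ p2] := H2; have [_ p12] := H12.
have Etd g t : section CM t -> td (sscale CM g t) = sscale EB (fun x => g (vproj BM x)) (td t).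
  move=> [_ pt]; apply/funext => x.
  by rewrite /sscale !core_sectionE (core_atZ HD) ?pt.
have Hfb : sfun (fun x => f (vproj BM x)) by exact: vproj_smooth.
have [_ [_ _ _ _ Hleib]] := HC.
rewrite (Etd _ _ H2) (Hleib _ _ D1.1 (td_section H2) _ Hfb) (core_brE H1 H2 D1).
apply/funext => x; rewrite /sadd /sscale !core_sectionE.
rewrite (core_atD HD) ?(vprojZ HCM) ?p2 ?p12// !(core_atZ HD) ?p2 ?p12//.
by rewrite (Theta_base HVC _ Hf) (projEQ_dual_sec HVC HSg HP' H1).
Qed.

Lemma core_degenerate_courant : is_degenerate_courant CM (core_courant D K P P').
Proof.
have [HdQs _ pdQ HdQD HdQZ] := dQ_morph HP'.
have [_ _ _ [_ _ Hrho _] _] := HVC; have [Hrs _ Hrp HrD HrZ] := Hrho.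
have pC x : vproj QM (dQ x) = vproj CM x by exact: pdQ.
split; split.
- exact: HCM.
- split=> //=.
  + by move=> f Hf; exact: HdQs _ (Hrs _ Hf).
  + by move=> x; rewrite [LHS]Hrp pC.
  + by move=> x y xy; rewrite HdQD// HrD//= !pC.
  + by move=> t x; rewrite HdQZ HrZ.
- split=> /=.
  + move=> x y xy; have [t Ht tx] := section_through HCM x.
    have [t' Ht' ty] := section_through HCM y.
    rewrite -tx -ty -xy.
    exact: (ev_dQ_sym HVC HVA HSg HP' dual_eq _ Ht' Ht).
  + by move=> x y z xy yz; rewrite (ev_Dc HD HMe) ?pC// ?xy ?yz.
  + by move=> t x y xy; rewrite (ev_Zc HD HMe) ?pC// xy.
  + move=> s1 s2 H1 H2; exact: (ev_sfun HD HMe (dQ_section HP' H2) H1).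
- exact: core_br_bilinear.
- move=> f Hf; split=> [|x /=]; first exact: rho_star_section.
  have [_ Hr] := rho_star_spec (vproj CM x) Hf; apply: Hr.
  exact: pC.
- exact: core_jacobi.
- move=> t1 t2 t3 H1 H2 H3 m; exact: core_invariant.
- by move=> t1 t2 H1 H2; exact: core_skew.
- by move=> t1 t2 H1 H2 f m Hf; exact: core_anchor.
- by move=> t1 t2 H1 H2 f Hf; exact: core_leibniz.
Qed.

End CoreCourant.

(** * The core of an LA-Courant algebroid *)

Section CoreOfLACourant.
Variables (R : realType) (E Q B C M : smoothSpace R) (D : dvb_ops E Q B C M).
Variables (K : vb_courant_ops E Q B C M) (L : vb_algebroid_ops E Q B M).
Hypothesis HLA : is_la_courant D K L.
Local Notation EB := (dEB D).
Local Notation QM := (dQM D).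
Local Notation BM := (dBM D).
Local Notation CM := (dCM D).
Local Notation c := (vc_courant K).
Local Notation ev := (vc_ev K).
Local Notation l := (va_lie L).
Local Notation td := (core_section D).
Local Notation lagr := (is_lagrangian_splitting D (cpair c)).
Let HVC : is_vb_courant D K. Proof. by case: HLA. Qed.
Let HVA : is_vb_algebroid D L. Proof. by case: HLA. Qed.
Let HD := lac_dvb HVC.
Let HMe := lac_metric HVC.
Let HQM := dvb_QM HD.
Let HCM := dvb_CM HD.

Lemma la_dual_eq Sg P' : lagr Sg -> is_two_rep D L Sg P' ->
  forall tau b, section CM tau -> section BM b -> forall m x, vproj EB x = b m ->
  cpair c (vadd EB (Sg (tr_dQ P' (tau m)) (b m))
    (core_at D (b m) (tr_nablaC P' b tau m))) x = rho_fun l (ell D ev tau) x.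
Proof.
move=> HSg HP' tau b Ht Hb m x xb.
have [_ _ [cT [cP [HT HPr [S [_ HS1 HS2 HS3]]]]]] := HLA.
exact: (dual_formula HVC HVA HT HPr HS1 HS2 HSg HP' Ht Hb xb).
Qed.

Section Splitting.
Variables (Sg : Q -> B -> E) (P : dorfman_rep Q B C M) (P' : two_rep Q B C M).
Hypothesis HSg : lagr Sg.
Hypothesis HP : is_dorfman_rep D K Sg P.
Hypothesis HP' : is_two_rep D L Sg P'.
Local Notation cb := (core_br D P P').
Local Notation e := (dual_sec HVC Sg P').
Let dual_eq := la_dual_eq HSg HP'.
Let e_dual tau (Ht : section CM tau) : is_dual D K L tau (e tau) :=
  dual_sec_dual HVC HVA HSg HP' dual_eq Ht.
Let e_br t t' (Ht : section CM t) (Ht' : section CM t') :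
  cbr c (e t) (td t') = td (cb t t') := dual_sec_bracket HVC HVA HSg HP HP' dual_eq Ht Ht'.
Let cb_section t t' (Ht : section CM t) (Ht' : section CM t') : section CM (cb t t') :=
  core_br_section HVC HP HP' Ht Ht'.

Lemma la_core_courant : is_degenerate_courant CM (core_courant D K P P').
Proof.
have [_ _ [cT [cP [HT HPr [S [_ HS1 HS2 HS3]]]]]] := HLA.
apply: (core_degenerate_courant (HVC := HVC) HVA HSg HP HP' dual_eq) => t1 t2 H1 H2.
  apply: (dual_bracket HVC HVA HT HPr HS1 HS2 HS3 H1 H2 (e_dual H1) (e_dual H2)
    (cb_section H1 H2) (e_br H1 H2) (k := fun m => ev (tr_dQ P' (t1 m)) (t1 m))).
    exact: (ev_sfun HD HMe (dQ_section HP' H1) H1).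
  by move=> b; exact: (dual_sec_norm HVC HVA HSg HP' dual_eq).
exact: (dual_bracket_sym HVC HVA HT HPr HS1 HS2 HS3 H1 H2 (e_dual H1) (e_dual H2)
    (cb_section H1 H2) (e_br H1 H2)).
Qed.

Lemma la_dB_bracket tau1 tau2 : section CM tau1 -> section CM tau2 ->
  (fun m => dr_dB P (cb tau1 tau2 m)) =
  lbr (va_base L) (fun m => dr_dB P (tau1 m)) (fun m => dr_dB P (tau2 m)).
Proof.
move=> H1 H2; apply/funext => m.
have [_ _ [cT [cP [HT HPr [S [_ HS1 HS2 HS3]]]]]] := HLA.
exact: (dB_bracket HVC HVA HT HPr HS1 HS2 HS3 (dB_morph HP) H1 (Theta_core HP)
  (e_dual H1) HSg.1 m H2 (cb_section H1 H2) (e_br H1 H2)).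
Qed.

Lemma la_dB_anchor t :
  lanchor (va_base L) (dr_dB P t) = vc_rhoQ K (tr_dQ P' t).
Proof.
have [_ _ [cT [cP [HT HPr [S [_ HS1 HS2 HS3]]]]]] := HLA.
have [_ _ pdB _ _] := dB_morph HP; have [_ _ pdQ _ _] := dQ_morph HP'.
have [_ _ _ [_ _ [_ _ Hrp _ _] _] _] := HVC.
have [tau Ht tm] := section_through HCM t; set m := vproj CM t in tm.
apply: tvec_eq => [|f Hf].
  by rewrite (tpt_rhoB HVC HVA) pdB [RHS]Hrp pdQ.
rewrite -tm.
rewrite (anchor_compat HVC HVA HT HPr HS1 HS2 HS3 (dB_morph HP) Ht (Theta_core HP)
  (e_dual Ht) m Hf).
by rewrite (dual_proj HVC HVA HSg HP' dual_eq m Ht (e_dual Ht)).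
Qed.

End Splitting.

(** The map d_Q is determined by the vertical anchors of core sections. For the brackets, [core_brE]
    is applied in both splittings to one and the same dual section. *)
Lemma la_same_courant Sg P P' Sg1 P1 P1' :
  lagr Sg -> is_dorfman_rep D K Sg P -> is_two_rep D L Sg P' ->
  lagr Sg1 -> is_dorfman_rep D K Sg1 P1 -> is_two_rep D L Sg1 P1' ->
  same_courant CM (core_courant D K P P') (core_courant D K P1 P1').
Proof.
move=> HSg HP HP' HSg1 HP1 HP1'.
have dQE t : tr_dQ P' t = tr_dQ P1' t.
  have [tau Ht tm] := section_through HCM t; set m := vproj CM t in tm.
  have [_ p1] := dQ_section HP' Ht; have [_ p2] := dQ_section HP1' Ht.
  have z : vproj QM (vzero QM m) = m by rewrite (vproj0 HQM).
  rewrite -tm; apply: (lin_sep HQM) => [|la [Hl fl]]; first by rewrite p1 p2.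
  have := rho_core HP' Ht (vzero QM m).
  rewrite (rho_core HP1' Ht) z => /(congr1 (fun v : TS Q => tval v la)) /=.
  by rewrite !(vlift_lin HQM) ?z ?p1 ?p2.
split=> //=.
- by move=> x; rewrite dQE.
- by move=> x y _; rewrite dQE.
move=> t1 t2 H1 H2.
have D1 := dual_sec_dual HVC HVA HSg HP' (la_dual_eq HSg HP') H1.
apply: (td_inj HVC (core_br_section HVC HP HP' H1 H2) (core_br_section HVC HP1 HP1' H1 H2)).
rewrite -(core_brE HVC HVA HSg HP HP' (la_dual_eq HSg HP') H1 H2 D1).
exact: (core_brE HVC HVA HSg1 HP1 HP1' (la_dual_eq HSg1 HP1') H1 H2 D1).
Qed.

End CoreOfLACourant.

Theorem theorem7p7 (R : realType) (E Q B C M : smoothSpace R)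
    (D : dvb_ops E Q B C M) (K : vb_courant_ops E Q B C M)
    (L : vb_algebroid_ops E Q B M)
    (HLA : is_la_courant D K L)
    (Sg : Q -> B -> E)
    (HSg : is_lagrangian_splitting D (cpair (vc_courant K)) Sg)
    (P : dorfman_rep Q B C M) (HP : is_dorfman_rep D K Sg P)
    (P' : two_rep Q B C M) (HP' : is_two_rep D L Sg P') :
  is_degenerate_courant (dCM D) (core_courant D K P P') /\
  (forall (Sg1 : Q -> B -> E)
      (P1 : dorfman_rep Q B C M) (P1' : two_rep Q B C M),
    is_lagrangian_splitting D (cpair (vc_courant K)) Sg1 ->
    is_dorfman_rep D K Sg1 P1 -> is_two_rep D L Sg1 P1' ->
    same_courant (dCM D) (core_courant D K P P') (core_courant D K P1 P1')) /\
  (forall tau1 tau2 : M -> C,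
    section (dCM D) tau1 -> section (dCM D) tau2 ->
    (fun m => dr_dB P (cbr (core_courant D K P P') tau1 tau2 m)) =
    lbr (va_base L) (fun m => dr_dB P (tau1 m)) (fun m => dr_dB P (tau2 m))) /\
  (forall tau : C,
    lanchor (va_base L) (dr_dB P tau) = canchor (core_courant D K P P') tau).
Proof.
split; first exact: (la_core_courant HLA HSg HP HP').
split; first by move=> Sg1 P1 P1' HSg1 HP1 HP1'; exact: (la_same_courant HLA HSg HP HP' HSg1 HP1 HP1').
split; first by move=> tau1 tau2; exact: (la_dB_bracket HLA HSg HP HP').
exact: (la_dB_anchor HLA HSg HP HP').
Qed.
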